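(* Let $(M,h)$ be a $Z^{(x,y)}$ manifold of dimension at least $2$ with an analytic metric $h$. Then $(M,h)$ is a $Y^{(x,y)}_l$ manifold for some $l>0$.
   Context: All Riemannian manifolds are smooth, connected and without boundary; geodesics are maximal. ''Analytic'' means real-analytic ($M$ is a real-analytic manifold and $h$ is a real-analytic tensor). Let $(M,h)$ be a complete Riemannian manifold and $x,y\in M$ (possibly $x=y$). $(M,h)$ is a $Z^{(x,y)}$ manifold if for every (nonconstant) geodesic $\alpha$ with $\alpha(0)=x$ there is some $t>0$ with $\alpha(t)=y$. For $l>0$, $(M,h)$ is a $Y^{(x,y)}_l$ manifold if for every geodesic $\alpha$ with $\alpha(0)=x$ and $h(\alpha'(0),\alpha'(0))=1$ we have $\alpha(l)=y$. *)

(* Defs.v *)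
From HB Require Import structures.
From mathcomp Require Import all_boot all_order all_algebra.
From mathcomp Require Import all_classical all_reals all_analysis.

Set Implicit Arguments.
Unset Strict Implicit.
Unset Printing Implicit Defensive.

Import Order.TTheory GRing.Theory Num.Theory.
Import numFieldNormedType.Exports.

Local Open Scope classical_set_scope.
Local Open Scope ring_scope.

(* MathComp-Analysis, over an arbitrary [R : realType].
   Points and tangent vectors of R^n are row vectors 'rV[R]_n, with the sup
   norm; a linear map acts on the right, so the differential of [f] at [a] is
   [v |-> v *m 'J f a]. *)

Section RealAnalytic.
Variables (R : realType) (n : nat).

(* The sum of the terms [c_m v^m] over the multi-indices [m] with |m| = k; each
   component of such an [m] is at most k. *)
Definition homog_part (c : {ffun 'I_n -> nat} -> R) (k : nat)
    (v : 'rV[R]_n) : R :=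
  \sum_(m : {ffun 'I_n -> 'I_k.+1} | (\sum_i (m i : nat))%N == k)
     c [ffun i => m i : nat] * \prod_i v 0 i ^+ m i.

(* On the polydisc of radius [r] about [a], [f] is the sum of a multivariate
   power series centred at [a]. The first condition is the summability of
   |c_m| r^|m|, i.e. absolute convergence on the closed polydisc; under it the
   order of summation is immaterial. *)
Definition analytic_at (f : 'rV[R]_n -> R) (a : 'rV[R]_n) : Prop :=
  exists (c : {ffun 'I_n -> nat} -> R) (r : R),
    [/\ 0 < r,
        cvgn (series (fun k => homog_part (fun m => `|c m|) k (const_mx r)))
      & forall u : 'rV[R]_n, `|u - a| < r ->
          series (fun k => homog_part c k (u - a)) @ \oo --> f u].

(* Meant for open [U]: only the values of [f] on [U] then matter. *)
Definition analytic_on (U : set 'rV[R]_n) (f : 'rV[R]_n -> R) : Prop :=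
  forall a, U a -> analytic_at f a.

End RealAnalytic.

(* A homeomorphism from an open subset of [M] onto an open subset of R^n. The
   two maps are total functions; their values off [chart_dom] and off the image of
   [chart_dom] are irrelevant. *)
Record chart (R : realType) (n : nat) (M : topologicalType) := Chart {
  chart_dom : set M;
  chart_map : M -> 'rV[R]_n;
  chart_inv : 'rV[R]_n -> M;
  chart_dom_open : open chart_dom;
  chart_image_open : open (chart_map @` chart_dom);
  chart_mapK : forall p, chart_dom p -> chart_inv (chart_map p) = p;
  chart_map_continuous : {within chart_dom, continuous chart_map};
  chart_inv_continuous : {within chart_map @` chart_dom, continuous chart_inv} }.

Definition transition (R : realType) (n : nat) (M : topologicalType)
    (phi psi : chart R n M) : 'rV[R]_n -> 'rV[R]_n :=
  fun u => chart_map psi (chart_inv phi u).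

(* Connected, Hausdorff, second countable, without boundary. The atlas need not
   be maximal: it generates the analytic structure, and every notion below is
   invariant under analytic changes of charts. *)
Record analyticManifold (R : realType) (n : nat) := AnalyticManifold {
  point_space :> topologicalType;
  space_hausdorff : hausdorff_space point_space;
  space_second_countable : @second_countable point_space;
  space_connected : connected [set: point_space];
  atlas : set (chart R n point_space);
  atlas_cover : forall p : point_space, exists2 phi, atlas phi & chart_dom phi p;
  atlas_analytic : forall phi psi, atlas phi -> atlas psi -> forall i,
    analytic_on (chart_map phi @` (chart_dom phi `&` chart_dom psi))
                (fun u => transition phi psi u 0 i) }.

(* [gram h phi u] is the matrix (h_ij) of the metric in the chart [phi], as a
   function of the coordinates [u]; [gram_transition] is the transformation law
   of a (0,2)-tensor. *)
Record analyticMetric (R : realType) (n : nat) (M : analyticManifold R n) :=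
  AnalyticMetric {
  gram : chart R n M -> 'rV[R]_n -> 'M[R]_n;
  gram_sym : forall phi p, atlas phi -> chart_dom phi p ->
    (gram phi (chart_map phi p))^T = gram phi (chart_map phi p);
  gram_posdef : forall phi p, atlas phi -> chart_dom phi p ->
    forall v : 'rV[R]_n, v != 0 ->
      0 < (v *m gram phi (chart_map phi p) *m v^T) 0 0;
  gram_analytic : forall phi, atlas phi -> forall i j,
    analytic_on (chart_map phi @` chart_dom phi) (fun u => gram phi u i j);
  gram_transition : forall phi psi p, atlas phi -> atlas psi ->
    chart_dom phi p -> chart_dom psi p ->
    let J := 'J (transition phi psi) (chart_map phi p) in
    gram phi (chart_map phi p) = J *m gram psi (chart_map psi p) *m J^T }.

Section Geodesics.
Variables (R : realType) (n : nat) (M : analyticManifold R n).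
Variable h : analyticMetric M.

Definition partial (i : 'I_n) (f : 'rV[R]_n -> R) (u : 'rV[R]_n) : R :=
  'D_(delta_mx 0 i) f u.

(* Gamma^k_ij of the Levi-Civita connection, in the chart [phi]. *)
Definition christoffel (phi : chart R n M) (k i j : 'I_n)
    (u : 'rV[R]_n) : R :=
  let g := gram h phi in
  2^-1 * \sum_l invmx (g u) k l *
    (partial i (fun w => g w j l) u + partial j (fun w => g w i l) u
     - partial l (fun w => g w i j) u).

Definition local_curve (phi : chart R n M) (alpha : R -> M) : R -> 'rV[R]_n :=
  fun t => chart_map phi (alpha t).

(* The components in [phi] of alpha'(t), when [alpha t] is in [chart_dom phi]. *)
Definition velocity (phi : chart R n M) (alpha : R -> M) (t : R) : 'rV[R]_n :=
  derive1 (local_curve phi alpha) t.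

Definition acceleration (phi : chart R n M) (alpha : R -> M) (t : R) :
    'rV[R]_n :=
  derive1 (velocity phi alpha) t.

(* A geodesic defined on the whole real line; constant ones are included. On a
   complete manifold these are exactly the maximal geodesics. *)
Definition geodesic (alpha : R -> M) : Prop :=
  continuous alpha /\
  forall phi t, atlas phi -> chart_dom phi (alpha t) ->
    [/\ derivable (local_curve phi alpha) t 1,
        derivable (velocity phi alpha) t 1
      & forall k, acceleration phi alpha t 0 k
          + \sum_i \sum_j christoffel phi k i j (local_curve phi alpha t)
              * velocity phi alpha t 0 i * velocity phi alpha t 0 j = 0].

(* For every p, exp_p is defined on all of T_pM. *)
Definition complete_metric : Prop :=
  forall (p : M) (phi : chart R n M) (v : 'rV[R]_n), atlas phi -> chart_dom phi p ->
    exists alpha, [/\ geodesic alpha, alpha 0 = p & velocity phi alpha 0 = v].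

(* h(alpha'(t), alpha'(t)) = 1; the left-hand side does not depend on the chart
   about [alpha t] in which it is computed. *)
Definition unit_speed_at (alpha : R -> M) (t : R) : Prop :=
  forall phi, atlas phi -> chart_dom phi (alpha t) ->
    let v := velocity phi alpha t in
    (v *m gram h phi (local_curve phi alpha t) *m v^T) 0 0 = 1.

Definition Z_manifold (x y : M) : Prop :=
  forall alpha, geodesic alpha -> (exists s, alpha s <> alpha 0) ->
    alpha 0 = x -> exists2 t : R, 0 < t & alpha t = y.

Definition Y_manifold (x y : M) (l : R) : Prop :=
  forall alpha, geodesic alpha -> alpha 0 = x -> unit_speed_at alpha 0 ->
    alpha l = y.

End Geodesics.

(* Main.v *)
Require Import Defs.
From HB Require Import structures.
From mathcomp Require Import all_boot all_order all_algebra.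
From mathcomp Require Import all_classical all_reals all_analysis.
From mathcomp Require Import ring lra.

Set Implicit Arguments.
Unset Strict Implicit.
Unset Printing Implicit Defensive.

Import Order.TTheory GRing.Theory Num.Theory.
Import numFieldNormedType.Exports.

Local Open Scope classical_set_scope.
Local Open Scope ring_scope.

(* Let [alpha_s] be unit-speed geodesics from x whose initial directions depend
   analytically on s. By the Gauss lemma, [d_s alpha_s(t)] is orthogonal to
   [d_t alpha_s(t)]. Expanding [alpha_s(t) - y] at a zero (s0, t0), the leading term
   in s - s0 would be both tangent and orthogonal to the geodesic; hence either
   [alpha_s(t0) = y] for all s near s0, or (s0, t0) is an isolated hit of y. As
   there are only countably many isolated hits but uncountably many parameters,
   some t works on an interval of parameters, and by analytic continuation for
   all s; for any other t the hits are countable.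

   The unit sphere of T_xM is covered by the curves s |-> (reflection of a fixed
   unit vector b in the line through w + s d). All of them may start at b, so only
   countably many times l occur, and freeing the coordinates of w one after the
   other gives a single l for all w.

   Analytic dependence of geodesics on initial data: an analytic function extends
   functorially to every commutative Banach algebra, and the geodesic ODE with
   initial value in A is solved by a contraction in the algebra of l^1 power
   series over A. Taking A to be itself an algebra of power series makes the
   solution analytic in time and in the parameter jointly. *)

(** * Commutative Banach algebras and l^1 power series *)

(** The leading-term argument must also cover points conjugate to x, where the position is
    stationary in s to first order. If the position at time [t0] departs from y at order k in
    [s - s0], with leading vector c, its s-derivative has leading term [k (s - s0)^(k-1) c].
    Dividing the Gauss relation by this power of [s - s0] makes c orthogonal to the velocity,
    whatever k is. The hits then satisfy a linear system in [(s - s0)^k] and [t - t0] with nonzero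
    determinant. Analyticity provides a finite k unless the position stays at y, so expansions
    jointly in s and t are required at every time, far outside the initial chart. Completeness
    supplies the geodesics globally; only their analytic dependence on s has to be continued in
    time. Reflections are chosen because they are rational in w, keep unit length for every
    [w != 0], and have degree 0: the parameter then ranges over a vector space in which single
    coordinates can be varied. The opposite vector -b is reached from w orthogonal to b, which
    requires dimension at least 2. *)

(* [nm_Sum] packages completeness: a series whose partial norm sums stay below
   [C] converges to [nm_Sum f], with the natural bound on every remainder. *)
Record banAlg (R : realType) := BanAlg {
  car :> comNzRingType;
  nm : car -> R;
  emb : {rmorphism R -> car};
  nm_Sum : (nat -> car) -> car;
  nm_ge0 : forall x, 0 <= nm x;
  nm_eq0 : forall x, nm x = 0 -> x = 0;
  nmN : forall x, nm (- x) = nm x;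
  nmD : forall x y, nm (x + y) <= nm x + nm y;
  nmM : forall x y, nm (x * y) <= nm x * nm y;
  nm_emb : forall c, nm (emb c) <= `|c|;
  nm_SumP : forall (f : nat -> car) C, (forall n, \sum_(i < n) nm (f i) <= C) ->
    forall n, nm (nm_Sum f - \sum_(i < n) f i) <= C - \sum_(i < n) nm (f i) }.

Section BanAlgTheory.
Variables (R : realType) (A : banAlg R).
Implicit Types (x y z : A) (f g : nat -> A) (C : R).

Lemma nm0 : nm (0 : A) = 0.
Proof.
have := nm_emb A 0; rewrite rmorph0 normr0 => h.
by apply/eqP; rewrite eq_le h nm_ge0.
Qed.

Lemma nm1_le : nm (1 : A) <= 1.
Proof. by have := nm_emb A 1; rewrite rmorph1 normr1. Qed.

Lemma nmB x y : nm (x - y) <= nm x + nm y.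
Proof. by rewrite (le_trans (nmD _ _))// nmN. Qed.

Lemma nm_distC x y : nm (x - y) = nm (y - x).
Proof. by rewrite -nmN opprB. Qed.

Lemma nm_sum (I : Type) (r : seq I) (P : pred I) (F : I -> A) :
  nm (\sum_(i <- r | P i) F i) <= \sum_(i <- r | P i) nm (F i).
Proof.
elim/big_rec2: _ => [|i s x _ h]; first by rewrite nm0.
by rewrite (le_trans (nmD _ _))// lerD2l.
Qed.

Lemma nmX x k : nm (x ^+ k) <= nm x ^+ k.
Proof.
elim: k => [|k IH]; first by rewrite !expr0 nm1_le.
by rewrite !exprS (le_trans (nmM _ _))// ler_wpM2l// nm_ge0.
Qed.

Lemma nm_embM c x : nm (emb A c * x) <= `|c| * nm x.
Proof. by rewrite (le_trans (nmM _ _))// ler_wpM2r ?nm_ge0// nm_emb. Qed.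

Lemma nm_small_eq0 x : (forall e, 0 < e -> nm x <= e) -> x = 0.
Proof.
move=> h; apply: nm_eq0; apply/eqP; rewrite eq_le nm_ge0 andbT.
by apply/ler_addgt0Pl => e e0; rewrite addr0 h.
Qed.

Definition sumb f C := forall n, \sum_(i < n) nm (f i) <= C.

Lemma sumb_ge0 f C : sumb f C -> 0 <= C.
Proof. by move=> /(_ 0%N); rewrite big_ord0. Qed.

Lemma sumb_le (B : banAlg R) f (g : nat -> B) C :
  (forall i, nm (f i) <= nm (g i)) -> (forall n, \sum_(i < n) nm (g i) <= C) -> sumb f C.
Proof. by move=> h hg n; rewrite (le_trans _ (hg n))// ler_sum. Qed.

Lemma nm_Sum_le f C : sumb f C -> nm (nm_Sum f) <= C.
Proof. by move=> h; have := nm_SumP h 0; rewrite !big_ord0 !subr0. Qed.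

Lemma sumb_tail f C e : sumb f C -> 0 < e ->
  exists N, forall n, (N <= n)%N -> nm (nm_Sum f - \sum_(i < n) f i) <= e.
Proof.
move=> fC e0.
set S := [set x | exists n, x = \sum_(i < n) nm (f i)].
have hS : has_sup S.
  split; first by exists 0, 0%N; rewrite big_ord0.
  by exists C => _ [n ->]; exact: fC.
have [x [N ->] hN] := sup_adherent e0 hS.
have fS : sumb f (sup S) by move=> n; apply: ub_le_sup; [exact: hS.2|exists n].
exists N => n Nn; rewrite (le_trans (nm_SumP fS n))//.
have : \sum_(i < N) nm (f i) <= \sum_(i < n) nm (f i).
  rewrite -(subnKC Nn) big_split_ord/= lerDl sumr_ge0// => i _; exact: nm_ge0.
by move: hN; lra.
Qed.

(** Closeness to arbitrarily late partial sums suffices, since those are close to [nm_Sum f] by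
    [sumb_tail]. The rules for finite, added, scaled, shifted and mapped sums are all derived from
    this criterion. *)
Lemma nm_Sum_unique f C x : sumb f C ->
  (forall e, 0 < e -> forall N, exists2 n, (N <= n)%N & nm (x - \sum_(i < n) f i) <= e) ->
  x = nm_Sum f.
Proof.
move=> fC h; apply/eqP; rewrite -subr_eq0; apply/eqP; apply: nm_small_eq0 => e e0.
have e20 : 0 < e / 2 by lra.
have [N hN] := sumb_tail fC e20.
have [n Nn hn] := h _ e20 N.
have := hN n Nn; rewrite nm_distC => hn'.
have -> : x - nm_Sum f = (x - \sum_(i < n) f i) + (\sum_(i < n) f i - nm_Sum f).
  by rewrite addrA subrK.
by rewrite (le_trans (nmD _ _))//; move: hn hn'; lra.
Qed.

Lemma nm_Sum_fin f n : (forall i, (n <= i)%N -> f i = 0) ->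
  nm_Sum f = \sum_(i < n) f i.
Proof.
move=> h; pose C := \sum_(i < n) nm (f i).
have big m : (n <= m)%N -> \sum_(i < m) nm (f i) = C.
  move=> nm; rewrite -(subnKC nm) big_split_ord/= [X in _ + X]big1 ?addr0// => i _.
  by rewrite h ?nm0// leq_addr.
have bigf m : (n <= m)%N -> \sum_(i < m) f i = \sum_(i < n) f i.
  move=> nm; rewrite -(subnKC nm) big_split_ord/= [X in _ + X]big1 ?addr0// => i _.
  by rewrite h// leq_addr.
symmetry; apply: (@nm_Sum_unique _ C) => [m|e e0 N].
  case: (leqP n m) => [/big ->//|mn].
  rewrite /C -(subnKC (ltnW mn)) big_split_ord/= lerDl sumr_ge0// => i _.
  exact: nm_ge0.
exists (maxn N n); first exact: leq_maxl.
by rewrite bigf ?leq_maxr// subrr nm0 ltW.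
Qed.

Lemma sumbD f g C D : sumb f C -> sumb g D -> sumb (fun i => f i + g i) (C + D).
Proof.
move=> hf hg n; apply: (@le_trans _ _ (\sum_(i < n) (nm (f i) + nm (g i)))).
  by apply: ler_sum => i _; exact: nmD.
by rewrite big_split/=; apply: lerD; [exact: hf|exact: hg].
Qed.

Lemma sumbM x f C : sumb f C -> sumb (fun i => x * f i) (nm x * C).
Proof.
move=> hf n; apply: (@le_trans _ _ (\sum_(i < n) (nm x * nm (f i)))).
  by apply: ler_sum => i _; exact: nmM.
by rewrite -mulr_sumr; apply: ler_wpM2l; [exact: nm_ge0|exact: hf].
Qed.

Lemma sumb_shift f C : sumb f C -> sumb (fun i => f i.+1) C.
Proof.
move=> hf n; have := hf n.+1; rewrite big_ord_recl.
by apply: le_trans; rewrite lerDr nm_ge0.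
Qed.

Lemma nm_SumD f g C D : sumb f C -> sumb g D ->
  nm_Sum (fun i => f i + g i) = nm_Sum f + nm_Sum g.
Proof.
move=> hf hg; symmetry; apply: (nm_Sum_unique (sumbD hf hg)) => e e0 N.
have e20 : 0 < e / 2 by lra.
have [N1 h1] := sumb_tail hf e20; have [N2 h2] := sumb_tail hg e20.
exists (maxn N (maxn N1 N2)); first exact: leq_maxl.
set m := maxn _ _.
rewrite big_split/= opprD addrACA (le_trans (nmD _ _))//.
have := h1 m; rewrite leq_max leq_max leqnn orTb orbT => /(_ isT).
have := h2 m; rewrite leq_max leq_max leqnn !orbT => /(_ isT).
lra.
Qed.

Lemma nm_SumM x f C : sumb f C -> nm_Sum (fun i => x * f i) = x * nm_Sum f.
Proof.
move=> hf; symmetry; apply: (nm_Sum_unique (sumbM x hf)) => e e0 N.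
have x0 := nm_ge0 x.
have d0 : 0 < e / (nm x + 1) by rewrite divr_gt0//; lra.
have [N1 h1] := sumb_tail hf d0.
exists (maxn N N1); first exact: leq_maxl.
rewrite -mulr_sumr -mulrBr (le_trans (nmM _ _))//.
rewrite (le_trans (ler_wpM2l x0 (h1 _ (leq_maxr _ _))))//.
rewrite mulrA ler_pdivrMr; last by lra.
nra.
Qed.

Lemma nm_SumS f C : sumb f C -> nm_Sum f = f 0%N + nm_Sum (fun i => f i.+1).
Proof.
move=> hf; apply/eqP; rewrite addrC -subr_eq; apply/eqP.
apply: (nm_Sum_unique (sumb_shift hf)) => e e0 N.
have [N1 h1] := sumb_tail hf e0.
exists (maxn N N1); first exact: leq_maxl.
have := h1 (maxn N N1).+1; rewrite big_ord_recl opprD addrA; apply.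
by rewrite leqW// leq_maxr.
Qed.

End BanAlgTheory.

(** Multiplicativity is left out because coefficient maps and formal integration are additive
    contractions but not ring morphisms; additivity and the norm bound are enough to commute with
    [nm_Sum]. *)
Definition contr_add (R : realType) (A B : banAlg R) (phi : A -> B) :=
  (forall x y, phi (x + y) = phi x + phi y) /\ (forall x, nm (phi x) <= nm x).

Lemma contr_add0 (R : realType) (A B : banAlg R) (phi : A -> B) :
  contr_add phi -> phi 0 = 0.
Proof. by case=> h _; apply: (addrI (phi 0)); rewrite -h !addr0. Qed.

Lemma contr_addN (R : realType) (A B : banAlg R) (phi : A -> B) :
  contr_add phi -> {morph phi : x / - x}.
Proof.
move=> h x; apply: (addrI (phi x)); rewrite -h.1 !subrr; exact: contr_add0.
Qed.

Lemma contr_addB (R : realType) (A B : banAlg R) (phi : A -> B) :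
  contr_add phi -> {morph phi : x y / x - y}.
Proof. by move=> h x y; rewrite h.1 contr_addN. Qed.

Lemma contr_add_sum (R : realType) (A B : banAlg R) (phi : A -> B)
    (I : Type) (r : seq I) (P : pred I) (F : I -> A) :
  contr_add phi -> phi (\sum_(i <- r | P i) F i) = \sum_(i <- r | P i) phi (F i).
Proof. by move=> h; apply: (big_morph phi h.1 (contr_add0 h)). Qed.

Lemma contr_add_sumb (R : realType) (A B : banAlg R) (phi : A -> B) f C :
  contr_add phi -> sumb f C -> sumb (phi \o f) C.
Proof. by move=> h hf n; rewrite (le_trans _ (hf n))// ler_sum// => i _; apply: h.2. Qed.

Lemma contr_add_Sum (R : realType) (A B : banAlg R) (phi : A -> B) f C :
  contr_add phi -> sumb f C -> phi (nm_Sum f) = nm_Sum (phi \o f).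
Proof.
move=> h hf; apply: (nm_Sum_unique (contr_add_sumb h hf)) => e e0 N.
have [N1 h1] := sumb_tail hf e0.
exists (maxn N N1); first exact: leq_maxl.
rewrite -(contr_add_sum _ _ _ h) -contr_addB//.
by rewrite (le_trans (h.2 _))// h1// leq_maxr.
Qed.

Definition ban_mor (R : realType) (A B : banAlg R) (phi : A -> B) :=
  [/\ contr_add phi, (forall x y, phi (x * y) = phi x * phi y)
    & (forall c, phi (emb A c) = emb B c)].

Lemma ban_mor1 (R : realType) (A B : banAlg R) (phi : A -> B) :
  ban_mor phi -> phi 1 = 1.
Proof. by case=> _ _ h; have := h 1; rewrite !rmorph1. Qed.

Lemma ban_morX (R : realType) (A B : banAlg R) (phi : A -> B) :
  ban_mor phi -> forall k, {morph phi : x / x ^+ k}.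
Proof.
move=> h k x; elim: k => [|k IH]; first by rewrite !expr0 ban_mor1.
by rewrite !exprS; case: (h) => _ -> _; rewrite IH.
Qed.

(** * The real numbers as a Banach algebra *)

Section RealBanAlg.
Variable R : realType.

Let rsum (f : nat -> R) : R := limn (fun n => \sum_(i < n) f i).

Lemma seriesE (f : nat -> R) n : series f n = \sum_(i < n) f i.
Proof. exact: big_mkord. Qed.

Lemma real_nmM (x y : R) : `|x * y| <= `|x| * `|y|.
Proof. by rewrite normrM. Qed.

Lemma real_SumP (f : nat -> R) C : (forall n, \sum_(i < n) `|f i| <= C) ->
  forall n, `|rsum f - \sum_(i < n) f i| <= C - \sum_(i < n) `|f i|.
Proof.
move=> h n.
have cvf : cvgn (series f).
  apply: normed_cvg; apply: nondecreasing_is_cvgn.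
    by apply: nondecreasing_series => k _ _; exact: normr_ge0.
  by exists C => _ [k _ <-]; have := h k; rewrite -(seriesE (fun i => `|f i|)).
have cvn : (fun n => \sum_(i < n) f i) @ \oo --> rsum f.
  have E : (fun n => \sum_(i < n) f i) = series f.
    by apply/funext => k; rewrite seriesE.
  by rewrite /rsum E.
have hle : (fun m => `|\sum_(i < m) f i - \sum_(i < n) f i|) @ \oo
    --> `|rsum f - \sum_(i < n) f i|.
  by apply: cvg_norm; apply: cvgB => //; exact: cvg_cst.
rewrite -(cvg_lim (@Rhausdorff R) hle).
apply: limr_le; first exact: cvgP hle.
exists n => // m /= nm.
rewrite -(subnKC nm); move: (m - n)%N => d; rewrite !big_split_ord/= [X in `|X - _|]addrC addrK.
rewrite lerBrDl; have := h (n + d)%N; rewrite big_split_ord/=.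
by apply: le_trans; rewrite lerD2l; exact: ler_norm_sum.
Qed.

Definition real_ban : banAlg R :=
  @BanAlg R R Num.norm idfun rsum (@normr_ge0 _ _) (@normr0_eq0 _ _) (@normrN _ _)
    (@ler_normD _ _) real_nmM
    (fun c => lexx _) real_SumP.

Lemma real_Sum_cvg (f : nat -> R) C : @sumb R real_ban f C ->
  series f @ \oo --> @nm_Sum R real_ban f.
Proof.
move=> h.
apply/cvgrPdist_le => /= e e0.
have [N hN] := @sumb_tail R real_ban f C e h e0.
by exists N => // n /= Nn; rewrite seriesE; exact: hN.
Qed.

End RealBanAlg.

(** * The Banach algebra of l^1 power series over a Banach algebra *)

Section PowerSeriesAlgebra.
Variables (R : realType) (A : banAlg R).
Implicit Types (f g h : nat -> A).

Definition cmul f g : nat -> A := fun k => \sum_(i < k.+1) f i * g (k - i)%N.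

(** Truncation to polynomials lets the Cauchy product inherit commutativity and associativity from
    [{poly A}]. *)
Lemma cmul_poly f g n k : (k < n)%N ->
  cmul f g k = ((\poly_(i < n) f i) * (\poly_(i < n) g i))`_k.
Proof.
move=> kn; rewrite coefM; apply: eq_bigr => i _.
rewrite !coef_poly (leq_ltn_trans _ kn); last by rewrite -ltnS.
by rewrite (leq_ltn_trans (leq_subr _ _) kn).
Qed.

Lemma coef_polyM (S : comNzRingType) (p q p' q' : {poly S}) k :
  (forall i, (i <= k)%N -> p`_i = p'`_i) -> (forall i, (i <= k)%N -> q`_i = q'`_i) ->
  (p * q)`_k = (p' * q')`_k.
Proof.
move=> hp hq; rewrite !coefM; apply: eq_bigr => i _.
by rewrite hp ?hq// ?leq_subr// -ltnS.
Qed.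

Lemma coef_poly_cmul f g n i : (i < n)%N ->
  (\poly_(i < n) cmul f g i)`_i = ((\poly_(i < n) f i) * (\poly_(i < n) g i))`_i.
Proof. by move=> h; rewrite coef_poly h (cmul_poly _ _ h). Qed.

Lemma cmulC f g : cmul f g = cmul g f.
Proof. by apply/funext => k; rewrite !(@cmul_poly _ _ k.+1)// mulrC. Qed.

Lemma cmulA f g h : cmul f (cmul g h) = cmul (cmul f g) h.
Proof.
apply/funext => k; rewrite !(@cmul_poly _ _ k.+1)//.
rewrite (coef_polyM (p' := \poly_(i < k.+1) f i)
  (q' := (\poly_(i < k.+1) g i) * (\poly_(i < k.+1) h i)))//; last first.
  by move=> i ik; rewrite coef_poly_cmul.
rewrite mulrA; apply: coef_polyM => // i ik.
by rewrite coef_poly_cmul.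
Qed.

Definition cC (c : A) : nat -> A := fun k => if k is 0%N then c else 0.

Lemma cmulC1 c f : cmul (cC c) f = (fun k => c * f k).
Proof.
apply/funext => k; rewrite /cmul big_ord_recl subn0/= big1 ?addr0// => i _.
by rewrite mul0r.
Qed.

Lemma cmulDl f g h : cmul (fun k => f k + g k) h = (fun k => cmul f h k + cmul g h k).
Proof.
apply/funext => k; rewrite /cmul -big_split/=; apply: eq_bigr => i _.
exact: mulrDl.
Qed.

Lemma horner1_poly (f : nat -> R) n : (\poly_(i < n) f i).[1] = \sum_(i < n) f i.
Proof. by rewrite horner_poly; apply: eq_bigr => i _; rewrite expr1n mulr1. Qed.

(** The norms of the first coefficients are dominated by those of the product of two truncated norm
    polynomials. All coefficients of that product are nonnegative, so their sum is at most its value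
    at 1, which is a product of two partial norm sums. *)
Lemma sumb_cmul f g C D : sumb f C -> sumb g D -> sumb (cmul f g) (C * D).
Proof.
move=> hf hg n.
pose P : {poly R} := \poly_(i < n) nm (f i).
pose Q : {poly R} := \poly_(i < n) nm (g i).
pose PQ : {poly R} := P * Q.
apply: (@le_trans _ _ (\sum_(k < n) nth 0 PQ k)).
  apply: ler_sum => k _; rewrite coefM (le_trans (nm_sum _ _ _))//.
  apply: ler_sum => i _; rewrite (le_trans (nmM _ _))//.
  rewrite !coef_poly (leq_ltn_trans _ (ltn_ord k)); last by rewrite -ltnS.
  by rewrite (leq_ltn_trans (leq_subr _ _) (ltn_ord k)).
apply: (@le_trans _ _ PQ.[1]).
  have sz : (size PQ <= n + n)%N.
    rewrite (leq_trans (size_polyMleq _ _))// (leq_trans (leq_pred _))//.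
    by apply: leq_add; exact: size_poly.
  rewrite (horner_coef_wide _ sz) big_split_ord/=.
  under [X in _ <= X + _]eq_bigr do rewrite expr1n mulr1.
  rewrite lerDl sumr_ge0// => i _; rewrite expr1n mulr1 coefM sumr_ge0// => j _.
  by rewrite mulr_ge0// coef_poly; case: ifP => // _; exact: nm_ge0.
rewrite /PQ hornerM !horner1_poly.
by rewrite ler_pM ?sumr_ge0// => *; exact: nm_ge0.
Qed.

(** The bound is existential, hence a proposition: by proof irrelevance, series with the same
    coefficients are equal. *)
Record lser := LSer { cf :> nat -> A; cf_bd : exists C, sumb cf C }.

Lemma lserP (u v : lser) : (forall k, u k = v k) -> u = v.
Proof.
case: u v => [f hf] [g hg]/= /funext fg; rewrite fg in hf *.
by rewrite (Prop_irrelevance hf hg).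
Qed.

HB.instance Definition _ := gen_eqMixin lser.
HB.instance Definition _ := gen_choiceMixin lser.

Lemma sumb_cC c : sumb (cC c) (nm c).
Proof.
case=> [|n]; first by rewrite big_ord0 nm_ge0.
by rewrite big_ord_recl big1 ?addr0// => i _; rewrite nm0.
Qed.

Definition ls_const c : lser := LSer (ex_intro _ _ (sumb_cC c)).

Lemma ls_add_bd (u v : lser) : exists C, sumb (fun k => u k + v k) C.
Proof. by case: (cf_bd u) (cf_bd v) => C hC [D hD]; exists (C + D); exact: sumbD. Qed.
Definition ls_add u v : lser := LSer (ls_add_bd u v).

Lemma ls_opp_bd (u : lser) : exists C, sumb (fun k => - u k) C.
Proof.
by case: (cf_bd u) => C; exists C; apply: sumb_le p => i; rewrite nmN.
Qed.
Definition ls_opp u : lser := LSer (ls_opp_bd u).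

Lemma ls_mul_bd (u v : lser) : exists C, sumb (cmul u v) C.
Proof. by case: (cf_bd u) (cf_bd v) => C hC [D hD]; exists (C * D); exact: sumb_cmul. Qed.
Definition ls_mul u v : lser := LSer (ls_mul_bd u v).

Lemma ls_addA : associative ls_add.
Proof. by move=> u v w; apply: lserP => k /=; rewrite addrA. Qed.
Lemma ls_addC : commutative ls_add.
Proof. by move=> u v; apply: lserP => k /=; rewrite addrC. Qed.
Lemma ls_add0 : left_id (ls_const 0) ls_add.
Proof. by move=> u; apply: lserP => -[|k] /=; rewrite add0r. Qed.
Lemma ls_addN : left_inverse (ls_const 0) ls_opp ls_add.
Proof. by move=> u; apply: lserP => -[|k] /=; rewrite addNr. Qed.

HB.instance Definition _ := GRing.isZmodule.Build lser ls_addA ls_addC ls_add0 ls_addN.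

Lemma ls_mulA : associative ls_mul.
Proof. by move=> u v w; apply: lserP => k /=; rewrite cmulA. Qed.
Lemma ls_mulC : commutative ls_mul.
Proof. by move=> u v; apply: lserP => k /=; rewrite cmulC. Qed.
Lemma ls_mul1 : left_id (ls_const 1) ls_mul.
Proof. by move=> u; apply: lserP => k /=; rewrite cmulC1 mul1r. Qed.
Lemma ls_mulD : left_distributive ls_mul ls_add.
Proof. by move=> u v w; apply: lserP => k /=; rewrite cmulDl. Qed.
Lemma ls_1neq0 : ls_const 1 != 0.
Proof.
by apply/eqP => /(congr1 (fun u : lser => u 0%N))/= /eqP; rewrite oner_eq0.
Qed.

HB.instance Definition _ :=
  GRing.Zmodule_isComNzRing.Build lser ls_mulA ls_mulC ls_mul1 ls_mulD ls_1neq0.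

Lemma lsD (u v : lser) k : (u + v) k = u k + v k. Proof. by []. Qed.
Lemma lsB (u v : lser) k : (u - v) k = u k - v k. Proof. by []. Qed.
Lemma ls0 k : (0 : lser) k = 0. Proof. by case: k. Qed.
Lemma lsM (u v : lser) k : (u * v) k = cmul u v k. Proof. by []. Qed.
Lemma ls_constM c (u : lser) k : (ls_const c * u) k = c * u k.
Proof. by rewrite lsM/= cmulC1. Qed.
Lemma ls_sum (I : Type) (r : seq I) (P : pred I) (F : I -> lser) k :
  (\sum_(i <- r | P i) F i) k = \sum_(i <- r | P i) F i k.
Proof. by elim/big_rec2: _ => [|i x y _ <-]; rewrite ?ls0. Qed.

Definition ls_nm (u : lser) : R := sup [set x | exists n, x = \sum_(i < n) nm (u i)].

Lemma ls_nm_has_sup (u : lser) : has_sup [set x | exists n, x = \sum_(i < n) nm (u i)].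
Proof.
split; first by exists 0, 0%N; rewrite big_ord0.
by case: (cf_bd u) => C hC; exists C => _ [n ->]; exact: hC.
Qed.

Lemma ls_nm_sumb (u : lser) : sumb u (ls_nm u).
Proof.
by move=> n; apply: ub_le_sup; [exact: (ls_nm_has_sup u).2|exists n].
Qed.

Lemma ls_nm_le (u : lser) C : sumb u C -> ls_nm u <= C.
Proof.
move=> hC; apply: ge_sup; first exact: (ls_nm_has_sup u).1.
by move=> _ [n ->]; exact: hC.
Qed.

Lemma ls_nm_coef (u : lser) k : nm (u k) <= ls_nm u.
Proof.
apply: le_trans (ls_nm_sumb u k.+1); rewrite big_ord_recr/= lerDr sumr_ge0// => i _.
exact: nm_ge0.
Qed.

Lemma ls_nm_ge0 u : 0 <= ls_nm u.
Proof. by apply: sumb_ge0 (ls_nm_sumb u). Qed.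

Lemma ls_nm_eq0 u : ls_nm u = 0 -> u = 0.
Proof.
move=> h; apply: lserP => k; rewrite ls0; apply: nm_eq0; apply/eqP.
by rewrite eq_le nm_ge0 andbT -h ls_nm_coef.
Qed.

Lemma ls_nmN u : ls_nm (- u) = ls_nm u.
Proof.
rewrite /ls_nm; congr (sup _); apply/seteqP; split => _ [n ->]; exists n;
  by apply: eq_bigr => i _; rewrite nmN.
Qed.

Lemma ls_nmD u v : ls_nm (u + v) <= ls_nm u + ls_nm v.
Proof. by apply: ls_nm_le; apply: sumbD; exact: ls_nm_sumb. Qed.

Lemma ls_nmM u v : ls_nm (u * v) <= ls_nm u * ls_nm v.
Proof. by apply: ls_nm_le; apply: sumb_cmul; exact: ls_nm_sumb. Qed.

Lemma ls_nm_const c : ls_nm (ls_const c) = nm c.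
Proof.
apply/eqP; rewrite eq_le (@ls_nm_le (ls_const c) _ (sumb_cC c))/=.
exact: (ls_nm_coef (ls_const c) 0).
Qed.

Lemma ls_const_additive : zmod_morphism ls_const.
Proof. by move=> x y; apply: lserP => -[|k]//=; rewrite subr0. Qed.
Lemma ls_const_multiplicative : monoid_morphism ls_const.
Proof.
by split => // x y; apply: lserP => -[|k]; rewrite ls_constM/= ?mulr0.
Qed.
HB.instance Definition _ := GRing.isZmodMorphism.Build A lser ls_const ls_const_additive.
HB.instance Definition _ := GRing.isMonoidMorphism.Build A lser ls_const ls_const_multiplicative.

Definition ls_emb : {rmorphism R -> lser} := (ls_const : {rmorphism A -> lser}) \o emb A.

Lemma ls_nm_emb c : ls_nm (ls_emb c) <= `|c|.
Proof. by rewrite ls_nm_const nm_emb. Qed.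

(** Summation is coefficientwise. The default 0 is never met for a norm-summable family, by
    [ls_SumE]. *)
Definition ls_Sum (F : nat -> lser) : lser :=
  if pselect (exists C, sumb (fun k => nm_Sum (fun j => F j k)) C) is left h
  then LSer h else 0.

Lemma coef_sumb (F : nat -> lser) C k : (forall n, \sum_(i < n) ls_nm (F i) <= C) ->
  sumb (fun j => F j k) C.
Proof.
by move=> h n; rewrite (le_trans _ (h n))// ler_sum// => i _; exact: ls_nm_coef.
Qed.

(** Only the first [K] coefficients enter at a time. A single late index [N] brings their partial
    sums within total error [e]; the terms between [n] and [N] form a finite double sum, in which
    the order of summation is exchanged. *)
Lemma ls_Sum_bd (F : nat -> lser) C : (forall n, \sum_(i < n) ls_nm (F i) <= C) ->
  forall n, sumb (fun k => nm_Sum (fun j => F j k) - \sum_(j < n) F j k)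
                 (C - \sum_(j < n) ls_nm (F j)).
Proof.
move=> h n K; apply/ler_addgt0Pl => e e0.
have [N nN hN] : exists2 N, (n <= N)%N &
    forall N', (N <= N')%N ->
    \sum_(k < K) nm (nm_Sum (fun j => F j k) - \sum_(j < N') F j k) <= e.
  elim: K e e0 => [|K IH] e e0.
    by exists n => // N' _; rewrite big_ord0 ltW.
  have e20 : 0 < e / 2 by lra.
  have [N1 nN1 h1] := IH _ e20.
  have [N2 h2] := sumb_tail (coef_sumb K h) e20.
  exists (maxn N1 N2) => [|N']; first by rewrite (leq_trans nN1)// leq_maxl.
  rewrite geq_max => /andP[/h1 a1 /h2 a2].
  by rewrite big_ord_recr/=; move: a1 a2; lra.
have := h N; move: (hN _ (leqnn N)); rewrite -(subnKC nN); move: (N - n)%N => d.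
rewrite [X in _ -> X <= _ -> _]big_split_ord/= => he hC.
apply: (@le_trans _ _ (e + \sum_(j < d) ls_nm (F (n + j)%N))); last by move: hC; lra.
apply: (@le_trans _ _ (\sum_(k < K) (nm (nm_Sum (fun j => F j k) - \sum_(j < n + d) F j k)
    + \sum_(j < d) nm (F (n + j)%N k)))).
  apply: ler_sum => k _; rewrite big_split_ord/=.
  set S := nm_Sum _; set a := \sum_(i < n) _; set b := \sum_(i < d) F _ _.
  have -> : S - a = S - (a + b) + b by rewrite opprD addrA subrK.
  by rewrite (le_trans (nmD _ _))// lerD2l nm_sum.
rewrite big_split/= lerD// exchange_big/= ler_sum// => j _.
exact: ls_nm_sumb.
Qed.

Lemma ls_SumE (F : nat -> lser) C : (forall n, \sum_(i < n) ls_nm (F i) <= C) ->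
  forall k, ls_Sum F k = nm_Sum (fun j => F j k).
Proof.
move=> h k; rewrite /ls_Sum; case: pselect => //= -[]; exists C.
have := ls_Sum_bd h 0; rewrite big_ord0 subr0.
by apply: sumb_le => i; rewrite big_ord0 subr0.
Qed.

Lemma ls_SumP (F : nat -> lser) C : (forall n, \sum_(i < n) ls_nm (F i) <= C) ->
  forall n, ls_nm (ls_Sum F - \sum_(i < n) F i) <= C - \sum_(i < n) ls_nm (F i).
Proof.
move=> h n; apply: ls_nm_le; apply: sumb_le (ls_Sum_bd h n) => k.
by rewrite lsB ls_sum (ls_SumE h).
Qed.

(** The construction can be iterated: [ls_ban (ls_ban (real_ban R))] holds series in time whose
    coefficients are series in the parameter, that is, joint expansions in two variables. *)
Definition ls_ban : banAlg R :=
  BanAlg ls_nm_ge0 ls_nm_eq0 ls_nmN ls_nmD ls_nmM ls_nm_emb ls_SumP.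

Lemma ls_ban_SumE (F : nat -> ls_ban) C k : sumb F C ->
  (nm_Sum F : lser) k = nm_Sum (fun j => (F j : lser) k).
Proof. by move=> h; exact: (ls_SumE h). Qed.

Lemma coef_contr k : contr_add (fun u : ls_ban => (u : lser) k).
Proof. by split => // x; exact: ls_nm_coef. Qed.

Lemma ls_const_mor : @ban_mor R A ls_ban ls_const.
Proof.
split => //; first split; first exact: rmorphD.
- by move=> x /=; rewrite ls_nm_const.
- by move=> x y; exact: (rmorphM ls_const).
Qed.

Definition cX : nat -> A := fun k => if k is 1%N then 1 else 0.
Lemma sumb_cX : sumb cX 1.
Proof.
case=> [|[|n]]; rewrite ?big_ord0 ?ler01//; first by rewrite big_ord1 nm0 ler01.
by rewrite !big_ord_recl/= nm0 add0r big1 ?addr0 ?nm1_le.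
Qed.
Definition lsX : lser := LSer (ex_intro _ _ sumb_cX).
Lemma nm_lsX : @nm R ls_ban lsX <= 1.
Proof. by apply: (@ls_nm_le lsX); exact: sumb_cX. Qed.

End PowerSeriesAlgebra.

Section MorphismBasics.
Variable R : realType.

Lemma ban_mor_id (A : banAlg R) : @ban_mor R A A idfun.
Proof. by split. Qed.

Lemma ban_mor_comp (A B C : banAlg R) (phi : A -> B) (psi : B -> C) :
  ban_mor phi -> ban_mor psi -> ban_mor (psi \o phi).
Proof.
case=> -[a1 a2] a3 a4 [[b1 b2] b3 b4]; split => /=.
- by split=> [x y|x] /=; rewrite ?a1 ?b1// (le_trans (b2 _)).
- by move=> x y; rewrite a3 b3.
- by move=> c; rewrite a4 b4.
Qed.

Lemma ban_mor_emb (A : banAlg R) : @ban_mor R (real_ban R) A (emb A).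
Proof.
by split; [split|..] => *; rewrite ?rmorphD ?rmorphM//; exact: nm_emb.
Qed.

End MorphismBasics.

Section Monomials.
Variables (R : realType) (A : banAlg R).
Local Notation L := (ls_ban A).
Implicit Types (u v : L) (c : A).

Lemma lsXM0 u : (lsX A * u : lser A) 0%N = 0.
Proof. by rewrite lsM /cmul big_ord1 mul0r. Qed.

Lemma lsXMS u k : (lsX A * u : lser A) k.+1 = (u : lser A) k.
Proof.
rewrite lsM /cmul !big_ord_recl big1 ?addr0/=; last by move=> i _; rewrite mul0r.
by rewrite /cX mul0r add0r mul1r subn1.
Qed.

Lemma coef_lsXn n k : (lsX A ^+ n : lser A) k = if k == n then 1 else 0.
Proof.
elim: n k => [|n IH] [|k]; rewrite ?expr0//.
  by rewrite exprS lsXM0.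
by rewrite exprS lsXMS IH.
Qed.

Lemma nm_lsXn n : nm (lsX A ^+ n : L) <= 1.
Proof.
rewrite (le_trans (@nmX _ L _ _))// exprn_ile1//; [exact: nm_ge0|exact: nm_lsX].
Qed.

Definition mono c n : L := ls_const c * lsX A ^+ n.

Lemma coef_mono c n k : (mono c n : lser A) k = if k == n then c else 0.
Proof. by rewrite ls_constM coef_lsXn; case: eqP; rewrite ?mulr1 ?mulr0. Qed.

Lemma nm_mono c n : nm (mono c n) <= nm c.
Proof.
rewrite (le_trans (@nmM _ L _ _))// -[leRHS]mulr1.
apply: ler_pM; [exact: nm_ge0|exact: nm_ge0| |exact: nm_lsXn].
by rewrite /= ls_nm_const.
Qed.

Lemma sumb_mono u : sumb (fun k => mono ((u : lser A) k) k) (nm u).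
Proof. by apply: sumb_le (ls_nm_sumb u) => k; exact: nm_mono. Qed.

Lemma mono_decomp u : u = nm_Sum (fun k => mono ((u : lser A) k) k).
Proof.
apply: lserP => k; rewrite (ls_ban_SumE _ (@sumb_mono u)).
rewrite (_ : (fun j => _) = (fun j => if k == j then (u : lser A) j else 0)); last first.
  by apply/funext => j; exact: coef_mono.
rewrite (@nm_Sum_fin _ _ _ k.+1) => [|i ki]; last by rewrite ltn_eqF.
rewrite big_ord_recr/= eqxx big1 ?add0r// => i _.
by rewrite gtn_eqF//=.
Qed.

Lemma shift_bd u : exists C, sumb (fun k => (u : lser A) k.+1) C.
Proof. by exists (nm u); apply: sumb_shift; exact: ls_nm_sumb. Qed.
Definition ls_shift u : L := LSer (shift_bd u).

Lemma nm_shift u : nm (ls_shift u) <= nm u.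
Proof. by apply: (@ls_nm_le _ _ (ls_shift u)); apply: sumb_shift; exact: ls_nm_sumb. Qed.

Lemma shift_decomp u : u = ls_const ((u : lser A) 0%N) + lsX A * ls_shift u.
Proof.
apply: lserP => -[|k]; first by rewrite lsD lsXM0 addr0.
by rewrite lsD lsXMS add0r.
Qed.

End Monomials.

(** * Evaluation of power series on the closed unit ball *)

Section Evaluation.
Variables (R : realType) (A B : banAlg R) (phi : A -> B) (z : B).
Hypotheses (hphi : ban_mor phi) (hz : nm z <= 1).
Local Notation L := (ls_ban A).
Implicit Types (u v : L).

Definition evg u : B := nm_Sum (fun k => phi ((u : lser A) k) * z ^+ k).

Lemma evg_sumb u : sumb (fun k => phi ((u : lser A) k) * z ^+ k) (nm u).
Proof.
apply: sumb_le (ls_nm_sumb u) => k; rewrite (le_trans (nmM _ _))//.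
rewrite -[leRHS]mulr1; apply: ler_pM; rewrite ?nm_ge0//; first by case: hphi => -[].
by rewrite (le_trans (nmX _ _))// exprn_ile1// nm_ge0.
Qed.

Lemma evg_add : contr_add evg.
Proof.
split=> [u v|u]; last exact: nm_Sum_le (@evg_sumb u).
rewrite /evg -(nm_SumD (@evg_sumb u) (@evg_sumb v)); congr nm_Sum.
by apply/funext => k; rewrite lsD; case: hphi => -[-> _] _ _; rewrite mulrDl.
Qed.

Lemma evg_const c : evg (ls_const c) = phi c.
Proof.
rewrite /evg (@nm_Sum_fin _ _ _ 1) => [|[|k]//= _].
  by rewrite big_ord1 mulr1.
by rewrite contr_add0 ?mul0r//; case: hphi.
Qed.

Lemma evg_constM c u : evg (ls_const c * u) = phi c * evg u.
Proof.
rewrite /evg -(nm_SumM _ (@evg_sumb u)); congr nm_Sum; apply/funext => k.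
by rewrite ls_constM; case: hphi => _ -> _; rewrite mulrA.
Qed.

Lemma evg_XM u : evg (lsX A * u) = z * evg u.
Proof.
rewrite {1}/evg (nm_SumS (@evg_sumb _)) lsXM0 contr_add0; last by case: hphi.
rewrite mul0r add0r /evg -(nm_SumM _ (@evg_sumb u)); congr nm_Sum.
by apply/funext => k; rewrite lsXMS exprS mulrCA.
Qed.

Lemma evg_mono u c n : evg (u * mono c n) = evg u * evg (mono c n).
Proof.
elim: n u => [|n IH] u.
  rewrite /mono expr0 mulr1 mulrC evg_constM evg_const mulrC //.
have E : mono c n.+1 = lsX A * mono c n by rewrite /mono exprS mulrCA.
by rewrite E mulrCA !evg_XM IH mulrCA.
Qed.

(** For a monomial factor this follows by pulling out one X at a time. The general case writes [v]
    as the sum of its monomials and uses that the contraction [evg] commutes with such sums. *)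
Lemma evgM u v : evg (u * v) = evg u * evg v.
Proof.
have hv := sumb_mono v.
rewrite {1}(mono_decomp v) -(@nm_SumM _ L _ _ _ hv).
rewrite (contr_add_Sum evg_add (sumbM u hv)).
rewrite [in RHS](mono_decomp v) (contr_add_Sum evg_add hv).
rewrite -(nm_SumM _ (contr_add_sumb evg_add hv)); congr nm_Sum.
by apply/funext => k /=; rewrite evg_mono.
Qed.

Lemma evg_mor : ban_mor evg.
Proof.
split; [exact: evg_add|exact: evgM|move=> c].
by rewrite evg_const; case: hphi => _ _ ->.
Qed.

Lemma evg_X : evg (lsX A) = z.
Proof.
have := evg_XM 1; rewrite mulr1 => ->.
by rewrite (ban_mor1 evg_mor) mulr1.
Qed.

Lemma evg_shift u : evg u = phi ((u : lser A) 0%N) + z * evg (ls_shift u).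
Proof. by rewrite {1}[u]shift_decomp evg_add.1 evg_const evg_XM. Qed.

End Evaluation.

Lemma evg_comp (R : realType) (A B C : banAlg R) (phi : A -> B) (z : B)
    (psi : B -> C) (u : ls_ban A) :
  ban_mor phi -> nm z <= 1 -> ban_mor psi ->
  psi (evg phi z u) = evg (psi \o phi) (psi z) u.
Proof.
move=> hphi hz hpsi; case: (hpsi) => ha hm _.
rewrite /evg (contr_add_Sum ha (evg_sumb hphi hz u)); congr nm_Sum.
by apply/funext => k /=; rewrite hm (ban_morX hpsi).
Qed.

Section MapSeries.
Variables (R : realType) (A B : banAlg R) (phi : A -> B).

Lemma ls_map_bd (u : lser A) : contr_add phi -> exists C, sumb (fun k => phi (u k)) C.
Proof. by move=> h; exists (ls_nm u); apply: (contr_add_sumb h); exact: ls_nm_sumb. Qed.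

Definition ls_map (h : contr_add phi) (u : ls_ban A) : ls_ban B := LSer (ls_map_bd u h).

Lemma ls_map_add (h : contr_add phi) : contr_add (ls_map h).
Proof.
split=> [u v|u]; first by apply: lserP => k /=; rewrite h.1.
by apply: (@ls_nm_le _ _ (ls_map h u)); apply: (contr_add_sumb h); exact: ls_nm_sumb.
Qed.

Lemma ls_map_mor (h : ban_mor phi) (h1 : contr_add phi) : ban_mor (ls_map h1).
Proof.
case: (h) => _ hm he; split; first exact: ls_map_add.
- move=> u v; apply: lserP => k /=; rewrite /cmul (contr_add_sum _ _ _ h1).
  by apply: eq_bigr => i _; rewrite hm.
- by move=> c; apply: lserP => -[|k] /=; rewrite ?he ?contr_add0.
Qed.

End MapSeries.

(* Locked: unification would otherwise unfold evaluations down to limits of series. *)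
HB.lock Definition evr (R : realType) (A : banAlg R) (x : R) (u : ls_ban A) : A :=
  evg idfun (emb A x) u.
Arguments evr {R A} x u.

(* The value at [x] of the formal derivative of [u]. *)
HB.lock Definition dser (R : realType) (A : banAlg R) (x : R) (u : ls_ban A) : A :=
  nm_Sum (fun k => (u : lser A) k.+1 * emb A (k.+1%:R * x ^+ k)).
Arguments dser {R A} x u.

(** * Evaluation at real points, Taylor expansion, formal derivative and integral *)

Section RealEvaluation.
Variables (R : realType) (A : banAlg R).
Local Notation L := (ls_ban A).
Implicit Types (u v : L) (x y l : R).

Lemma evrE x : evr x = evg idfun (emb A x) :> (L -> A).
Proof. by rewrite evr.unlock. Qed.

Lemma dserE x u :
  dser x u = nm_Sum (fun k => (u : lser A) k.+1 * emb A (k.+1%:R * x ^+ k)).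
Proof. by rewrite dser.unlock. Qed.

Lemma nm_emb_le1 x : `|x| <= 1 -> nm (emb A x) <= 1.
Proof. by move=> h; rewrite (le_trans (nm_emb _ _)). Qed.

Lemma evr_mor x : `|x| <= 1 -> @ban_mor R L A (evr x).
Proof. by move=> h; rewrite evrE; apply: evg_mor; [exact: ban_mor_id|exact: nm_emb_le1]. Qed.

Lemma evr_add x : `|x| <= 1 -> @contr_add R L A (evr x).
Proof. by move=> /evr_mor[]. Qed.

Lemma evr_shift x u : `|x| <= 1 ->
  evr x u = (u : lser A) 0%N + emb A x * evr x (ls_shift u).
Proof.
by move=> h; rewrite evrE; apply: evg_shift; [exact: ban_mor_id|exact: nm_emb_le1].
Qed.

Lemma evr0 u : evr 0 u = (u : lser A) 0%N.
Proof. by rewrite evr_shift ?normr0// rmorph0 mul0r addr0. Qed.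

Lemma evr_const x (c : A) : `|x| <= 1 -> evr x (ls_const c) = c.
Proof. by move=> h; rewrite evrE; apply: evg_const; exact: ban_mor_id. Qed.

Lemma evr_X x : `|x| <= 1 -> evr x (lsX A : L) = emb A x.
Proof. by move=> h; rewrite evrE; apply: evg_X; [exact: ban_mor_id|exact: nm_emb_le1]. Qed.

Lemma evr_dist0 x u : `|x| <= 1 -> nm (evr x u - (u : lser A) 0%N) <= `|x| * nm u.
Proof.
move=> h; rewrite evr_shift// addrC addKr (le_trans (nm_embM _ _))//.
by rewrite ler_wpM2l// (le_trans ((evr_add h).2 _))// nm_shift.
Qed.

Definition tay_pt x l : L := emb L x + emb L l * lsX A.

Lemma nm_tay_pt x l : `|x| + `|l| <= 1 -> nm (tay_pt x l) <= 1.
Proof.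
apply: le_trans; rewrite (le_trans (nmD _ _))// lerD//; first exact: nm_emb.
rewrite (le_trans (nm_embM _ _))// -[leRHS]mulr1 ler_wpM2l//.
exact: nm_lsX.
Qed.

(* Taylor expansion at [x], in the variable [l * X]. *)
Definition tay x l : L -> L := @evg R A L (@ls_const R A) (tay_pt x l).

Lemma tay_mor x l : `|x| + `|l| <= 1 -> ban_mor (tay x l).
Proof. by move=> h; apply: evg_mor; [exact: ls_const_mor|exact: nm_tay_pt]. Qed.

(** Both sides evaluate [u] by fixing constants and sending X to [x + l * y]; [evg_comp] reduces the
    claim to these data. *)
Lemma evr_tay x l y u : `|x| + `|l| <= 1 -> `|y| <= 1 ->
  evr y (tay x l u) = evr (x + l * y) u.
Proof.
move=> h hy; have my := evr_mor hy.
rewrite (evg_comp _ (@ls_const_mor _ A) (nm_tay_pt h) my) (evrE (x + l * y)).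
congr (evg _ _ u); first by apply/funext => c /=; exact: evr_const.
rewrite -[LHS]/(evr y (tay_pt x l)); case: my => -[ma _] mm me; rewrite /tay_pt; have := ma (emb L x) (emb L l * lsX A).
by rewrite mm !me => ->; rewrite rmorphD rmorphM -(evr_X hy).
Qed.

Lemma coef01_affineX (a b : A) k :
  let w : L := (ls_const a + ls_const b * lsX A) ^+ k in
  (w : lser A) 0%N = a ^+ k /\ (w : lser A) 1%N = b * a ^+ k.-1 *+ k.
Proof.
have c0 : (ls_const a + ls_const b * lsX A : lser A) 0%N = a.
  by rewrite lsD ls_constM mulr0 addr0.
have c1 : (ls_const a + ls_const b * lsX A : lser A) 1%N = b.
  by rewrite lsD ls_constM /= mulr1 add0r.
rewrite /=; move: (ls_const a + _) c0 c1 => w c0 c1.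
elim: k => [|k [IH0 IH1]] /=; first by rewrite !expr0 mulr0n.
rewrite exprS !lsM; split.
  by rewrite /cmul big_ord1 c0 IH0 exprS.
rewrite /cmul !big_ord_recl big_ord0 addr0 /bump/= subn0 subnn c0 c1 IH0 IH1.
case: k {IH0 IH1} => [|k] /=; first by rewrite expr0 mulr0n mulr0 add0r.
by rewrite mulrnAr mulrCA -exprS [RHS]mulrSr.
Qed.

Lemma tay_coef0 x l u : `|x| + `|l| <= 1 -> (tay x l u : lser A) 0%N = evr x u.
Proof.
move=> h; rewrite -evr0 evr_tay// ?normr0// ?mulr0 ?addr0//.
Qed.

Lemma tay_term x l u k : ((ls_const ((u : lser A) k) * tay_pt x l ^+ k : L) : lser A) 1%N =
  (u : lser A) k * emb A (l * x ^+ k.-1 *+ k).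
Proof.
rewrite ls_constM /tay_pt (coef01_affineX _ _ k).2.
by rewrite rmorphMn rmorphM rmorphXn.
Qed.

Lemma tay_term1 x l u : `|x| + `|l| <= 1 ->
  sumb (fun k => (u : lser A) k * emb A (l * x ^+ k.-1 *+ k)) (nm u).
Proof.
move=> h; apply: sumb_le (contr_add_sumb (coef_contr A 1)
  (evg_sumb (@ls_const_mor _ A) (nm_tay_pt h) u)) => k.
by rewrite -tay_term.
Qed.

Lemma tay_coef1 x l u : `|x| + `|l| <= 1 -> (tay x l u : lser A) 1%N =
  nm_Sum (fun k => (u : lser A) k * emb A (l * x ^+ k.-1 *+ k)).
Proof.
move=> h; rewrite /tay /evg (ls_ban_SumE _ (evg_sumb (@ls_const_mor _ A) (nm_tay_pt h) u)).
by congr nm_Sum; apply/funext => k; rewrite -tay_term.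
Qed.

(** Recentring at [x] with the largest admissible scale [l = 1 - |x|] is contracting, so the terms
    of its first coefficient, which are [l] times those of the derivative, have norm sum at most
    [nm u]. Division by [l] gives the bound. *)
Lemma dser_sumb x u : `|x| < 1 ->
  sumb (fun k => (u : lser A) k.+1 * emb A (k.+1%:R * x ^+ k)) (nm u / (1 - `|x|)).
Proof.
move=> h; have l0 : 0 < 1 - `|x| by lra.
have hl : `|x| + `|1 - `|x| | <= 1 by rewrite (gtr0_norm l0); lra.
have := sumbM (emb A (1 - `|x|)^-1) (sumb_shift (@tay_term1 _ _ u hl)) => /= hs n.
rewrite mulrC; have := le_trans (hs n) (ler_wpM2r (nm_ge0 u) (nm_emb A _)).
rewrite (@ger0_norm _ (1 - `|x|)^-1) ?invr_ge0 ?(ltW l0)//; apply: le_trans.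
apply: ler_sum => i _; rewrite mulrCA -rmorphM -mulrnAr mulrA mulVf ?mul1r ?gt_eqF//.
by rewrite mulr_natl.
Qed.

Lemma tay_coef1E x l u : `|x| < 1 -> `|x| + `|l| <= 1 ->
  (tay x l u : lser A) 1%N = emb A l * dser x u.
Proof.
move=> hx h; rewrite tay_coef1// (nm_SumS (@tay_term1 _ _ u h)).
rewrite mulr0n rmorph0 mulr0 add0r !dserE -(nm_SumM _ (dser_sumb u hx)).
congr nm_Sum; apply/funext => k /=.
by rewrite mulrCA -rmorphM -mulrnAr mulr_natl.
Qed.

Lemma int_bd u : exists C, sumb
  (fun k => if k is k'.+1 then (u : lser A) k' * emb A k'.+1%:R^-1 else 0) C.
Proof.
exists (nm u) => -[|n]; first by rewrite big_ord0 nm_ge0.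
rewrite big_ord_recl nm0 add0r (le_trans _ (ls_nm_sumb u n))//.
apply: ler_sum => i _; rewrite /= mulrC (le_trans (nm_embM _ _))//.
rewrite -[leRHS]mul1r ler_wpM2r ?nm_ge0// ger0_norm ?invr_ge0//.
by rewrite invf_le1// ler1n.
Qed.
Definition ls_int u : L := LSer (int_bd u).

Lemma ls_int_add : contr_add ls_int.
Proof.
split=> [u v|u].
  by apply: lserP => -[|k] /=; rewrite ?addr0// mulrDl.
apply: (@ls_nm_le _ _ (ls_int u)) => -[|n]; first by rewrite big_ord0 nm_ge0.
rewrite big_ord_recl nm0 add0r (le_trans _ (ls_nm_sumb u n))//.
apply: ler_sum => i _; rewrite /= mulrC (le_trans (nm_embM _ _))//.
rewrite -[leRHS]mul1r ler_wpM2r ?nm_ge0// ger0_norm ?invr_ge0//.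
by rewrite invf_le1// ler1n.
Qed.

Lemma dser_int x u : `|x| < 1 -> dser x (ls_int u) = evr x u.
Proof.
move=> hx; rewrite dserE evrE /evg; congr nm_Sum; apply/funext => k /=.
by rewrite -mulrA -rmorphM mulrA mulVf ?pnatr_eq0// mul1r rmorphXn.
Qed.

Lemma dser_add x u v : `|x| < 1 -> dser x (u + v) = dser x u + dser x v.
Proof.
move=> hx; rewrite !dserE -(nm_SumD (dser_sumb u hx) (dser_sumb v hx)).
by congr nm_Sum; apply/funext => k; rewrite lsD mulrDl.
Qed.

Lemma dser_constM x (c : A) u : `|x| < 1 -> dser x (ls_const c * u) = c * dser x u.
Proof.
move=> hx; rewrite !dserE -(nm_SumM _ (dser_sumb u hx)).
by congr nm_Sum; apply/funext => k; rewrite ls_constM mulrA.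
Qed.

Lemma dser_const x (c : A) : dser x (ls_const c) = 0.
Proof.
by rewrite dserE (@nm_Sum_fin _ _ _ 0) ?big_ord0// => k _; rewrite mul0r.
Qed.

Lemma nm_dser x u : `|x| < 1 -> nm (dser x u) <= nm u / (1 - `|x|).
Proof. by move=> hx; rewrite dserE; exact: nm_Sum_le (dser_sumb u hx). Qed.

(** After recentring at [x] with scale [l = 1 - |x|], the remainder is the square of [h / l] times
    the value of the twice shifted series, and shifting does not increase the norm. *)
Lemma evr_taylor1 x h u : `|x| < 1 -> `|x| + `|h| <= 1 ->
  nm (evr (x + h) u - evr x u - emb A h * dser x u) <=
    (`|h| / (1 - `|x|)) ^+ 2 * nm u.
Proof.
move=> hx hh; have l0 : 0 < 1 - `|x| by lra.
set l := 1 - `|x| in l0 *.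
have hl : `|x| + `|l| <= 1 by rewrite (gtr0_norm l0) /l; lra.
have hy : `|h / l| <= 1 by rewrite normrM normfV (gtr0_norm l0) ler_pdivrMr// mul1r /l; lra.
have -> : x + h = x + l * (h / l) by rewrite mulrCA mulfV ?gt_eqF// mulr1.
rewrite -evr_tay// evr_shift// (evr_shift (ls_shift _))//= tay_coef0// tay_coef1E//.
set w := ls_shift (ls_shift _).
have -> : emb A h = emb A (h / l) * emb A l by rewrite -rmorphM mulfVK ?gt_eqF.
set a := evr x u; set b := emb A (h / l).
have -> : a + b * (emb A l * dser x u + b * evr (h / l) w) - a - b * emb A l * dser x u =
  b * (b * evr (h / l) w) by ring.
rewrite (le_trans (nm_embM _ _))// normrM normfV (gtr0_norm l0) expr2 -mulrA.
rewrite ler_wpM2l ?divr_ge0 ?(ltW l0)// (le_trans (nm_embM _ _))//.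
rewrite normrM normfV (gtr0_norm l0) ler_wpM2l ?divr_ge0 ?(ltW l0)//.
rewrite (le_trans ((evr_add hy).2 _))// (le_trans (nm_shift _))// (le_trans (nm_shift _))//.
by case: (tay_mor hl) => -[_ + _ _]; exact.
Qed.

End RealEvaluation.

Lemma is_derive_taylor (R : realType) (f : R -> R) (x d C r : R) : 0 < r ->
  (forall h, `|h| < r -> `|f (x + h) - f x - h * d| <= C * h ^+ 2) ->
  is_derive x 1 f d.
Proof.
move=> r0 hC.
have key : h^-1 *: (f (h *: 1 + x) - f x) @[h --> 0^'] --> d.
  apply/cvgrPdist_le => /= e e0.
  have C0 : 0 <= `|C| := normr_ge0 C.
  have d0 : 0 < e / (`|C| + 1) by rewrite divr_gt0//; lra.
  near=> h.
  have h0 : h != 0 by near: h; exact: nbhs_dnbhs_neq.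
  have hr : `|h| < r by near: h; exact: dnbhs0_lt.
  have he : `|h| < e / (`|C| + 1) by near: h; exact: dnbhs0_lt.
  have := hC h hr; rewrite /GRing.scale/= mulr1 [h + x]addrC.
  move: (f (x + h) - f x) => q hq.
  have -> : d - h^-1 * q = - (h^-1 * (q - h * d)) by rewrite mulrBr mulKf// opprB.
  rewrite normrN normrM normfV ler_pdivrMl ?normr_gt0// (le_trans hq)//.
  rewrite (le_trans (ler_norm _))// normrM normrX expr2 mulrA mulrC ler_wpM2l//.
  rewrite ltr_pdivlMr in he; last by lra.
  by have := normr_ge0 h; nra.
apply: DeriveDef; first exact: cvgP key.
exact: cvg_lim key.
Unshelve. all: by end_near. Qed.

Section RealSeries.
Variable R : realType.
Local Notation L := (ls_ban (real_ban R)).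

Definition evR (x : R) (u : L) : R := evr x u.
Definition devR (x : R) (u : L) : R := dser x u.

Lemma is_derive_evR (x : R) (u : L) : `|x| < 1 ->
  is_derive x 1 (fun y => evR y u) (devR x u).
Proof.
move=> hx; have l0 : 0 < 1 - `|x| by lra.
apply: (@is_derive_taylor _ _ _ _ (nm u / (1 - `|x|) ^+ 2) _ l0) => h hh.
have := @evr_taylor1 _ (real_ban R) x h u hx; rewrite -lerBrDl => /(_ (ltW hh)).
move=> /le_trans; apply.
by rewrite expr_div_n real_normK ?num_real// [leLHS]mulrC mulrA mulrAC.
Qed.

End RealSeries.

(** * Functorially analytic functions *)

Section Fan.
Variables (R : realType).
Local Notation RR := (real_ban R).

Definition in_ball (I : finType) (A : banAlg R) (a : I -> R) (r : R) (w : I -> A) :=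
  forall i, nm (w i - emb A (a i)) <= r.

(* [fan] stands for "functorially analytic": [F] extends [f], near [a], to all
   Banach algebras, functorially for norm-decreasing morphisms. *)
Record fan_ext (I : finType) (f : (I -> R) -> R) (a : I -> R) (r K : R)
    (F : forall A : banAlg R, (I -> A) -> A) : Prop := FanExt {
  fe_r : 0 < r;
  fe_K : 0 <= K;
  fe_val : forall w : I -> R, @in_ball I RR a r w -> F RR w = f w;
  fe_lip : forall (A : banAlg R) (w w' : I -> A) d, in_ball a r w -> in_ball a r w' ->
    0 <= d -> (forall i, nm (w i - w' i) <= d) -> nm (F A w - F A w') <= K * d;
  fe_nat : forall (A B : banAlg R) (phi : A -> B), ban_mor phi ->
    forall w, in_ball a r w -> phi (F A w) = F B (phi \o w) }.

Definition fan (I : finType) (f : (I -> R) -> R) (a : I -> R) :=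
  exists r K F, @fan_ext I f a r K F.

Section Basics.
Variable I : finType.
Implicit Types (f g : (I -> R) -> R) (a b : I -> R).

Lemma in_ball_le (A : banAlg R) a r r' (w : I -> A) :
  r <= r' -> in_ball a r w -> in_ball a r' w.
Proof. by move=> h hw i; rewrite (le_trans (hw i)). Qed.

Lemma in_ball_mor (A B : banAlg R) (phi : A -> B) a r (w : I -> A) :
  ban_mor phi -> in_ball a r w -> in_ball a r (phi \o w).
Proof.
case=> h1 h2 h3 hw i /=; rewrite -h3 -contr_addB//.
by rewrite (le_trans (h1.2 _)).
Qed.

Lemma in_ball_center (A : banAlg R) a r : 0 <= r -> in_ball a r (fun i => emb A (a i)).
Proof. by move=> h i; rewrite subrr nm0. Qed.

Lemma fan_ext_le f a r K F r' K' : 0 < r' -> r' <= r -> K <= K' ->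
  @fan_ext I f a r K F -> @fan_ext I f a r' K' F.
Proof.
move=> r0 hr hK [h0 hK0 h1 h2 h3]; split => //.
- by rewrite (le_trans hK0).
- by move=> w /(in_ball_le hr); exact: h1.
- move=> A w w' d /(in_ball_le hr) hw /(in_ball_le hr) hw' d0 hd.
  by rewrite (le_trans (h2 _ _ _ _ hw hw' d0 hd))// ler_wpM2r.
- by move=> A B phi hphi w /(in_ball_le hr); exact: h3.
Qed.

Lemma fan_ext_center f a r K F (A : banAlg R) : @fan_ext I f a r K F ->
  F A (fun i => emb A (a i)) = emb A (f a).
Proof.
case=> r0 _ hv _ hn.
have ha : @in_ball I RR a r a by exact: (@in_ball_center RR a r (ltW r0)).
by rewrite -(hv a ha) (hn _ _ _ (ban_mor_emb A) _ ha).
Qed.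

Lemma fan_ext_dist f a r K F (A : banAlg R) r' (w : I -> A) : @fan_ext I f a r K F ->
  0 <= r' -> r' <= r -> in_ball a r' w -> nm (F A w - emb A (f a)) <= K * r'.
Proof.
move=> h r'0 hr hw; rewrite -(fan_ext_center A h).
apply: (fe_lip h); [exact: in_ball_le hw| |exact: r'0|exact: hw].
by apply: in_ball_center; exact: ltW (fe_r h).
Qed.

Lemma fan_ext_bound f a r K F (A : banAlg R) (w : I -> A) : @fan_ext I f a r K F ->
  in_ball a r w -> nm (F A w) <= `|f a| + K * r.
Proof.
move=> h hw; have := fan_ext_dist h (ltW (fe_r h)) (lexx _) hw => hd.
rewrite -(subrK (emb A (f a)) (F A w)) (le_trans (nmD _ _))// addrC.
by rewrite lerD// nm_emb.
Qed.

Lemma fan_near f g a r : 0 < r ->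
  (forall w, (forall i, `|w i - a i| <= r) -> f w = g w) -> fan f a -> fan g a.
Proof.
move=> r0 hfg [r1 [K [F h]]]; exists (Num.min r r1), K, F.
have m0 : 0 < Num.min r r1 by rewrite lt_min r0 (fe_r h).
have mr : Num.min r r1 <= r1 by rewrite ge_min lexx orbT.
have [h0 h1 h2 h3 h4] := fan_ext_le m0 mr (lexx K) h.
split => // w hw; rewrite h2// hfg// => i.
by apply: le_trans (hw i) _; rewrite ge_min lexx.
Qed.

Lemma fan_const c a : fan (fun=> c) a.
Proof.
exists 1, 0, (fun A _ => emb A c); split => //.
- by move=> A w w' d _ _ d0 _; rewrite subrr nm0 mul0r.
- by move=> A B phi [_ _ h] w _; rewrite h.
Qed.

Lemma fan_proj i a : fan (fun w => w i) a.
Proof.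
exists 1, 1, (fun A w => w i); split => //.
by move=> A w w' d _ _ d0 /(_ i); rewrite mul1r.
Qed.

Lemma fan_ext_common f g a r K F r' K' G :
  @fan_ext I f a r K F -> @fan_ext I g a r' K' G ->
  exists s, exists2 L, @fan_ext I f a s L F & @fan_ext I g a s L G.
Proof.
move=> h h'; have m0 : 0 < Num.min r r' by rewrite lt_min (fe_r h) (fe_r h').
exists (Num.min r r'), (K + K').
- apply: fan_ext_le h => //; first by rewrite ge_min lexx.
  by rewrite lerDl (fe_K h').
- apply: fan_ext_le h' => //; first by rewrite ge_min lexx orbT.
  by rewrite lerDr (fe_K h).
Qed.

Lemma fan_add f g a : fan f a -> fan g a -> fan (fun w => f w + g w) a.
Proof.
case=> r1 [K1 [F h1]] [r2 [K2 [G h2]]].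
have [r [K hF hG]] := fan_ext_common h1 h2.
exists r, (K + K), (fun A w => F A w + G A w); split => //; first exact: (fe_r hF).
- by rewrite addr_ge0 ?(fe_K hF).
- by move=> w hw; rewrite /= (fe_val hF hw) (fe_val hG hw).
- move=> A w w' d hw hw' d0 hd; rewrite opprD addrACA (le_trans (nmD _ _))// mulrDl.
  by rewrite lerD// ?(fe_lip hF)// (fe_lip hG).
- move=> A B phi hphi w hw; rewrite -(fe_nat hF hphi hw) -(fe_nat hG hphi hw).
  by case: hphi => -[].
Qed.

Lemma fan_mul f g a : fan f a -> fan g a -> fan (fun w => f w * g w) a.
Proof.
case=> r1 [K1 [F h1]] [r2 [K2 [G h2]]].
have [r [K hF hG]] := fan_ext_common h1 h2.
have Kr : 0 <= K * r by rewrite mulr_ge0 ?(fe_K hF)// ltW// (fe_r hF).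
set M := `|f a| + `|g a| + K * r.
have M0 : 0 <= M by rewrite !addr_ge0.
exists r, (M * K + M * K), (fun A w => F A w * G A w); split => //; first exact: (fe_r hF).
- by rewrite addr_ge0// mulr_ge0// (fe_K hF).
- by move=> w hw; rewrite /= (fe_val hF hw) (fe_val hG hw).
- move=> A w w' d hw hw' d0 hd.
  have bF := fan_ext_bound hF hw; have bG := fan_ext_bound hG hw'.
  have -> : F A w * G A w - F A w' * G A w' =
    F A w * (G A w - G A w') + G A w' * (F A w - F A w') by ring.
  rewrite (le_trans (nmD _ _))// mulrDl -!mulrA lerD//.
    rewrite (le_trans (nmM _ _))// ler_pM ?nm_ge0 ?(fe_lip hG)//.
    by rewrite (le_trans bF)// /M lerD2r lerDl.
  rewrite (le_trans (nmM _ _))// ler_pM ?nm_ge0 ?(fe_lip hF)//.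
  by rewrite (le_trans bG)// /M lerD2r lerDr.
- move=> A B phi hphi w hw; rewrite -(fe_nat hF hphi hw) -(fe_nat hG hphi hw).
  by case: hphi => _ ->.
Qed.

Lemma fan_opp f a : fan f a -> fan (fun w => - f w) a.
Proof.
move=> h; have := fan_mul (fan_const (-1) a) h.
by apply: (fan_near ltr01) => w _; rewrite mulN1r.
Qed.

Lemma fan_sum (T : Type) (s : seq T) (P : pred T) (F : T -> (I -> R) -> R) a :
  (forall i, P i -> fan (F i) a) -> fan (fun w => \sum_(i <- s | P i) F i w) a.
Proof.
move=> h; elim: s => [|i s IH].
  by apply: (fan_near ltr01 _ (fan_const 0 a)) => w _; rewrite big_nil.
case E : (P i); last by apply: (fan_near ltr01 _ IH) => w _; rewrite big_cons E.
by apply: (fan_near ltr01 _ (fan_add (h _ E) IH)) => w _; rewrite big_cons E.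
Qed.

Lemma fan_prod (T : Type) (s : seq T) (P : pred T) (F : T -> (I -> R) -> R) a :
  (forall i, P i -> fan (F i) a) -> fan (fun w => \prod_(i <- s | P i) F i w) a.
Proof.
move=> h; elim: s => [|i s IH].
  by apply: (fan_near ltr01 _ (fan_const 1 a)) => w _; rewrite big_nil.
case E : (P i); last by apply: (fan_near ltr01 _ IH) => w _; rewrite big_cons E.
by apply: (fan_near ltr01 _ (fan_mul (h _ E) IH)) => w _; rewrite big_cons E.
Qed.

End Basics.

Lemma fan_reindex (I J : finType) (s : I -> J) (f : (I -> R) -> R) (a : J -> R) :
  fan f (a \o s) -> fan (fun w => f (w \o s)) a.
Proof.
case=> r [K [F h]]; exists r, K, (fun A w => F A (w \o s)).
have hin (A : banAlg R) (w : J -> A) : in_ball a r w -> in_ball (a \o s) r (w \o s).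
  by move=> hw i; exact: hw.
split => //; [exact: fe_r h|exact: fe_K h|..].
- by move=> w hw; apply: (fe_val h); exact: (hin RR).
- by move=> A w w' d /hin hw /hin hw' d0 hd; apply: (fe_lip h) => // i; exact: hd.
- by move=> A B phi hphi w /hin hw; rewrite (fe_nat h hphi hw).
Qed.

(** * Inverses near nonzero scalars *)

Section Inverse.
Variable A : banAlg R.

Definition neu (y : A) : A := nm_Sum (fun k => y ^+ k).

Lemma neu_sumb y : nm y <= 2^-1 -> @sumb R A (fun k => y ^+ k) 2.
Proof.
move=> hy; have h0 := nm_ge0 y.
have : forall n, \sum_(i < n) nm (y ^+ i) <= 2 - 2 * 2^-1 ^+ n.
  elim=> [|n IH]; first by rewrite big_ord0 expr0; lra.
  rewrite big_ord_recr/= exprS mulrA mulfV// mul1r.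
  have : nm (y ^+ n) <= 2^-1 ^+ n by rewrite (le_trans (nmX _ _))// lerXn2r// nnegrE.
  by move: IH; lra.
move=> h n; rewrite (le_trans (h n))//.
have : 0 <= 2^-1 ^+ n :> R by rewrite exprn_ge0//.
lra.
Qed.

Lemma neu_mul y : nm y <= 2^-1 -> (1 - y) * neu y = 1.
Proof.
move=> hy; have hs := neu_sumb hy.
rewrite mulrBl mul1r {1}/neu (nm_SumS hs) expr0 /neu -(nm_SumM _ hs).
rewrite [X in _ - X](_ : _ = nm_Sum (fun i => y ^+ i.+1)) ?addrK//.
by congr nm_Sum; apply/funext => i; rewrite exprS.
Qed.

(** The inverse of [z] near the scalar [c]: write [z = c (1 - y)] with [y = 1 - z / c] small and
    invert [1 - y] by its Neumann series. *)
Definition binv (c : R) (z : A) : A := emb A c^-1 * neu (1 - emb A c^-1 * z).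

Lemma binv_small c z : c != 0 -> nm (z - emb A c) <= `|c| / 2 ->
  nm (1 - emb A c^-1 * z) <= 2^-1.
Proof.
move=> c0 hz; have -> : 1 - emb A c^-1 * z = - (emb A c^-1 * (z - emb A c)).
  by rewrite mulrBr -rmorphM mulVf// rmorph1 opprB.
rewrite nmN (le_trans (nm_embM _ _))// normfV ler_pdivrMl ?normr_gt0//.
Qed.

Lemma binv_mul c z : c != 0 -> nm (z - emb A c) <= `|c| / 2 -> z * binv c z = 1.
Proof.
move=> c0 hz; have := neu_mul (binv_small c0 hz).
by rewrite opprB addrC subrK /binv mulrCA mulrA.
Qed.

Lemma nm_binv c z : c != 0 -> nm (z - emb A c) <= `|c| / 2 ->
  nm (binv c z) <= 2 / `|c|.
Proof.
move=> c0 hz; rewrite (le_trans (nm_embM _ _))// normfV mulrC ler_wpM2r ?invr_ge0//.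
exact: nm_Sum_le (neu_sumb (binv_small c0 hz)).
Qed.

End Inverse.

Lemma binv_mor (A B : banAlg R) (phi : A -> B) c (z : A) : ban_mor phi ->
  c != 0 -> nm (z - emb A c) <= `|c| / 2 -> phi (binv c z) = binv c (phi z).
Proof.
move=> hphi c0 hz; case: (hphi) => ha hm he; rewrite /binv hm he; congr (_ * _).
rewrite /neu (contr_add_Sum ha (neu_sumb (binv_small c0 hz))); congr nm_Sum.
apply/funext => k /=; rewrite (ban_morX hphi); congr (_ ^+ _).
by rewrite contr_addB// hm he (ban_mor1 hphi).
Qed.

Lemma fan_inv (I : finType) (f : (I -> R) -> R) a :
  fan f a -> f a != 0 -> fan (fun w => (f w)^-1) a.
Proof.
case=> r [K [F h]] c0; set c := f a in c0.
have cp : 0 < `|c| by rewrite normr_gt0.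
have K0 := fe_K h; have r0 := fe_r h.
(* Within this radius the Lipschitz bound keeps [F A w] at distance at most [|c| / 2] from the
   scalar [c], where [binv] is an inverse; [K + 1] avoids a zero denominator. *)
set r' := Num.min r (`|c| / (2 * (K + 1))).
have r'0 : 0 < r' by rewrite lt_min r0 divr_gt0// mulr_gt0//; lra.
have hr : r' <= r by rewrite ge_min lexx.
have hsm (A : banAlg R) (w : I -> A) : in_ball a r' w -> nm (F A w - emb A c) <= `|c| / 2.
  move=> hw; rewrite (le_trans (fan_ext_dist h (ltW r'0) hr hw))//.
  apply: (@le_trans _ _ (K * (`|c| / (2 * (K + 1))))).
    by rewrite ler_wpM2l// ge_min lexx orbT.
  rewrite mulrA ler_pdivrMr; last by lra.
  nra.
exists r', ((2 / `|c|) * (2 / `|c|) * K), (fun A w => binv c (F A w)).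
have h' := fan_ext_le r'0 hr (lexx K) h.
split => //.
- by rewrite !mulr_ge0.
- move=> w hw; have := binv_mul c0 (hsm _ _ hw); rewrite (fe_val h' hw) => E.
  have fw0 : f w != 0.
    by apply/eqP => f0; move: E; rewrite f0 mul0r => /esym/eqP; rewrite oner_eq0.
  by apply: (mulfI fw0); rewrite E mulfV.
- move=> A w w' d hw hw' d0 hd.
  have e1 := binv_mul c0 (hsm _ _ hw); have e2 := binv_mul c0 (hsm _ _ hw').
  have n1 := nm_binv c0 (hsm _ _ hw); have n2 := nm_binv c0 (hsm _ _ hw').
  set p := binv c (F A w) in e1 n1 *; set q := binv c (F A w') in e2 n2 *.
  have -> : p - q = p * q * (F A w' - F A w).
    have -> : p * q * (F A w' - F A w) = p * (F A w' * q) - q * (F A w * p) by ring.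
    by rewrite e1 e2 !mulr1.
  rewrite -[leRHS]mulrA (le_trans (nmM _ _))// ler_pM ?nm_ge0//.
    by rewrite (le_trans (nmM _ _))// ler_pM ?nm_ge0.
  by rewrite nm_distC (fe_lip h').
- by move=> A B phi hphi w hw; rewrite (binv_mor hphi c0 (hsm _ _ hw)) (fe_nat h' hphi hw).
Qed.

End Fan.

(** * Convergent power series are functorially analytic *)

Section AnalyticFan.
Variables (R : realType) (n : nat).
Local Notation RR := (real_ban R).

Definition rv (w : 'I_n -> R) : 'rV[R]_n := \row_i w i.

Lemma rvE w i : rv w 0 i = w i. Proof. by rewrite mxE. Qed.

Lemma rvK (u : 'rV[R]_n) : rv (fun i => u 0 i) = u.
Proof. by apply/rowP => i; rewrite mxE. Qed.

Lemma rv_normP (u : 'rV[R]_n) (d : R) : 0 <= d ->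
  `|u| <= d <-> forall i, `|u 0 i| <= d.
Proof.
move=> d0; rewrite -[`|u|]/(mx_norm u) mx_normrE; split.
  move=> h i; rewrite (le_trans _ h)//.
  exact: (le_bigmax _ (fun ij : 'I_1 * 'I_n => `|u ij.1 ij.2|) (0, i)).
by move=> h; apply: bigmax_le => //= -[i j] _ /=; rewrite ord1.
Qed.

Definition hpA (A : banAlg R) (c : {ffun 'I_n -> nat} -> R) (k : nat)
    (v : 'I_n -> A) : A :=
  \sum_(m : {ffun 'I_n -> 'I_k.+1} | (\sum_i (m i : nat))%N == k)
     emb A (c [ffun i => m i : nat]) * \prod_i v i ^+ m i.

Lemma hpA_real c k (v : 'rV[R]_n) : @hpA RR c k (fun i => v 0 i) = homog_part c k v.
Proof. by []. Qed.

Lemma prod_pow_bound (A : banAlg R) (v : 'I_n -> A) r (m : 'I_n -> nat) :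
  0 <= r -> (forall i, nm (v i) <= r) ->
  nm (\prod_i v i ^+ m i) <= \prod_(i < n) r ^+ m i.
Proof.
move=> r0 hv; elim/big_rec2: _ => [|i x y _ IH]; first exact: nm1_le.
rewrite (le_trans (nmM _ _))// ler_pM ?nm_ge0// (le_trans (nmX _ _))//.
by rewrite lerXn2r// nnegrE// nm_ge0.
Qed.

Lemma hpA_bound (A : banAlg R) c k (v : 'I_n -> A) r : 0 <= r ->
  (forall i, nm (v i) <= r) ->
  nm (hpA c k v) <= homog_part (fun m => `|c m|) k (const_mx r).
Proof.
move=> r0 hv; rewrite (le_trans (nm_sum _ _ _))//; apply: ler_sum => m _.
rewrite (le_trans (nm_embM _ _))// ler_wpM2l//.
rewrite (le_trans (prod_pow_bound _ r0 hv))//.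
by rewrite le_eqVlt; apply/orP; left; apply/eqP; apply: eq_bigr => i _; rewrite mxE.
Qed.

(* [P x y k]: a degree-[k] product of factors of norm at most [r], two by two
   [d]-close; the factor [r] on the left of the last bound avoids [r ^+ k.-1]. *)
Let P (A : banAlg R) (r d : R) (x y : A) (k : nat) :=
  [/\ nm x <= r ^+ k, nm y <= r ^+ k & r * nm (x - y) <= k%:R * r ^+ k * d].

Let P_mul (A : banAlg R) r d (x y x' y' : A) k k' : 0 <= r -> 0 <= d ->
  P r d x y k -> P r d x' y' k' -> P r d (x * x') (y * y') (k + k').
Proof.
move=> r0 d0 [a1 a2 a3] [b1 b2 b3]; split.
- by rewrite exprD (le_trans (nmM _ _))// ler_pM ?nm_ge0.
- by rewrite exprD (le_trans (nmM _ _))// ler_pM ?nm_ge0.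
have -> : x * x' - y * y' = x' * (x - y) + y * (x' - y') by ring.
apply: (@le_trans _ _ (r * (nm x' * nm (x - y) + nm y * nm (x' - y')))).
  by rewrite ler_wpM2l// (le_trans (nmD _ _))// lerD// nmM.
have c1 : nm x' * (r * nm (x - y)) <= r ^+ k' * (k%:R * r ^+ k * d).
  by rewrite ler_pM ?nm_ge0// mulr_ge0// nm_ge0.
have c2 : nm y * (r * nm (x' - y')) <= r ^+ k * (k'%:R * r ^+ k' * d).
  by rewrite ler_pM ?nm_ge0// mulr_ge0// nm_ge0.
rewrite natrD exprD.
have -> : r * (nm x' * nm (x - y) + nm y * nm (x' - y')) =
  nm x' * (r * nm (x - y)) + nm y * (r * nm (x' - y')) by ring.
rewrite (le_trans (lerD c1 c2))// le_eqVlt; apply/orP; left; apply/eqP; ring.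
Qed.

Let P_one (A : banAlg R) r d : @P A r d 1 1 0.
Proof. by split; rewrite ?expr0 ?nm1_le// subrr nm0 mulr0 !mul0r. Qed.

Let P_exp (A : banAlg R) r d (x y : A) k : 0 <= r -> 0 <= d ->
  nm x <= r -> nm y <= r -> nm (x - y) <= d -> P r d (x ^+ k) (y ^+ k) k.
Proof.
move=> r0 d0 hx hy hd; elim: k => [|k IH]; first by rewrite !expr0; exact: P_one.
rewrite !exprS -add1n; apply: P_mul => //; split; rewrite ?expr1//.
by rewrite mul1r ler_wpM2l.
Qed.

Let P_prod (A : banAlg R) r d (v v' : 'I_n -> A) (m : 'I_n -> nat) : 0 <= r -> 0 <= d ->
  (forall i, nm (v i) <= r) -> (forall i, nm (v' i) <= r) ->
  (forall i, nm (v i - v' i) <= d) ->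
  P r d (\prod_i v i ^+ m i) (\prod_i v' i ^+ m i) (\sum_i m i).
Proof.
move=> r0 d0 h1 h2 h3; elim/big_rec3: _ => [|i k x y _ IH]; first exact: P_one.
by apply: P_mul => //; exact: P_exp.
Qed.

(** Halving the radius absorbs the factor [k] in the Lipschitz constant of a monomial of degree [k],
    because [k <= 2 ^ k]. *)
Lemma hpA_lip (A : banAlg R) c k (v v' : 'I_n -> A) r d : 0 < r -> 0 <= d ->
  (forall i, nm (v i) <= r / 2) -> (forall i, nm (v' i) <= r / 2) ->
  (forall i, nm (v i - v' i) <= d) ->
  nm (hpA c k v - hpA c k v') <=
    homog_part (fun m => `|c m|) k (const_mx r) * (2 / r * d).
Proof.
move=> r0 d0 h1 h2 h3; have r20 : 0 <= r / 2 by lra.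
rewrite -sumrB (le_trans (nm_sum _ _ _))// mulr_suml; apply: ler_sum => m /eqP mk.
rewrite -mulrBr (le_trans (nm_embM _ _))// -mulrA ler_wpM2l//.
have [_ _ hp] := @P_prod A _ _ _ _ (fun i => m i : nat) r20 d0 h1 h2 h3.
rewrite mk in hp.
have -> : \prod_i (const_mx r : 'rV[R]_n) 0 i ^+ m i = r ^+ k.
  transitivity (r ^+ (\sum_i (m i : nat))); last by rewrite mk.
  by rewrite -prodrXr; apply: eq_bigr => i _; rewrite mxE.
have k2 : k%:R <= 2 ^+ k :> R by rewrite -natrX ler_nat ltnW// ltn_expl.
have : r / 2 * nm (\prod_i v i ^+ m i - \prod_i v' i ^+ m i) <= r ^+ k * d.
  rewrite (le_trans hp)// ler_wpM2r// expr_div_n mulrCA ler_piMr ?exprn_ge0 ?(ltW r0)//.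
  by rewrite ler_pdivrMr ?exprn_gt0// mul1r.
move=> hq; rewrite mulrCA -ler_pdivrMl; last by rewrite divr_gt0.
by rewrite invf_div.
Qed.

Lemma hpA_mor (A B : banAlg R) (phi : A -> B) c k (v : 'I_n -> A) : ban_mor phi ->
  phi (hpA c k v) = hpA c k (phi \o v).
Proof.
move=> h; case: (h) => ha hm he; rewrite /hpA (contr_add_sum _ _ _ ha).
apply: eq_bigr => m _; rewrite hm he; congr (_ * _).
rewrite (big_morph phi hm (ban_mor1 h)); apply: eq_bigr => i _.
by rewrite (ban_morX h).
Qed.

(** The coefficients are real, so the same series can be summed over any commutative Banach algebra;
    morphisms fix real scalars and commute with sums, whence naturality. The radius is halved for
    the sake of [hpA_lip]. *)
Lemma analytic_fan (f : 'rV[R]_n -> R) (a : 'rV[R]_n) : analytic_at f a ->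
  fan (f \o rv) (fun i => a 0 i).
Proof.
case=> c [r [r0 cvr cvf]].
set H := fun k => homog_part (fun m => `|c m|) k (const_mx r) in cvr.
have H0 k : 0 <= H k.
  apply: sumr_ge0 => m _; apply: mulr_ge0 => //; apply: prodr_ge0 => i _.
  by rewrite mxE exprn_ge0// ltW.
set C := limn (series H).
have HC N : \sum_(k < N) H k <= C.
  rewrite -(seriesE H); apply: nondecreasing_cvgn_le => //.
  by apply: nondecreasing_series => k _ _; exact: H0.
have C0 : 0 <= C by have := HC 0%N; rewrite big_ord0.
pose a' (i : 'I_n) := a 0 i.
pose F (A : banAlg R) (w : 'I_n -> A) : A :=
  nm_Sum (fun k => hpA c k (fun i => w i - emb A (a' i))).
have hs (A : banAlg R) (w : 'I_n -> A) : in_ball a' (r / 2) w ->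
    @sumb R A (fun k => hpA c k (fun i => w i - emb A (a' i))) C.
  move=> hw N; rewrite (le_trans _ (HC N))//; apply: ler_sum => k _.
  apply: hpA_bound => [|i]; first exact: ltW.
  by rewrite (le_trans (hw i))//; lra.
exists (r / 2), (C * (2 / r)), F; split.
- lra.
- by rewrite mulr_ge0// divr_ge0// ltW.
- move=> w hw; have hn : `|rv w - a| < r.
    have : `|rv w - a| <= r / 2.
      apply/rv_normP => [|i]; first by lra.
      by have := hw i; rewrite !mxE.
    by move=> /le_lt_trans; apply; lra.
  have := real_Sum_cvg (hs _ _ hw).
  have := cvf _ hn.
  rewrite (_ : (fun k => homog_part c k (rv w - a)) =
    (fun k => @hpA RR c k (fun i => w i - a' i))); last first.
    apply/funext => k; rewrite -hpA_real; congr (@hpA RR c k _).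
    by apply/funext => i; rewrite !mxE.
  by move=> h1 h2; exact: (cvg_unique (@Rhausdorff R) h2 h1).
- move=> A w w' d hw hw' d0 hd.
  have sb : @sumb R A (fun k => - hpA c k (fun i => w' i - emb A (a' i))) C.
    by apply: sumb_le (hs _ _ hw') => k; rewrite nmN.
  have -> : F A w - F A w' = nm_Sum (fun k => hpA c k (fun i => w i - emb A (a' i))
      + - hpA c k (fun i => w' i - emb A (a' i))).
    rewrite (nm_SumD (hs _ _ hw) sb); congr (_ + _).
    rewrite -mulN1r -(nm_SumM _ (hs _ _ hw')); congr nm_Sum.
    by apply/funext => k; rewrite mulN1r.
  apply: nm_Sum_le => N; rewrite -mulrA.
  apply: (@le_trans _ _ (\sum_(k < N) H k * (2 / r * d))).
    apply: ler_sum => k _; apply: hpA_lip => // i.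
    by rewrite opprB addrA subrK.
  by rewrite -mulr_suml ler_wpM2r// mulr_ge0// divr_ge0// ltW.
- move=> A B phi h w hw; case: (h) => ha hm he.
  rewrite /F (contr_add_Sum ha (hs _ _ hw)); congr nm_Sum; apply/funext => k /=.
  rewrite (hpA_mor _ _ _ h); congr hpA; apply/funext => i /=.
  by rewrite contr_addB// he.
Qed.

End AnalyticFan.

(** * Partial derivatives and Taylor bounds of functorially analytic functions *)

Section FanPartial.
Variables (R : realType) (I : finType).
Local Notation RR := (real_ban R).
Implicit Types (f : (I -> R) -> R) (a u v : I -> R).

Definition addi u i (h : R) : I -> R := fun j => u j + (if j == i then h else 0).

Definition line_pt (A : banAlg R) (i : I) (l : R) (w : I -> A) : I -> ls_ban A :=
  fun j => ls_const (w j) + (if j == i then emb (ls_ban A) l * lsX A else 0).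

Lemma line_pt_in_ball (A : banAlg R) i l a r (w : I -> A) : 0 <= l ->
  in_ball a r w -> in_ball a (r + l) (line_pt i l w).
Proof.
move=> l0 hw j; rewrite /line_pt.
set b := (X in _ + X - _).
have -> : ls_const (w j) + b - emb (ls_ban A) (a j) = ls_const (w j - emb A (a j)) + b.
  by rewrite (rmorphB (@ls_const R A)) addrAC.
rewrite (le_trans (nmD _ _))// lerD//; first by rewrite /= ls_nm_const.
rewrite /b; case: ifP => _; last by rewrite nm0.
rewrite (le_trans (nm_embM _ _))// ger0_norm// -[leRHS]mulr1 ler_wpM2l//.
exact: nm_lsX.
Qed.

(** The derivative is read off from the extension over power series: when coordinate [i] is
    displaced by the formal increment [l X], the coefficient of X is [l] times the partial
    derivative. This recipe works over every Banach algebra, so the derivative is again functorially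
    analytic. *)
Lemma fan_partial f a i : fan f a -> exists2 g, fan g a &
  exists r C : R, [/\ 0 < r, 0 <= C & forall u (h : R), (forall j, `|u j - a j| <= r) ->
    `|h| <= r -> `|f (addi u i h) - f u - h * g u| <= C * h ^+ 2].
Proof.
(* Half of the radius is left to the base point, half to the increment [l X]. *)
case=> r [K [F hF]]; have r0 := fe_r hF; set l := r / 2.
have l0 : 0 < l by rewrite /l; lra.
pose G (A : banAlg R) (w : I -> A) : A :=
  emb A l^-1 * (F (ls_ban A) (line_pt i l w) : lser A) 1%N.
have hin (A : banAlg R) (w : I -> A) : in_ball a l w -> in_ball a r (line_pt i l w).
  move=> /(line_pt_in_ball i (ltW l0)); apply: in_ball_le; rewrite /l; lra.
exists (G RR).
  exists l, (l^-1 * K), G; split => //.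
  - by rewrite mulr_ge0 ?invr_ge0 ?(fe_K hF)// ltW.
  - move=> A w w' d hw hw' d0 hd.
    rewrite /G -mulrBr (le_trans (nm_embM _ _))// ger0_norm ?invr_ge0 ?(ltW l0)//.
    rewrite -mulrA ler_wpM2l ?invr_ge0 ?(ltW l0)// -lsB.
    rewrite (le_trans (ls_nm_coef _ 1))//.
    apply: (fe_lip hF (hin _ _ hw) (hin _ _ hw') d0) => j.
    rewrite /line_pt opprD addrACA subrr addr0.
    by rewrite -(rmorphB (@ls_const R A)) /= ls_nm_const.
  (* Applying [phi] coefficientwise is a morphism of series algebras that fixes the increment, so
     naturality of [F] over series gives naturality of the first coefficient. *)
  - move=> A B phi h w hw; case: (h) => ha hm he; rewrite /G hm he; congr (_ * _).
    have -> : F (ls_ban B) (line_pt i l (phi \o w)) =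
       ls_map ha (F (ls_ban A) (line_pt i l w)); last by [].
    rewrite (fe_nat hF (ls_map_mor h ha) (hin _ _ hw)); congr F.
    apply/funext => j /=; apply: lserP => k.
    rewrite /line_pt /= ha.1; congr (_ + _).
      by case: k => [|k]//=; rewrite contr_add0.
    case: ifP => _; last by rewrite !ls0 contr_add0.
    rewrite !ls_constM hm he; congr (_ * _).
    by case: k => [|[|k]] //=; rewrite ?contr_add0// (ban_mor1 h).
have Kr0 : 0 <= `|f a| + K * r.
  by rewrite addr_ge0// mulr_ge0 ?(fe_K hF)// ltW.
exists l, (l^-1 ^+ 2 * (`|f a| + K * r)); split => //.
  by rewrite mulr_ge0// exprn_ge0// invr_ge0 ltW.
move=> u h hu hh.
have hb : in_ball a r (@line_pt RR i l u) by exact: hin.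
set g := F (ls_ban RR) (@line_pt RR i l u).
have hx : `|h / l| <= 1 by rewrite normrM normfV (gtr0_norm l0) ler_pdivrMr// mul1r.
have val x : `|x| <= 1 -> f (addi u i (l * x)) = evr x g.
  move=> x1; rewrite (fe_nat hF (evr_mor RR x1) hb).
  have E : evr x \o @line_pt RR i l u = addi u i (l * x).
    apply/funext => j; case: (evr_mor RR x1) => hA hM hE.
    transitivity (evr x (ls_const (u j : RR)) +
      evr x (if j == i then emb (ls_ban RR) l * lsX RR else 0)); first exact: hA.1.
    rewrite evr_const//; congr (_ + _); case: ifP => _; last exact: contr_add0.
    transitivity (evr x (emb (ls_ban RR) l) * evr x (lsX RR)); first exact: hM.
    by rewrite hE evr_X.
  rewrite E (fe_val hF)// => j.
  have := in_ball_mor (evr_mor RR x1) hb j; rewrite -E; exact.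
have v0 : f u = evr 0 g.
  rewrite -val ?normr0// mulr0; congr f; apply/funext => j.
  by rewrite /addi; case: ifP => _; rewrite addr0.
have -> : addi u i h = addi u i (l * (h / l)) by rewrite mulrCA mulfV ?gt_eqF// mulr1.
set e : R := evr (h / l) (ls_shift (ls_shift g)).
set g0 : R := (g : lser RR) 0%N; set g1 : R := (g : lser RR) 1%N.
have E1 : evr (h / l) g = g0 + h / l * (g1 + h / l * e) :> R.
  by rewrite evr_shift// (evr_shift (ls_shift _)).
have E2 : G RR u = l^-1 * g1 :> R by [].
rewrite val// E1 E2 v0 evr0 -/g0 [X in `|X|](_ : _ = (h / l) ^+ 2 * e); last first.
  by rewrite expr2; ring.
rewrite normrM normrX normrM normfV (gtr0_norm l0) exprMn real_normK ?num_real//.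
rewrite [leRHS](_ : _ = h ^+ 2 * l^-1 ^+ 2 * (`|f a| + K * r)); last by ring.
rewrite ler_wpM2l//; first by rewrite mulr_ge0// sqr_ge0.
rewrite (le_trans ((evr_add RR hx).2 _))// (le_trans (nm_shift _))//.
by rewrite (le_trans (nm_shift _))//; exact: (fan_ext_bound hF hb).
Qed.

Lemma fan_lip f a : fan f a -> exists r K : R, [/\ 0 < r, 0 <= K & forall u v (d : R),
  (forall j, `|u j - a j| <= r) -> (forall j, `|v j - a j| <= r) -> 0 <= d ->
  (forall j, `|v j - u j| <= d) -> `|f v - f u| <= K * d].
Proof.
case=> r [K [F h]]; exists r, K; split; [exact: fe_r h|exact: fe_K h|].
move=> u v d hu hv d0 hd.
rewrite -(fe_val h hu) -(fe_val h hv).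
exact: (@fe_lip _ _ _ _ _ _ _ h RR v u d hv hu d0 hd).
Qed.

Lemma ex_common_radius (P : I -> R -> R -> Prop) :
  (forall i, exists r C : R, [/\ 0 < r, 0 <= C & P i r C]) ->
  (forall i r C r' C', 0 < r' -> r' <= r -> C <= C' -> P i r C -> P i r' C') ->
  exists r C : R, [/\ 0 < r, 0 <= C & forall i, P i r C].
Proof.
move=> h mono.
suff [r [C [r0 C0 hP]]] : exists r C : R, [/\ 0 < r, 0 <= C & forall i, i \in enum I -> P i r C].
  by exists r, C; split => // i; apply: hP; rewrite mem_enum.
elim: (enum I) => [|i s [r [C [r0 C0 hP]]]]; first by exists 1, 0.
have [r1 [C1 [r10 C10 h1]]] := h i.
have m0 : 0 < Num.min r r1 by rewrite lt_min r0 r10.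
exists (Num.min r r1), (C + C1); split => //; first by rewrite addr_ge0.
move=> j; rewrite inE => /orP[/eqP ->|/hP hj].
  by apply: mono h1 => //; rewrite ?ge_min ?lexx ?orbT// lerDr.
by apply: mono hj => //; rewrite ?ge_min ?lexx ?orbT// lerDl.
Qed.

Lemma fan_taylor f a : fan f a -> exists2 g : I -> (I -> R) -> R, (forall i, fan (g i) a) &
  exists r C : R, [/\ 0 < r, 0 <= C & forall u v (d : R),
    (forall j, `|u j - a j| <= r) -> (forall j, `|v j - a j| <= r) -> 0 <= d ->
    (forall j, `|v j - u j| <= d) ->
    `|f v - f u - \sum_i (v i - u i) * g i u| <= C * d ^+ 2].
Proof.
move=> hf.
have /choice[g hg] : forall i, exists g, fan g a /\ (exists r C : R, [/\ 0 < r, 0 <= C & forall u (h : R),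
    (forall j, `|u j - a j| <= r) ->
    `|h| <= r -> `|f (addi u i h) - f u - h * g u| <= C * h ^+ 2]).
  by move=> i; have [g ? ?] := fan_partial i hf; exists g.
exists g => [i|]; first exact: (hg i).1.
have [r1 [C1 [r10 C10 h1]]] : exists r C : R, [/\ 0 < r, 0 <= C & forall i, forall u (h : R),
    (forall j, `|u j - a j| <= r) ->
    `|h| <= r -> `|f (addi u i h) - f u - h * g i u| <= C * h ^+ 2].
  apply: (@ex_common_radius (fun i r C => forall u (h : R),
    (forall j, `|u j - a j| <= r) ->
    `|h| <= r -> `|f (addi u i h) - f u - h * g i u| <= C * h ^+ 2)).
    by move=> i; exact: (hg i).2.
  move=> i r C r' C' r'0 hr hC H u h hu hh.
  rewrite (le_trans (H u h _ _)) ?(le_trans hh)//; last by rewrite ler_wpM2r ?sqr_ge0.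
  by move=> j; rewrite (le_trans (hu j)).
have [r2 [C2 [r20 C20 h2]]] : exists r K : R, [/\ 0 < r, 0 <= K & forall i u v (d : R),
  (forall j, `|u j - a j| <= r) -> (forall j, `|v j - a j| <= r) -> 0 <= d ->
  (forall j, `|v j - u j| <= d) -> `|g i v - g i u| <= K * d].
  apply: (@ex_common_radius (fun i r K => forall u v (d : R),
    (forall j, `|u j - a j| <= r) -> (forall j, `|v j - a j| <= r) -> 0 <= d ->
    (forall j, `|v j - u j| <= d) -> `|g i v - g i u| <= K * d)).
    by move=> i; exact: fan_lip (hg i).1.
  move=> i r C r' C' r'0 hr hC H u v d hu hv d0 hd.
  rewrite (le_trans (H u v d _ _ _ _))//; last by rewrite ler_wpM2r.
    by move=> j; rewrite (le_trans (hu j)).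
  by move=> j; rewrite (le_trans (hv j)).
exists (Num.min (r1 / 2) r2), (#|I|%:R * (C1 + C2)).
split; [by rewrite lt_min r20 andbT; lra|by rewrite mulr_ge0// addr_ge0|].
move=> u v d hu hv d0 hd.
have hu1 j : `|u j - a j| <= r1 / 2 by rewrite (le_trans (hu j))// ge_min lexx.
have hv1 j : `|v j - a j| <= r1 / 2 by rewrite (le_trans (hv j))// ge_min lexx.
have hu2 j : `|u j - a j| <= r2 by rewrite (le_trans (hu j))// ge_min lexx orbT.
have hv2 j : `|v j - a j| <= r2 by rewrite (le_trans (hv j))// ge_min lexx orbT.
have dist j : `|v j - u j| <= r1.
  have -> : v j - u j = (v j - a j) - (u j - a j) by ring.
  rewrite (le_trans (ler_normB _ _))//; have := hu1 j; have := hv1 j; lra.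
(* Coordinates are moved from [u] to [v] one at a time. Each move costs its one-variable Taylor
   error and the change of [g i] between [u] and [us s], both of order [d ^+ 2]. *)
pose us (s : seq I) : I -> R := fun j => if j \in s then v j else u j.
have key (s : seq I) : uniq s ->
  `|f (us s) - f u - \sum_(i <- s) (v i - u i) * g i u| <= (size s)%:R * (C1 + C2) * d ^+ 2.
  elim: s => [|i s IH] /=.
    by rewrite big_nil (_ : us [::] = u)// !subrr normr0 !mul0r.
  case/andP=> is_ /IH{}IH.
  have E : us (i :: s) = addi (us s) i (v i - u i).
    apply/funext => j; rewrite /us /addi inE; case: eqP => [->|_] /=.
      by rewrite (negbTE is_) addrC subrK.
    by rewrite addr0.
  have husr1 j : `|us s j - a j| <= r1.
    by rewrite /us; case: ifP => _; [have := hv1 j|have := hu1 j]; lra.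
  have husr2 j : `|us s j - a j| <= r2 by rewrite /us; case: ifP.
  have := h1 i (us s) (v i - u i) husr1 (dist i); rewrite -E => e1.
  have e2 : `|g i (us s) - g i u| <= C2 * d.
    by apply: h2 => // j; rewrite /us; case: ifP => // _; rewrite subrr normr0.
  rewrite big_cons.
  rewrite [X in `|X|](_ : _ = (f (us (i :: s)) - f (us s) - (v i - u i) * g i (us s)) +
    ((v i - u i) * (g i (us s) - g i u)) +
    (f (us s) - f u - \sum_(i <- s) (v i - u i) * g i u)); last by ring.
  rewrite [leRHS](_ : _ = (C1 * d ^+ 2 + C2 * d ^+ 2) +
    (size s)%:R * (C1 + C2) * d ^+ 2); last by rewrite -natr1; ring.
  rewrite (le_trans (ler_normD _ _))// lerD//.
  rewrite (le_trans (ler_normD _ _))// lerD//.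
    rewrite (le_trans e1)// ler_wpM2l// -real_normK ?num_real//.
    by rewrite lerXn2r ?nnegrE.
  rewrite normrM; apply: (@le_trans _ _ (d * (C2 * d))); first by rewrite ler_pM.
  by rewrite mulrCA -expr2.
have := key (enum I) (enum_uniq _).
rewrite (_ : us (enum I) = v); last by apply/funext => j; rewrite /us mem_enum.
by rewrite big_enum /= -cardE.
Qed.

End FanPartial.

(** * Differential calculus on row vectors *)

Section RowCalculus.
Variable R : realType.

Lemma is_derive_rowP n (c : R -> 'rV[R]_n) (t : R) (d : 'rV[R]_n) :
  is_derive t 1 c d <-> forall i, is_derive t 1 (fun s => c s 0 i) (d 0 i).
Proof.
split=> [[h1 h2] i|h].
  have /derivable_mxP/(_ 0 i) hi := h1.
  by apply: DeriveDef => //; rewrite -h2 derive_mx// mxE.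
have hd : derivable c t 1.
  apply/derivable_mxP => i j; rewrite ord1; exact: (@ex_derive _ _ _ _ _ _ _ (h j)).
apply: DeriveDef => //; rewrite derive_mx//; apply/rowP => i; rewrite mxE.
by rewrite (@derive_val _ _ _ _ _ _ _ (h i)).
Qed.

Lemma mulmxr_continuous n m (J : 'M[R]_(n, m)) : continuous (fun v : 'rV[R]_n => v *m J).
Proof.
apply: (@bounded_linear_continuous _ _ _ (mulmxr J)).
apply/linear_boundedP; near=> r => v.
pose C := \sum_i \sum_j `|J i j|.
have C0 : 0 <= C by apply: sumr_ge0 => i _; apply: sumr_ge0.
have rC : C <= r by near: r; apply: nbhs_pinfty_ge; rewrite num_real.
apply: (@le_trans _ _ (C * `|v|)); last by rewrite ler_wpM2r.
apply/rv_normP => [|j]; first by rewrite mulr_ge0.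
rewrite /= mxE (le_trans (ler_norm_sum _ _ _))// mulr_suml ler_sum// => i _.
rewrite normrM mulrC ler_pM//.
  by rewrite (bigD1 j)//= lerDl sumr_ge0.
by move: i; apply/rv_normP.
Unshelve. all: by end_near. Qed.

Lemma quad_diff (V W : normedModType R) (f : V -> W) (a : V) (L : {linear V -> W})
    (r C : R) : continuous L -> 0 < r ->
  (forall v, `|v - a| <= r -> `|f v - f a - L (v - a)| <= C * `|v - a| ^+ 2) ->
  differentiable f a /\ 'd f a = L :> (V -> W).
Proof.
move=> cL r0 h.
have key : f \o shift a = cst (f a) + L +o_ 0 id.
  apply/eqaddoP => e e0; near=> v.
  have v1 : `|v| <= r by near: v; apply: nbhs0_le.
  have v2 : `|v| <= e / (`|C| + 1).
    by near: v; apply: nbhs0_le; rewrite divr_gt0// ltr_wpDl.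
  have := h (v + a); rewrite addrK => /(_ v1) hv.
  rewrite [X in `|X|](_ : _ = f (v + a) - f a - L v); last first.
    by rewrite !fctE/= opprD addrA.
  rewrite (le_trans hv)// (le_trans (ler_norm _))// normrM normrX normr_id expr2 mulrA.
  rewrite ler_wpM2r//; rewrite ler_pdivlMr in v2; last by rewrite ltr_wpDl.
  have := normr_ge0 C; have := normr_ge0 v; nra.
have dL := diff_unique cL key.
by split=> //; apply/diff_locallyP; rewrite dL.
Unshelve. all: by end_near. Qed.

Lemma lip_continuous (V : normedModType R) (f : V -> R) (a : V) (r C : R) : 0 < r -> 0 <= C ->
  (forall u, `|u - a| <= r -> `|f u - f a| <= C * `|u - a|) -> {for a, continuous f}.
Proof.
move=> r0 C0 h; apply/cvgrPdist_le => e e0; near=> u.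
have hu : `|u - a| <= r by rewrite distrC; near: u; exact: cvgr_dist_le.
have hu' : `|u - a| <= e / (C + 1).
  by rewrite distrC; near: u; apply: cvgr_dist_le => //; rewrite divr_gt0// ltr_wpDl.
rewrite distrC (le_trans (h u hu))//.
rewrite ler_pdivlMr in hu'; last by rewrite ltr_wpDl.
have := normr_ge0 (u - a); nra.
Unshelve. all: by end_near. Qed.

Lemma quad_differentiable n m (f : 'rV[R]_n -> 'rV[R]_m) (a : 'rV[R]_n) (J : 'M[R]_(n, m))
    (r C : R) : 0 < r ->
  (forall v, `|v - a| <= r -> `|f v - f a - (v - a) *m J| <= C * `|v - a| ^+ 2) ->
  differentiable f a /\ 'J f a = J.
Proof.
move=> r0 h.
have [df dJ] := @quad_diff _ _ f a (mulmxr J) r C (@mulmxr_continuous n m J) r0 h.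
split=> //; apply/row_matrixP => i; rewrite !rowE /jacobian mul_rV_lin1.
by rewrite dJ.
Qed.

Lemma is_derive_chain n m (f : 'rV[R]_n -> 'rV[R]_m) (c : R -> 'rV[R]_n) t d :
  differentiable f (c t) -> is_derive t 1 c d -> is_derive t 1 (f \o c) (d *m 'J f (c t)).
Proof.
move=> hf [hc hd].
have hc' : differentiable c t by apply/derivable1_diffP.
have hfc : differentiable (f \o c) t by exact: differentiable_comp.
apply: DeriveDef; first by apply/derivable1_diffP.
have E : 'd c t 1 = d by rewrite -deriveE.
by rewrite deriveE// diff_comp//= E -deriveEjacobian// deriveE.
Qed.

End RowCalculus.

Section FanRow.
Variables (R : realType) (n : nat).
Implicit Types (f g : 'rV[R]_n -> R) (a u v : 'rV[R]_n).

Definition fanv f a := fan (f \o @rv R n) (fun i => a 0 i).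

Lemma rv_ball a u r : 0 <= r -> `|u - a| <= r <-> forall i, `|u 0 i - a 0 i| <= r.
Proof.
by move=> r0; rewrite rv_normP//; split=> h i; have := h i; rewrite !mxE.
Qed.

Lemma fanv_near f g a r : 0 < r -> (forall u, `|u - a| <= r -> f u = g u) ->
  fanv f a -> fanv g a.
Proof.
move=> r0 h; apply: (fan_near r0) => w hw /=; apply: h.
by apply/rv_ball => [|i]; [exact: ltW|rewrite rvE].
Qed.

Lemma fanv_taylor f a : fanv f a -> exists2 g : 'I_n -> 'rV[R]_n -> R,
  (forall i, fanv (g i) a) & exists r C : R, [/\ 0 < r, 0 <= C & forall u v,
    `|u - a| <= r -> `|v - a| <= r ->
    `|f v - f u - \sum_i (v 0 i - u 0 i) * g i u| <= C * `|v - u| ^+ 2].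
Proof.
move=> /fan_taylor[g hg [r [C [r0 C0 h]]]].
exists (fun i u => g i (fun j => u 0 j)).
  move=> i; rewrite /fanv; apply: (fan_near r0 _ (hg i)) => w _ /=; congr (g i _).
  by apply/funext => j; rewrite rvE.
exists r, C; split => // u v hu hv.
have := h (fun j => u 0 j) (fun j => v 0 j) `|v - u|; rewrite /= !rvK; apply => //.
- by apply/rv_ball => //; exact: ltW.
- by apply/rv_ball => //; exact: ltW.
- by apply/rv_ball.
Qed.

Lemma fanv_lip f a : fanv f a -> exists r C : R, [/\ 0 < r, 0 <= C & forall u v,
    `|u - a| <= r -> `|v - a| <= r -> `|f v - f u| <= C * `|v - u|].
Proof.
move=> /fan_lip[r [C [r0 C0 h]]]; exists r, C; split => // u v hu hv.
have := h (fun j => u 0 j) (fun j => v 0 j) `|v - u|; rewrite /= !rvK; apply => //.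
- by apply/rv_ball => //; exact: ltW.
- by apply/rv_ball => //; exact: ltW.
- by apply/rv_ball.
Qed.

Lemma fanv_continuous f a : fanv f a -> {for a, continuous f}.
Proof.
move=> /fanv_lip[r [C [r0 C0 h]]].
apply: (lip_continuous r0 C0) => u hu.
by apply: h; rewrite ?subrr ?normr0// ltW.
Qed.

Lemma fanv_neq0 f a : fanv f a -> f a != 0 ->
  exists2 r : R, 0 < r & forall u, `|u - a| <= r -> f u != 0.
Proof.
move=> /fanv_lip[r [C [r0 C0 h]]] fa.
have fp : 0 < `|f a| by rewrite normr_gt0.
exists (Num.min r (`|f a| / (C + 1) / 2)).
  by rewrite lt_min r0 !divr_gt0// ltr_wpDl.
move=> u; rewrite le_min => /andP[hr hu]; apply/eqP => fu.
have := h a u; rewrite subrr normr0 (ltW r0) hr fu sub0r normrN => /(_ isT isT).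
rewrite -mulrA -invfM ler_pdivlMr in hu; last by rewrite mulr_gt0// ltr_wpDl.
have := normr_ge0 (u - a); nra.
Qed.

(** The quadratic bound of [fanv_taylor] holds at every base point near [a], so its functions [g i]
    agree with the true partial derivatives on a whole ball and pass their analyticity on to
    them. *)
Lemma fanv_partial_taylor f a : fanv f a -> (forall i, fanv (partial i f) a) /\
  exists r C : R, [/\ 0 < r, 0 <= C & forall u v,
    `|u - a| <= r -> `|v - a| <= r ->
    `|f v - f u - \sum_i (v 0 i - u 0 i) * partial i f u| <= C * `|v - u| ^+ 2].
Proof.
move=> /fanv_taylor[g hg [r [C [r0 C0 h]]]].
have E i u : `|u - a| <= r / 2 -> g i u = partial i f u.
  move=> hu.
  have r20 : 0 < r / 2 by rewrite divr_gt0.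
  have hd : is_derive (0 : R) 1 (fun s : R => f (u + s *: delta_mx 0 i)) (g i u).
    apply: (@is_derive_taylor _ _ _ _ C (r / 2)) => // s hs; rewrite add0r scale0r addr0.
    have nd : `|s *: delta_mx 0 i : 'rV[R]_n| <= `|s|.
      apply/rv_normP => // j; rewrite !mxE eqxx /=; case: eqP => _; rewrite ?mulr1 ?mulr0//.
      by rewrite normr0.
    have := h u (u + s *: delta_mx 0 i).
    rewrite (_ : \sum_j _ = s * g i u); last first.
      rewrite (bigD1 i)//= big1 ?addr0 => [|j ji].
        by rewrite !mxE !eqxx/= mulr1 [X in X * _]addrC addKr.
      by rewrite !mxE (negbTE ji) andbF mulr0 addr0 subrr mul0r.
    have dE : u + s *: delta_mx 0 i - u = s *: delta_mx 0 i by rewrite addrC addKr.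
    rewrite dE => hh; rewrite (le_trans (hh _ _))//.
    - by rewrite (le_trans hu)// ler_pdivrMr// ler_peMr ?ler1n// ltW.
    - rewrite addrAC (le_trans (ler_normD _ _))// (splitr r) lerD//.
      by rewrite (le_trans nd)// ltW.
    - by rewrite ler_wpM2l// -[leRHS]real_normK ?num_real// lerXn2r ?nnegrE.
  have := @derive_val _ _ _ _ _ _ _ hd => <-; rewrite /partial /derive.
  set F1 := (F1 in lim (F1 @ _) = _); set F2 := (F2 in _ = lim (F2 @ _)).
  suff -> : F1 = F2 by [].
  apply/funext => s; rewrite /F1 /F2 /=.
  by rewrite scale0r !addr0 [_%:A]mulr1 [s *: _ + u]addrC.
have r20 : 0 < r / 2 by rewrite divr_gt0.
have rr : r / 2 <= r by rewrite ler_pdivrMr// ler_peMr ?ler1n// ltW.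
split=> [i|]; first by apply: (fanv_near r20 (E i) (hg i)).
exists (r / 2), C; split => // u v hu hv.
under eq_bigr do rewrite -E//.
by apply: h; [exact: le_trans hu _|exact: le_trans hv _].
Qed.

Lemma fanv_partial i f a : fanv f a -> fanv (partial i f) a.
Proof. by move=> /fanv_partial_taylor[]. Qed.

Lemma fanv_const (c : R) a : fanv (fun=> c) a.
Proof. exact: fan_const. Qed.

Lemma fanv_add f g a : fanv f a -> fanv g a -> fanv (fun u => f u + g u) a.
Proof. exact: fan_add. Qed.

Lemma fanv_mul f g a : fanv f a -> fanv g a -> fanv (fun u => f u * g u) a.
Proof. exact: fan_mul. Qed.

Lemma fanv_opp f a : fanv f a -> fanv (fun u => - f u) a.
Proof. exact: fan_opp. Qed.

Lemma fanv_sum (T : Type) (s : seq T) (P : pred T) (F : T -> 'rV[R]_n -> R) a :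
  (forall i, P i -> fanv (F i) a) -> fanv (fun u => \sum_(i <- s | P i) F i u) a.
Proof. exact: (@fan_sum _ _ _ _ _ (fun i => F i \o @rv R n)). Qed.

Lemma fanv_prod (T : Type) (s : seq T) (P : pred T) (F : T -> 'rV[R]_n -> R) a :
  (forall i, P i -> fanv (F i) a) -> fanv (fun u => \prod_(i <- s | P i) F i u) a.
Proof. exact: (@fan_prod _ _ _ _ _ (fun i => F i \o @rv R n)). Qed.

Lemma fanv_inv f a : fanv f a -> f a != 0 -> fanv (fun u => (f u)^-1) a.
Proof. by move=> hf fa; apply: (fan_inv hf); rewrite /= rvK. Qed.

Lemma fanv_det k (G : 'rV[R]_n -> 'M[R]_k) a : (forall i j, fanv (fun u => G u i j) a) ->
  fanv (fun u => \det (G u)) a.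
Proof.
move=> h; apply: fanv_sum => s _; apply: fanv_mul; first exact: fanv_const.
by apply: fanv_prod => i _; exact: h.
Qed.

(** Cramer's rule. Since [invmx] follows it only on invertible matrices, the formula is used on a
    ball where the determinant does not vanish. *)
Lemma fanv_invmx k (G : 'rV[R]_n -> 'M[R]_k) a : (forall i j, fanv (fun u => G u i j) a) ->
  G a \in unitmx -> forall i j, fanv (fun u => invmx (G u) i j) a.
Proof.
move=> h; rewrite unitmxE unitfE => d0 i j.
have hd := fanv_det h.
have [r r0 hr] := fanv_neq0 hd d0.
apply: (@fanv_near (fun u => (\det (G u))^-1 * \adj (G u) i j) _ _ r) => //.
  by move=> u /hr u0; rewrite /invmx unitmxE unitfE u0 [RHS]mxE.
apply: fanv_mul; first exact: fanv_inv.
apply: (@fanv_near (fun u => (-1) ^+ (j + i) * \det (row' j (col' i (G u)))) _ _ 1) => //.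
  by move=> u _; rewrite mxE.
apply: fanv_mul; first exact: fanv_const.
apply: fanv_det => p q; apply: (fanv_near ltr01 _ (h (lift j p) (lift i q))) => u _.
by rewrite !mxE.
Qed.

End FanRow.

Lemma fanv_jacobian (R : realType) n m (T : 'rV[R]_n -> 'rV[R]_m) (a : 'rV[R]_n) :
  (forall k, fanv (fun u => T u 0 k) a) ->
  differentiable T a /\ 'J T a = \matrix_(i, k) partial i (fun u => T u 0 k) a.
Proof.
move=> h.
(* The Taylor bound is specialised to base point [a]; the chain of equalities in the term below only
   proves [|a - a| <= r]. *)
have [r [C [r0 C0 hC]]] := @ex_common_radius R 'I_m
  (fun k r C => forall v, `|v - a| <= r -> `|T v 0 k - T a 0 k -
    \sum_i (v 0 i - a 0 i) * partial i (fun u => T u 0 k) a| <= C * `|v - a| ^+ 2)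
  (fun k => let: conj _ (ex_intro r (ex_intro C (And3 r0 C0 h))) := fanv_partial_taylor (h k) in
    ex_intro _ r (ex_intro _ C (And3 r0 C0 (fun v hv => h a v (etrans (congr1 (<=%O^~ r) (etrans (congr1 Num.norm (subrr a)) (normr0 _))) (ltW r0)) hv))))
  (fun k r C r' C' r'0 hr hC H v hv => le_trans (H v (le_trans hv hr)) (ler_wpM2r (sqr_ge0 _) hC)).
apply: (quad_differentiable r0 (C := C)) => v hv.
apply/rv_normP => [|k]; first by rewrite mulr_ge0// exprn_ge0.
have := hC k v hv; rewrite !mxE; congr (`|_ - _| <= _).
by apply: eq_bigr => i _; rewrite !mxE.
Qed.

Lemma is_derive_fanv (R : realType) n (f : 'rV[R]_n -> R) (c : R -> 'rV[R]_n) t d :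
  fanv f (c t) -> is_derive t 1 c d ->
  is_derive t 1 (f \o c) (\sum_i d 0 i * partial i f (c t)).
Proof.
move=> hf hc; pose T u : 'rV[R]_1 := const_mx (f u).
have E : (fun u => T u 0 0) = f by apply/funext => u; rewrite mxE.
have [k|dT jT] := @fanv_jacobian R n 1 T (c t); first by rewrite ord1 E.
have /is_derive_rowP/(_ 0) := is_derive_chain dT hc.
rewrite jT mxE (_ : (fun s => (T \o c) s 0 0) = f \o c); last first.
  by apply/funext => s; rewrite /= mxE.
by under eq_bigr do rewrite mxE E.
Qed.

(** * Analytic flows *)

Section Flow.
Variables (R : realType) (I : finType).
Local Notation RR := (real_ban R).

Lemma fan_ext_family (G : I -> (I -> R) -> R) (a : I -> R) : (forall i, fan (G i) a) ->
  exists (r K : R) (F : I -> forall A : banAlg R, (I -> A) -> A),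
    [/\ 0 < r, 0 <= K & forall i, fan_ext (G i) a r K (F i)].
Proof.
move=> h.
have [r [K [r0 K0 hr]]] := @ex_common_radius R I
  (fun i r K => exists F : forall A : banAlg R, (I -> A) -> A, fan_ext (G i) a r K F)
  (fun i => let: ex_intro r (ex_intro K (ex_intro F hF)) := h i in
     ex_intro _ r (ex_intro _ K (And3 (fe_r hF) (fe_K hF) (ex_intro _ F hF))))
  (fun i r C r' C' r'0 hr hC H => let: ex_intro F hF := H in
     ex_intro _ F (fan_ext_le r'0 hr hC hF)).
by have /choice[F hF] := hr; exists r, K, F.
Qed.

Section Contraction.
Variables (B : banAlg R) (X : set (I -> B)) (T : (I -> B) -> I -> B) (u0 : I -> B) (D : R).
Hypotheses (X0 : X u0) (TX : forall u, X u -> X (T u)).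
Hypothesis T0 : forall i, nm (T u0 i - u0 i) <= D.
Hypothesis Tlip : forall u v d, X u -> X v -> 0 <= d ->
  (forall i, nm (u i - v i) <= d) -> forall i, nm (T u i - T v i) <= 2^-1 * d.
Hypothesis Xclosed : forall u, (forall e, 0 < e -> exists2 v, X v &
  forall i, nm (u i - v i) <= e) -> X u.

(** Completeness is available in the form of summable series, so the fixed point is [u0] plus the
    telescoping series of the increments of the iteration, whose norms are at most [D / 2^k]. *)
Lemma contraction_fixpoint : exists2 u, X u & T u = u.
Proof.
pose it k := iter k T u0.
have itX k : X (it k) by elim: k => [|k] //=; exact: TX.
pose e k i := it k.+1 i - it k i.
(* An empty [I] is set apart: only an actual coordinate forces [0 <= D]. *)
have [[i0 _]|I0] := pselect (exists i : I, True); last first.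
  by exists u0 => //; apply/funext => i; case: I0; exists i.
have D0 : 0 <= D by exact: le_trans (nm_ge0 _) (T0 i0).
have he k i : nm (e k i) <= D * 2^-1 ^+ k.
  elim: k i => [|k IH] i; first by rewrite expr0 mulr1; exact: T0.
  rewrite exprS mulrCA.
  by apply: (Tlip (itX k.+1) (itX k) _ IH); rewrite mulr_ge0// exprn_ge0.
have hs i : @sumb R B (e^~ i) (2 * D).
  have : forall n, \sum_(k < n) nm (e k i) <= 2 * D - 2 * D * 2^-1 ^+ n.
    elim=> [|n IH]; first by rewrite big_ord0 expr0; lra.
    rewrite big_ord_recr/= exprS; move: (he n i) IH; lra.
  move=> h n; rewrite (le_trans (h n))//.
  by rewrite gerBl mulr_ge0 ?exprn_ge0// mulr_ge0.
pose u i := u0 i + nm_Sum (e^~ i).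
have tel n i : \sum_(k < n) e k i = it n i - u0 i.
  elim: n => [|n IH]; first by rewrite big_ord0 subrr.
  by rewrite big_ord_recr/= IH /e addrC addrA subrK.
have close d : 0 < d -> exists N, forall n i, (N <= n)%N -> nm (u i - it n i) <= d.
  move=> d0; have /choice[N hN] : forall i, exists N, forall n, (N <= n)%N ->
     nm (nm_Sum (e^~ i) - \sum_(k < n) e k i) <= d by move=> i; exact: sumb_tail (hs i) d0.
  exists (\max_i N i)%N => n i hn.
  have -> : u i - it n i = nm_Sum (e^~ i) - \sum_(k < n) e k i.
    by rewrite tel /u opprB addrA [_ + nm_Sum _]addrC.
  by apply: hN; rewrite (leq_trans _ hn)//; exact: leq_bigmax.
have Xu : X u.
  apply: Xclosed => d d0; have [N hN] := close d d0.
  by exists (it N) => // i; exact: hN.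
exists u => //; apply/funext => i; apply/eqP; rewrite -subr_eq0; apply/eqP.
apply: nm_small_eq0 => d d0.
have d20 : 0 < d / 2 by lra.
have [N hN] := close _ d20.
have -> : T u i - u i = (T u i - it N.+1 i) - (u i - it N.+1 i) by ring.
rewrite (le_trans (nmB _ _))//.
have h1 : nm (T u i - it N.+1 i) <= 2^-1 * (d / 2).
  by apply: (Tlip Xu (itX N)) => // [|j]; [exact: ltW|exact: hN].
have h2 := hN N.+1 i (leqnSn _).
lra.
Qed.

End Contraction.

(* [u] solves du/ds = tau G(u) with initial value [w], where [v] stands for G(u);
   [psi] ranges over all evaluations. *)
Lemma analytic_flow (G : I -> (I -> R) -> R) (a : I -> R) (r0 : R) :
  0 < r0 -> (forall i, fan (G i) a) -> exists d tau : R, [/\ 0 < d, 0 < tau &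
    forall (A : banAlg R) (w : I -> A), in_ball a d w ->
    exists u v : I -> ls_ban A,
      [/\ (forall i, u i = ls_const (w i) + emb (ls_ban A) tau * ls_int (v i)),
          in_ball a r0 u
        & forall psi : ls_ban A -> RR, ban_mor psi ->
            forall i, psi (v i) = G i (fun j => psi (u j))]].
Proof.
move=> r00 /fan_ext_family[r1 [K [F [r10 K0 hF1]]]].
set r := Num.min r0 r1; have rp : 0 < r by rewrite lt_min r00 r10.
have rr0 : r <= r0 by rewrite ge_min lexx.
have rr1 : r <= r1 by rewrite ge_min lexx orbT.
have hF i := fan_ext_le rp rr1 (lexx K) (hF1 i).
(* [M] dominates both the values of every [F i] on the ball and the constant [K]. The bound
   [tau * M <= r / 2] makes the Picard map preserve the ball, and [tau * K <= 1/2] makes it a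
   contraction; integration itself is already norm-decreasing. *)
set M := \sum_i `|G i a| + K * r + K.
have M0 : 0 <= M by rewrite !addr_ge0 ?sumr_ge0 ?mulr_ge0// ltW.
have KM : K <= M by rewrite /M lerDr addr_ge0 ?sumr_ge0 ?mulr_ge0// ltW.
set tau := Num.min (r / 2) 2^-1 / (M + 1).
have m0 : 0 < Num.min (r / 2) 2^-1 by rewrite lt_min divr_gt0//= invr_gt0 ltr0n.
have M1 : 0 < M + 1 by rewrite ltr_wpDl.
have t0 : 0 < tau by rewrite divr_gt0.
have tM : tau * M <= Num.min (r / 2) 2^-1.
  rewrite /tau mulrAC ler_pdivrMr// ler_wpM2l// ?(ltW m0)//; lra.
have tM1 : tau * M <= r / 2 by rewrite (le_trans tM)// ge_min lexx.
have tK : tau * K <= 2^-1.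
  apply: (@le_trans _ _ (tau * M)); first by rewrite ler_wpM2l// ltW.
  by rewrite (le_trans tM)// ge_min lexx orbT.
exists (r / 2), tau; split => //; first by rewrite divr_gt0.
move=> A w hw; pose B := ls_ban A.
pose T (u : I -> B) (i : I) : B := ls_const (w i) + emb B tau * ls_int (F i B u).
have c0 i : nm ((ls_const (w i) : B) - emb B (a i)) <= r / 2.
  by rewrite -(rmorphB (@ls_const R A)) /= ls_nm_const; exact: hw.
have bF u i : in_ball a r u -> nm (emb B tau * ls_int (F i B u)) <= r / 2.
  move=> hu; rewrite (le_trans (nm_embM _ _))// (gtr0_norm t0) (le_trans _ tM1)//.
  rewrite ler_wpM2l ?(ltW t0)// (le_trans ((ls_int_add A).2 _))//.
  rewrite (le_trans (fan_ext_bound (hF i) hu))// /M -addrA lerD//.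
    by rewrite (bigD1 i)//= lerDl sumr_ge0.
  by rewrite lerDl.
have [| | |u v d hu hv d0 hd i|u hu|u hu Tu] :=
    @contraction_fixpoint B (in_ball a r) T (fun i => ls_const (w i)) (r / 2).
- by move=> i; rewrite (le_trans (c0 i))// ler_pdivrMr// ler_peMr ?ler1n// ltW.
- move=> u hu i; rewrite /T addrAC (le_trans (nmD _ _))// (splitr r) lerD//.
  exact: bF.
- move=> i; rewrite /T addrC addKr; apply: bF => j.
  by rewrite (le_trans (c0 j))// ler_pdivrMr// ler_peMr ?ler1n// ltW.
- rewrite /T opprD addrACA subrr add0r -mulrBr (le_trans (nm_embM _ _))//.
  rewrite (gtr0_norm t0) -(contr_addB (ls_int_add A)).
  apply: (@le_trans _ _ (tau * (K * d))); last by rewrite mulrA ler_wpM2r.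
  rewrite ler_wpM2l ?(ltW t0)// (le_trans ((ls_int_add A).2 _))//.
  exact: (fe_lip (hF i) hu hv d0 hd).
- move=> i; apply/ler_addgt0Pr => e e0; have [v hv hd] := hu _ e0.
  have -> : u i - emb B (a i) = (v i - emb B (a i)) + (u i - v i) by ring.
  by rewrite (le_trans (nmD _ _))// lerD// hv.
exists u, (fun i => F i B u); split.
- by move=> i; rewrite -{1}Tu.
- exact: in_ball_le hu.
- move=> psi hpsi i; rewrite (fe_nat (hF i) hpsi hu) (fe_val (hF i))//.
  exact: (in_ball_mor hpsi hu).
Qed.

End Flow.

(** * Continuation, mean value bounds and ODE uniqueness on the line *)

Section RealHelpers.
Variable R : realType.

(** Continuation by connectedness. It serves to follow a geodesic inside a chart, to carry analytic
    dependence through time, and to spread a hit time over all parameters. *)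
Lemma interval_clopen (E : set R) (P : R -> Prop) (s0 : R) : is_interval E -> E s0 -> P s0 ->
  (forall s, E s -> P s -> exists2 e : R, 0 < e & forall s1, E s1 -> `|s1 - s| < e -> P s1) ->
  (forall s, E s -> (forall e, 0 < e -> exists s1, [/\ E s1, `|s1 - s| < e & P s1]) -> P s) ->
  forall s, E s -> P s.
Proof.
move=> /connected_intervalP cE Es0 Ps0 hopen hclosed.
suff : E `&` P = E by move=> EP s; rewrite -EP => -[].
apply: cE; first by exists s0.
- exists [set t | exists s e, [/\ 0 < e, `|t - s| < e &
     forall s1, E s1 -> `|s1 - s| < e -> P s1]].
    rewrite openE => t [s [e [e0 te he]]]; near=> t'; exists s, e; split => //.
    have -> : t' - s = (t' - t) + (t - s) by rewrite addrA subrK.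
    rewrite (le_lt_trans (ler_normD _ _))// -ltrBrDr distrC.
    by near: t'; apply: cvgr_dist_lt => //; rewrite subr_gt0.
  apply/seteqP; split => t /=.
    move=> [Et Pt]; split => //; have [e e0 he] := hopen t Et Pt.
    by exists t, e; split => //; rewrite subrr normr0.
  by move=> [Et [s [e [e0 te he]]]]; split => //; exact: he.
- exists (~` [set t | exists s e, [/\ 0 < e, `|t - s| < e &
     forall s1, E s1 -> `|s1 - s| < e -> ~ P s1]]).
    apply: open_closedC.
    rewrite openE => t [s [e [e0 te he]]]; near=> t'; exists s, e; split => //.
    have -> : t' - s = (t' - t) + (t - s) by rewrite addrA subrK.
    rewrite (le_lt_trans (ler_normD _ _))// -ltrBrDr distrC.
    by near: t'; apply: cvgr_dist_lt => //; rewrite subr_gt0.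
  apply/seteqP; split => t /=.
    by move=> [Et Pt]; split => // -[s [e [e0 te he]]]; exact: (he t).
  move=> [Et ht]; split => //; apply: (hclosed t Et) => e e0.
  apply: contrapT => hn; apply: ht; exists t, e; split => //; first by rewrite subrr normr0.
  by move=> s1 Es1 hs1 Ps1; apply: hn; exists s1.
Unshelve. all: by end_near. Qed.

Lemma ball_interval (s0 e : R) : is_interval [set s | `|s - s0| < e].
Proof.
move=> x y /= hx hy z /andP[xz zy]; move: hx hy; rewrite !ltr_norml => /andP[a1 a2] /andP[b1 b2].
by apply/andP; split; lra.
Qed.

Lemma is_derive_continuous (V : normedModType R) (f : R -> V) (x : R) d :
  is_derive x 1 f d -> {for x, continuous f}.
Proof.
by move=> [hf _]; apply: differentiable_continuous; apply/derivable1_diffP.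
Qed.

Lemma mvt_bound (f : R -> R) (df : R -> R) (s0 e C : R) :
  (forall s, `|s - s0| < e -> is_derive s 1 f (df s)) ->
  (forall s, `|s - s0| < e -> `|df s| <= C) ->
  forall s, `|s - s0| < e -> `|f s - f s0| <= C * `|s - s0|.
Proof.
move=> hd hC s hs.
have btw a b x : `|a - s0| < e -> `|b - s0| < e -> a <= x <= b -> `|x - s0| < e.
  by move=> ha hb; exact: (ball_interval ha hb).
have main a b : a <= b -> `|a - s0| < e -> `|b - s0| < e -> `|f b - f a| <= C * `|b - a|.
  move=> ab ha hb.
  have [||c /andP[c1 c2] ->] := @MVT_segment R f df a b ab.
  - move=> x; rewrite in_itv/= => /andP[x1 x2]; apply: hd; apply: (btw _ _ _ ha hb).
    by rewrite (ltW x1) (ltW x2).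
  - apply: continuous_in_subspaceT => x; rewrite inE/= in_itv/= => xab.
    exact: is_derive_continuous (hd _ (btw _ _ _ ha hb xab)).
  rewrite normrM ler_wpM2r//; apply: hC; apply: (btw _ _ _ ha hb).
  by rewrite bnd_simp in c1; rewrite bnd_simp in c2; rewrite c1 c2.
have h0 : `|s0 - s0| < e by rewrite subrr normr0 (le_lt_trans _ hs).
have [ss0|s0s] := leP s s0; last by apply: main => //; exact: ltW.
by rewrite distrC [`|s - s0|]distrC; exact: main.
Qed.

Lemma is_derive0_const (f : R -> R) (s0 e : R) :
  (forall s, `|s - s0| < e -> is_derive s 1 f 0) ->
  forall s, `|s - s0| < e -> f s = f s0.
Proof.
move=> h s hs; apply/eqP; rewrite -subr_eq0 -normr_le0 -(mul0r `|s - s0|).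
by apply: (mvt_bound (df := fun=> 0) h _ hs) => s' _; rewrite normr0.
Qed.

Lemma is_derive_affine (V : normedModType R) (f : R -> V) (t tau s : R) d :
  is_derive (t + tau * s) 1 f d -> is_derive s 1 (fun s => f (t + tau * s)) (tau *: d).
Proof.
move=> [hf hd].
have ha : is_derive s 1 (fun s : R => t + tau * s) tau.
  apply: (@is_derive_taylor R _ s tau 0 1) => // h _.
  by rewrite [X in `|X|](_ : _ = 0) ?normr0 ?mul0r//; ring.
have da : differentiable (fun s : R => t + tau * s) s by apply/derivable1_diffP; case: ha.
have df : differentiable f (t + tau * s) by apply/derivable1_diffP.
have dfa : differentiable (f \o (fun s : R => t + tau * s)) s by exact: differentiable_comp.
apply: DeriveDef; first by apply/derivable1_diffP.
rewrite deriveE// diff_comp//=.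
have -> : 'd (fun s : R => t + tau * s) s 1 = tau by rewrite -deriveE// derive_val.
by rewrite -[X in 'd f _ X]mulr1 [X in 'd f _ X](_ : _ = tau *: 1)// linearZ -deriveE// hd.
Qed.

(** Both solutions stay within [r] of the initial value near [s0], so they differ by at most
    [2 * r]. On an interval where Lipschitz constant times length is at most 1/2, the mean value
    bound halves any such estimate; iteration drives it to 0. *)
Lemma ode_unique (I : finType) (G : I -> (I -> R) -> R) (tau s0 : R) (y z : R -> I -> R) :
  (forall i, fan (G i) (y s0)) -> y s0 = z s0 -> (exists2 e : R, 0 < e & forall s, `|s - s0| < e ->
    forall i, is_derive s 1 (fun s => y s i) (tau * G i (y s)) /\
              is_derive s 1 (fun s => z s i) (tau * G i (z s))) ->
  exists2 e : R, 0 < e & forall s, `|s - s0| < e -> y s = z s.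
Proof.
move=> hG yz [e e0 hd].
have [r [K [r0 K0 hl]]] := @ex_common_radius R I _ (fun i => fan_lip (hG i))
  (fun i r C r' C' r'0 hr hC H u v d hu hv d0 hd => le_trans
    (H u v d (fun j => le_trans (hu j) hr) (fun j => le_trans (hv j) hr) d0 hd)
    (ler_wpM2r d0 hC)).
have near_r (w : R -> I -> R) : w s0 = y s0 ->
   (forall i, {for s0, continuous (fun s => w s i)}) ->
   exists2 e' : R, 0 < e' & forall s, `|s - s0| < e' -> forall i, `|w s i - y s0 i| <= r.
  move=> ws hc.
  have [|i r' C r1 C1 r10 hr _ H s hs|e' [C' [e'0 _ H]]] := @ex_common_radius R I
    (fun i r' (C : R) => forall s, `|s - s0| < r' -> `|w s i - y s0 i| <= r).
  - move=> i; have /cvgrPdist_le/(_ r r0)[e' /= e'0 he'] := hc i.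
    exists e', 0; split => // s hs; rewrite distrC -ws.
    by apply: he'; rewrite /= distrC.
  - by apply: H; exact: lt_le_trans hs hr.
  by exists e' => // s hs i; exact: H.
have s00 : `|s0 - s0| < e by rewrite subrr normr0.
have [e1 e10 h1] : exists2 e' : R, 0 < e' & forall s, `|s - s0| < e' -> forall i, `|y s i - y s0 i| <= r.
  by apply: near_r => // i; exact: is_derive_continuous (hd _ s00 i).1.
have [e2 e20 h2] : exists2 e' : R, 0 < e' & forall s, `|s - s0| < e' -> forall i, `|z s i - y s0 i| <= r.
  by apply: near_r => // i; exact: is_derive_continuous (hd _ s00 i).2.
pose b := 2^-1 / (`|tau| * K + 1).
have b0 : 0 < b by rewrite divr_gt0// ltr_wpDl// mulr_ge0.
pose e' := Num.min (Num.min e e1) (Num.min e2 b).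
have e'0 : 0 < e' by rewrite !lt_min e0 e10 e20 b0.
have key k : forall s, `|s - s0| < e' -> forall i, `|z s i - y s i| <= 2 * r * 2^-1 ^+ k.
  elim: k => [|k IH] s hs i.
    rewrite expr0 mulr1.
    have -> : z s i - y s i = (z s i - y s0 i) - (y s i - y s0 i) by ring.
    move: (hs); rewrite !lt_min => /andP[/andP[_ he1] /andP[he2 _]].
    rewrite (le_trans (ler_normB _ _))// mulr2n mulrDl mul1r lerD//; [exact: h2|exact: h1].
  pose dd := 2 * r * 2^-1 ^+ k.
  have dd0 : 0 <= dd by rewrite /dd !mulr_ge0 ?exprn_ge0// ltW.
  have H1 t : `|t - s0| < e' -> is_derive t 1 (fun s => z s i - y s i)
      (tau * G i (z t) - tau * G i (y t)).
    rewrite !lt_min => /andP[/andP[he _] _]; have [h3 h4] := hd t he i.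
    exact: is_deriveB.
  have H2 t : `|t - s0| < e' -> `|tau * G i (z t) - tau * G i (y t)| <= `|tau| * (K * dd).
    move=> ht; rewrite -mulrBr normrM ler_wpM2l//; apply: hl => //.
    + by move: ht; rewrite !lt_min => /andP[/andP[_ he1] _]; exact: h1.
    + by move: ht; rewrite !lt_min => /andP[_ /andP[he2 _]]; exact: h2.
    + exact: IH.
  have := mvt_bound H1 H2 hs; rewrite yz subrr subr0 => H; apply: (le_trans H).
  move: hs; rewrite !lt_min => /andP[_ /andP[_ hb]].
  have -> : 2 * r * 2^-1 ^+ k.+1 = dd * 2^-1 by rewrite exprS /dd; ring.
  apply: (@le_trans _ _ (`|tau| * (K * dd) * b)).
    by rewrite ler_wpM2l ?(ltW hb)// mulr_ge0// mulr_ge0.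
  rewrite [X in X <= _](_ : _ = dd * ((`|tau| * K) * b)); last by ring.
  rewrite ler_wpM2l// /b mulrCA ler_piMr//.
  have tk0 : 0 <= `|tau| * K by rewrite mulr_ge0.
  by rewrite ler_pdivrMr; lra.
exists e' => // s hs; apply/funext => i; apply/eqP; rewrite eq_sym -subr_eq0 -normr_le0.
have cv : (fun k => 2 * r * 2^-1 ^+ k) @ \oo --> 2 * r * 0.
  apply: cvgM; first exact: cvg_cst.
  by apply: cvg_expr; rewrite ger0_norm//; lra.
rewrite -(mulr0 (2 * r)) -(cvg_lim (@Rhausdorff R) cv).
by apply: limr_ge; [exact: cvgP cv|apply: nearW => k; exact: key].
Qed.

End RealHelpers.

(** * Geodesics in a chart *)

Lemma agree_limit (R : realType) (T : topologicalType) (f g : R -> T) (s : R) :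
  hausdorff_space T -> {for s, continuous f} -> {for s, continuous g} ->
  (forall e : R, 0 < e -> exists2 s1, `|s1 - s| < e & f s1 = g s1) -> f s = g s.
Proof.
move=> hT cf cg h; apply: hT => A B fA gB.
have /nbhs_ballP[e e0 he] : nbhs s (f @^-1` A `&` g @^-1` B).
  by apply: filterI; [exact: cf|exact: cg].
have [s1 hs1 fg] := h e e0; exists (f s1).
have [] := he s1; first by rewrite /ball/= distrC.
by rewrite /= => ? ?; split => //; rewrite fg.
Qed.

Section ChartLevel.
Variables (R : realType) (n : nat) (M : analyticManifold R n) (h : analyticMetric M).
Implicit Types (phi psi : chart R n M) (u v w q : 'rV[R]_n) (alpha : R -> M).

Definition chart_im phi : set 'rV[R]_n := chart_map phi @` chart_dom phi.

Lemma chart_inj phi p p' : chart_dom phi p -> chart_dom phi p' ->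
  chart_map phi p = chart_map phi p' -> p = p'.
Proof. by move=> hp hp' E; rewrite -(chart_mapK hp) -(chart_mapK hp') E. Qed.

Lemma chart_im_inv phi u : chart_im phi u ->
  chart_dom phi (chart_inv phi u) /\ chart_map phi (chart_inv phi u) = u.
Proof. by move=> [p hp <-]; rewrite chart_mapK. Qed.

Lemma open_closed_ball (A : set 'rV[R]_n) u : open A -> A u ->
  exists2 r : R, 0 < r & forall v, `|v - u| <= r -> A v.
Proof.
move=> oA Au; have /nbhs_ballP[e /= e0 he] : nbhs u A by apply: open_nbhs_nbhs.
exists (e / 2); first by rewrite divr_gt0.
move=> v hv; apply: he; rewrite -ball_normE /= distrC.
by rewrite (le_lt_trans hv)// ltr_pdivrMr// ltr_pMr// ltr1n.
Qed.

Lemma chart_im_ball phi u : chart_im phi u ->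
  exists2 r : R, 0 < r & forall v, `|v - u| <= r -> chart_im phi v.
Proof. by apply: open_closed_ball; exact: chart_image_open. Qed.

Lemma chart_inv_cont phi u : chart_im phi u -> {for u, continuous (chart_inv phi)}.
Proof.
move=> hu; have := @chart_inv_continuous _ _ _ phi.
rewrite continuous_open_subspace; last exact: chart_image_open.
by apply; rewrite inE.
Qed.

Lemma curve_dom_near phi alpha t : continuous alpha -> chart_dom phi (alpha t) ->
  exists2 e : R, 0 < e & forall s, `|s - t| < e -> chart_dom phi (alpha s).
Proof.
move=> ca hd.
have /nbhs_ballP[e /= e0 he] : nbhs t (alpha @^-1` chart_dom phi).
  by apply: ca; apply: open_nbhs_nbhs; split => //; exact: chart_dom_open.
by exists e => // s hs; apply: he; rewrite /ball/= distrC.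
Qed.

Lemma analytic_on_fanv (U : set 'rV[R]_n) f u : analytic_on U f -> U u -> fanv f u.
Proof. by move=> hf hu; apply: analytic_fan; exact: hf. Qed.

Lemma gram_fanv phi u i j : atlas phi -> chart_im phi u ->
  fanv (fun w => gram h phi w i j) u.
Proof.
move=> hphi; apply: analytic_on_fanv; exact: gram_analytic.
Qed.

Lemma gram_symE phi u i j : atlas phi -> chart_im phi u ->
  gram h phi u i j = gram h phi u j i.
Proof.
by move=> hphi [p hp <-]; rewrite -[in LHS](gram_sym h hphi hp) mxE.
Qed.

Lemma gram_unit phi u : atlas phi -> chart_im phi u -> gram h phi u \in unitmx.
Proof.
move=> hphi [p hp <-]; rewrite -row_free_unit; apply/row_freeP.
have hk : kermx (gram h phi (chart_map phi p)) = 0.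
  apply/row_matrixP => i; rewrite row0; apply/eqP/negPn/negP => v0.
  have := gram_posdef h hphi hp v0.
  by rewrite -row_mul mulmx_ker row0 mul0mx mxE ltxx.
by apply/row_freeP; rewrite -kermx_eq0 hk.
Qed.

Lemma christoffel_fanv phi u k i j : atlas phi -> chart_im phi u ->
  fanv (christoffel h phi k i j) u.
Proof.
move=> hphi hu.
have hg a b : fanv (fun w => gram h phi w a b) u by exact: gram_fanv.
apply: fanv_mul; first exact: fanv_const.
apply: fanv_sum => l _ /=; apply: fanv_mul.
  by apply: fanv_invmx => //; exact: gram_unit.
by apply: fanv_add; [apply: fanv_add|apply: fanv_opp]; exact: fanv_partial.
Qed.

Definition geo_acc phi q v : 'rV[R]_n :=
  \row_k - \sum_i \sum_j christoffel h phi k i j q * v 0 i * v 0 j.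

(** Positions ([inl]) and velocities ([inr]) share one finite index type, so that the geodesic
    equation is a first-order system to which [analytic_flow] applies. *)
Definition geo_field phi (c : 'I_n + 'I_n) (z : 'I_n + 'I_n -> R) : R :=
  match c with
  | inl i => z (inr i)
  | inr k => geo_acc phi (rv (z \o inl)) (rv (z \o inr)) 0 k
  end.

Definition phase q v (c : 'I_n + 'I_n) : R :=
  match c with inl i => q 0 i | inr i => v 0 i end.

Lemma phase_inl q v : rv (phase q v \o inl) = q.
Proof. by apply/rowP => i; rewrite mxE. Qed.
Lemma phase_inr q v : rv (phase q v \o inr) = v.
Proof. by apply/rowP => i; rewrite mxE. Qed.

Lemma geo_field_fan phi q v c : atlas phi -> chart_im phi q ->
  fan (geo_field phi c) (phase q v).
Proof.
move=> hphi hq; case: c => [i|k]; first exact: fan_proj.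
apply: (@fan_near _ _ (fun z => - \sum_i \sum_j christoffel h phi k i j (rv (z \o inl)) *
  z (inr i) * z (inr j)) _ _ 1) => // [w _|].
  rewrite /geo_field /geo_acc mxE; congr (- _); apply: eq_bigr => i _; apply: eq_bigr => j _.
  by rewrite !mxE.
apply: fan_opp; apply: fan_sum => i _; apply: fan_sum => j _.
apply: fan_mul; last exact: fan_proj.
apply: fan_mul; last exact: fan_proj.
apply: (@fan_reindex _ _ _ inl (christoffel h phi k i j \o @rv R n)).
have -> : phase q v \o inl = (fun i => q 0 i) by [].
exact: christoffel_fanv.
Qed.

Lemma geodesic_derive phi alpha t : geodesic h alpha -> atlas phi ->
  chart_dom phi (alpha t) ->
  is_derive t 1 (local_curve phi alpha) (velocity phi alpha t) /\
  is_derive t 1 (velocity phi alpha) (geo_acc phi (local_curve phi alpha t) (velocity phi alpha t)).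
Proof.
move=> [_ hg] hphi hd; have [h1 h2 h3] := hg _ _ hphi hd; split.
  by apply: DeriveDef; [exact: h1|rewrite -derive1E].
apply: DeriveDef; [exact: h2|rewrite -derive1E]; apply/rowP => k; rewrite /geo_acc mxE.
by apply/eqP; rewrite -addr_eq0; apply/eqP; exact: h3.
Qed.

Lemma phase_is_derive (q v : R -> 'rV[R]_n) (tau s : R) phi :
  is_derive s 1 q (tau *: v s) -> is_derive s 1 v (tau *: geo_acc phi (q s) (v s)) ->
  forall c, is_derive s 1 (fun s => phase (q s) (v s) c)
                          (tau * geo_field phi c (phase (q s) (v s))).
Proof.
move=> /is_derive_rowP hq /is_derive_rowP hv [i|k] /=.
  by have := hq i; rewrite mxE.
by have := hv k; rewrite mxE phase_inl phase_inr.
Qed.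

(** Agreement is open by ODE uniqueness. For closedness the geodesic must not leave the chart in the
    limit: as the manifold is Hausdorff, the limit point is [chart_inv phi (q s)], which still lies
    in the domain. *)
Lemma geo_follow phi alpha (t1 tau : R) (q v : R -> 'rV[R]_n) : geodesic h alpha -> atlas phi ->
  (forall s, `|s| < 1 -> [/\ chart_im phi (q s), is_derive s 1 q (tau *: v s) &
     is_derive s 1 v (tau *: geo_acc phi (q s) (v s))]) ->
  chart_dom phi (alpha t1) -> local_curve phi alpha t1 = q 0 ->
  velocity phi alpha t1 = v 0 ->
  forall s, `|s| < 1 -> [/\ chart_dom phi (alpha (t1 + tau * s)),
    local_curve phi alpha (t1 + tau * s) = q s & velocity phi alpha (t1 + tau * s) = v s].
Proof.
move=> hal hphi hqv hd0 hq0 hv0.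
have calpha : continuous alpha by case: hal.
pose P s := [/\ chart_dom phi (alpha (t1 + tau * s)),
    local_curve phi alpha (t1 + tau * s) = q s & velocity phi alpha (t1 + tau * s) = v s].
have caff s : {for s, continuous (fun s : R => t1 + tau * s)}.
  exact: is_derive_continuous (@is_derive_affine R R idfun t1 tau s 1 (is_derive_id _ _)).
have calpha' s : {for s, continuous (fun s => alpha (t1 + tau * s))}.
  apply: (@continuous_comp _ _ _ (fun s : R => t1 + tau * s) alpha); first exact: caff.
  exact: calpha.
have hE : is_interval [set s : R | `|s| < 1].
  have := @ball_interval R 0 1; rewrite (_ : [set s | `|s - 0| < 1] = [set s | `|s| < 1])//.
  by apply/seteqP; split => s /=; rewrite subr0.
apply: (@interval_clopen R [set s : R | `|s| < 1] P 0) => //=.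
- by rewrite normr0.
- by rewrite /P mulr0 addr0.
- move=> s hs [hd hq hv]; have [iq dq dv] := hqv s hs.
  have [e1 e10 he1] := curve_dom_near calpha hd.
  have := caff s; move=> /cvgrPdist_lt/(_ e1 e10)[e2 /= e20 he2].
  have hf c : fan (geo_field phi c) (phase (q s) (v s)) by exact: geo_field_fan.
  have m0 : 0 < Num.min (1 - `|s|) e2 by rewrite lt_min e20 subr_gt0 hs.
  have hder s1 : `|s1 - s| < Num.min (1 - `|s|) e2 -> `|s1| < 1 /\
      chart_dom phi (alpha (t1 + tau * s1)).
    rewrite lt_min => /andP[a1 a2]; split.
      rewrite -(subrK s s1) (le_lt_trans (ler_normD _ _))//; lra.
    by apply: he1; rewrite distrC; apply: he2; rewrite /= distrC.
  have [||e3 e30 he3] := @ode_unique R _ (geo_field phi) tau s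
     (fun s => phase (q s) (v s))
     (fun s => phase (local_curve phi alpha (t1 + tau * s)) (velocity phi alpha (t1 + tau * s))) hf.
  + by rewrite hq hv.
  + exists (Num.min (1 - `|s|) e2) => // s1 /hder[s11 hd1] c.
    have [_ dq1 dv1] := hqv s1 s11; split; first exact: phase_is_derive.
    have [dl da] := geodesic_derive hal hphi hd1.
    by apply: (phase_is_derive (q := fun s => local_curve phi alpha (t1 + tau * s))
      (v := fun s => velocity phi alpha (t1 + tau * s))); exact: is_derive_affine.
  exists (Num.min e3 (Num.min (1 - `|s|) e2)); first by rewrite lt_min e30.
  move=> s1 _; rewrite lt_min => /andP[b1 /hder[_ b2]]; split => //.
    by rewrite -[LHS](phase_inl _ (velocity phi alpha (t1 + tau * s1))) -he3// phase_inl.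
  by rewrite -[LHS](phase_inr (local_curve phi alpha (t1 + tau * s1))) -he3// phase_inr.
- move=> s hs hlim; have [iq dq dv] := hqv s hs.
  have E : alpha (t1 + tau * s) = chart_inv phi (q s).
    apply: (@agree_limit R M (fun s => alpha (t1 + tau * s)) (chart_inv phi \o q) s).
    + exact: space_hausdorff.
    + exact: calpha'.
    + apply: continuous_comp; first exact: is_derive_continuous dq.
      exact: chart_inv_cont.
    + move=> e e0; have [s1 [_ hs1 [d1 l1 _]]] := hlim e e0; exists s1 => //=.
      by rewrite -l1 /local_curve chart_mapK.
  have [d2 m2] := chart_im_inv iq.
  have hd : chart_dom phi (alpha (t1 + tau * s)) by rewrite E.
  split => //; first by rewrite /local_curve E.
  have [_ da] := geodesic_derive hal hphi hd.
  apply: (@agree_limit R _ (fun s => velocity phi alpha (t1 + tau * s)) v s).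
  + exact: norm_hausdorff.
  + exact: is_derive_continuous (is_derive_affine da).
  + exact: is_derive_continuous dv.
  + by move=> e e0; have [s1 [_ hs1 [_ _ v1]]] := hlim e e0; exists s1.
Qed.

End ChartLevel.

(** * Analytic families of geodesics and the Gauss lemma *)

HB.lock Definition evrow (R : realType) (n : nat) (x : R)
  (a : 'I_n -> ls_ban (real_ban R)) : 'rV[R]_n := \row_i evR x (a i).
HB.lock Definition devrow (R : realType) (n : nat) (x : R)
  (a : 'I_n -> ls_ban (real_ban R)) : 'rV[R]_n := \row_i devR x (a i).
(** The substitution of [l * x] for [x], obtained as the Taylor expansion at 0 with scale [l]; it
    shrinks the range of parameters. *)
HB.lock Definition sc (R : realType) (n : nat) (l : R)
  (a : 'I_n -> ls_ban (real_ban R)) : 'I_n -> ls_ban (real_ban R) :=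
  fun i => tay 0 l (a i).
Arguments evrow {R n} x a.
Arguments devrow {R n} x a.
Arguments sc {R n} l a.

Section Families.
Variables (R : realType) (n : nat).
Local Notation RR := (real_ban R).
Local Notation A1 := (ls_ban RR).
Implicit Types (a b : 'I_n -> A1) (x l : R).

Lemma evrowE x a i : evrow x a 0 i = evR x (a i).
Proof. by rewrite evrow.unlock mxE. Qed.
Lemma devrowE x a i : devrow x a 0 i = devR x (a i).
Proof. by rewrite devrow.unlock mxE. Qed.

Lemma is_derive_unique (V : normedModType R) (f : R -> V) (t : R) d d' :
  is_derive t 1 f d -> is_derive t 1 f d' -> d = d'.
Proof. by move=> h h'; rewrite -(@derive_val _ _ _ _ _ _ _ h) (@derive_val _ _ _ _ _ _ _ h'). Qed.

Lemma near_ball (P : R -> Prop) (x e : R) : 0 < e -> (forall y, `|y - x| < e -> P y) ->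
  \forall y \near x, P y.
Proof.
by move=> e0 h; apply/nbhs_ballP; exists e => // y; rewrite /ball/= distrC; exact: h.
Qed.

Lemma is_derive_near (V : normedModType R) (f g : R -> V) (x e : R) d : 0 < e ->
  (forall y, `|y - x| < e -> f y = g y) -> is_derive x 1 f d -> is_derive x 1 g d.
Proof. by move=> e0 h; apply: near_eq_is_derive; exact: near_ball e0 h. Qed.

Lemma unit_ball_near x y : `|x| < 1 -> `|y - x| < 1 - `|x| -> `|y| < 1.
Proof. by move=> hx hy; rewrite -(subrK x y) (le_lt_trans (ler_normD _ _))//; lra. Qed.

Lemma is_derive_evrow x a : `|x| < 1 -> is_derive x 1 (evrow^~ a) (devrow x a).
Proof.
move=> hx; apply/is_derive_rowP => i; rewrite devrowE.
rewrite (_ : (fun s => evrow s a 0 i) = (fun s => evR s (a i))); first exact: is_derive_evR.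
by apply/funext => s; rewrite evrowE.
Qed.

Lemma scE l a i : sc l a i = tay 0 l (a i).
Proof. by rewrite sc.unlock. Qed.

Lemma sc_le l : 0 < l -> l <= 1 -> `|0 : R| + `|l| <= 1.
Proof. by move=> l0 l1; rewrite normr0 add0r ger0_norm// ltW. Qed.

Lemma evR_sc x l (u : A1) : 0 < l -> l <= 1 -> `|x| <= 1 -> evR x (tay 0 l u) = evR (l * x) u.
Proof. by move=> l0 l1 hx; rewrite /evR evr_tay ?add0r// sc_le. Qed.

Lemma evrow_sc x l a : 0 < l -> l <= 1 -> `|x| <= 1 -> evrow x (sc l a) = evrow (l * x) a.
Proof. by move=> l0 l1 hx; apply/rowP => i; rewrite !evrowE scE evR_sc. Qed.

Lemma scale_unit x l : 0 < l -> l <= 1 -> `|x| < 1 -> `|l * x| < 1.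
Proof.
move=> l0 l1 hx; rewrite normrM (gtr0_norm l0) (le_lt_trans _ hx)//.
by rewrite ler_piMl.
Qed.

Lemma devrow_sc x l a : 0 < l -> l <= 1 -> `|x| < 1 ->
  devrow x (sc l a) = l *: devrow (l * x) a.
Proof.
move=> l0 l1 hx; apply: (is_derive_unique (is_derive_evrow (sc l a) hx)).
have e0 : 0 < 1 - `|x| by rewrite subr_gt0.
apply: (is_derive_near (f := fun y => evrow (0 + l * y) a) e0) => [y hy|].
  by rewrite add0r evrow_sc// ltW// (unit_ball_near hx).
apply: (@is_derive_affine R _ (fun y => evrow y a) 0 l x); rewrite add0r.
by apply: is_derive_evrow; exact: scale_unit.
Qed.

Lemma nm_sc l (u : A1) : 0 < l -> l <= 1 ->
  nm (tay 0 l u - emb A1 (evR 0 u)) <= l * nm u.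
Proof.
move=> l0 l1; have hl := sc_le l0 l1; have [hA hM hE] := tay_mor RR hl.
rewrite /evR evr0 {1}[u]shift_decomp.
have -> : tay 0 l (ls_const ((u : lser RR) 0%N) + lsX RR * ls_shift u) =
   ls_const ((u : lser RR) 0%N) + tay 0 l (lsX RR) * tay 0 l (ls_shift u).
  rewrite -hM; transitivity (tay 0 l (ls_const ((u : lser RR) 0%N)) + tay 0 l (lsX RR * ls_shift u)).
    exact: hA.1.
  by congr (_ + _); exact: (evg_const (tay_pt RR 0 l) (@ls_const_mor _ RR)).
have -> : tay 0 l (lsX RR) = emb A1 l * lsX RR.
  rewrite /tay (evg_X (@ls_const_mor _ RR) (nm_tay_pt RR hl)).
  by rewrite /tay_pt rmorph0 add0r.
have -> : (ls_const ((u : lser RR) 0%N) : A1) = emb A1 ((u : lser RR) 0%N) by [].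
rewrite addrC addKr -mulrA (le_trans (nm_embM _ _))// (gtr0_norm l0) ler_wpM2l ?(ltW l0)//.
rewrite (le_trans (nmM _ _))// -[leRHS]mul1r ler_pM ?nm_ge0//; first exact: nm_lsX.
by rewrite (le_trans (hA.2 _))// nm_shift.
Qed.

(** Substituting [l * x] for [x] multiplies the bound on the nonconstant part by [l]. This brings
    series into the small balls around scalars on which functorial extensions are defined. *)
Lemma ex_scale (J : finType) (w : J -> A1) (e : R) : 0 < e ->
  exists2 l : R, 0 < l & l <= 1 /\
    forall i, nm (tay 0 l (w i) - emb A1 (evR 0 (w i))) <= e.
Proof.
move=> e0; pose C := \sum_i nm (w i).
have C0 : 0 <= C by apply: sumr_ge0 => i _; exact: nm_ge0.
have m0 : 0 < Num.min 1 (e / (C + 1)) by rewrite lt_min ltr01 divr_gt0// ltr_wpDl.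
have m1 : Num.min 1 (e / (C + 1)) <= 1 by rewrite ge_min lexx.
exists (Num.min 1 (e / (C + 1))) => //; split => // i.
rewrite (le_trans (nm_sc _ m0 m1))//.
have wC : nm (w i) <= C by rewrite /C (bigD1 i)// lerDl sumr_ge0// => j _; exact: nm_ge0.
apply: (@le_trans _ _ (e / (C + 1) * C)).
  by rewrite ler_pM ?nm_ge0 ?(ltW m0)// ge_min lexx orbT.
by rewrite mulrAC ler_pdivrMr ?ltr_wpDl// ler_wpM2l ?(ltW e0)// lerDl.
Qed.

Lemma evR_mor x : `|x| <= 1 -> @ban_mor R A1 RR (evR x).
Proof. exact: evr_mor. Qed.

(** Composition of [f] with series: by naturality, [F A w] takes under every real evaluation the
    value of [f] at the evaluated arguments. *)
Lemma fan_apply (I : finType) (f : (I -> R) -> R) (c : I -> R) : fan f c ->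
  exists r C : R, [/\ 0 < r, 0 <= C & forall (A : banAlg R) (w : I -> A), in_ball c r w ->
    exists b : A, forall psi : A -> RR, ban_mor psi -> psi b = f (fun i => psi (w i))].
Proof.
case=> r [K [F hF]]; exists r, K; split; [exact: fe_r hF|exact: fe_K hF|].
move=> A w hw; exists (F A w) => psi hpsi; rewrite (fe_nat hF hpsi hw) (fe_val hF)//.
exact: (in_ball_mor hpsi hw).
Qed.

Lemma fan_apply_common (I J : finType) (f : J -> (I -> R) -> R) (c : I -> R) :
  (forall j, fan (f j) c) ->
  exists r C : R, [/\ 0 < r, 0 <= C & forall (A : banAlg R) (w : I -> A), in_ball c r w ->
    exists b : J -> A, forall psi : A -> RR, ban_mor psi ->
      forall j, psi (b j) = f j (fun i => psi (w i))].
Proof.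
move=> hf.
have [r [C [r0 C0 h]]] := @ex_common_radius R J
  (fun j r (C : R) => forall (A : banAlg R) (w : I -> A), in_ball c r w ->
    exists b : A, forall psi : A -> RR, ban_mor psi -> psi b = f j (fun i => psi (w i)))
  (fun j => fan_apply (hf j))
  (fun j r C r' C' _ hr _ H A w hw => H A w (in_ball_le hr hw)).
exists r, C; split => // A w hw.
have /choice[b hb] : forall j, exists b : A, forall psi : A -> RR, ban_mor psi ->
   psi b = f j (fun i => psi (w i)) by move=> j; exact: h.
by exists b => psi hpsi j; exact: hb.
Qed.

Lemma evrow_in_ball x a (c : 'I_n -> R) r : `|x| <= 1 -> in_ball c r a ->
  forall i, `|evrow x a 0 i - c i| <= r.
Proof.
move=> hx ha i; rewrite evrowE; have := in_ball_mor (evR_mor hx) ha i; exact.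
Qed.

End Families.

Section Good.
Variables (R : realType) (n : nat) (M : analyticManifold R n) (h : analyticMetric M).
Local Notation RR := (real_ban R).
Local Notation A1 := (ls_ban RR).
Implicit Types (phi psi : chart R n M) (alpha : R -> R -> M) (aq ap bq bp : 'I_n -> A1).

Definition mform phi (u v w : 'rV[R]_n) : R := (v *m gram h phi u *m w^T) 0 0.

Lemma mformE phi u v w : mform phi u v w = \sum_i \sum_j v 0 i * gram h phi u i j * w 0 j.
Proof.
rewrite /mform mxE exchange_big/=; apply: eq_bigr => j _.
by rewrite !mxE mulr_suml.
Qed.

Lemma mformZl phi u c v w : mform phi u (c *: v) w = c * mform phi u v w.
Proof. by rewrite /mform -scalemxAl -scalemxAl mxE. Qed.

(* Near the parameter [th0], at time [T], position and velocity of the family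
   depend analytically on the parameter; the last two clauses are unit speed and
   the Gauss lemma. *)
Definition good_data alpha th0 T phi rho aq ap := [/\ atlas phi, 0 < rho &
  forall x : R, `|x| < 1 -> let q := evrow x aq in let p := evrow x ap in
    [/\ chart_dom phi (alpha (th0 + rho * x) T),
        local_curve phi (alpha (th0 + rho * x)) T = q,
        velocity phi (alpha (th0 + rho * x)) T = p,
        mform phi q p p = 1 & mform phi q (devrow x aq) p = 0]].

Lemma good_scale alpha th0 T phi rho aq ap l : 0 < l -> l <= 1 ->
  good_data alpha th0 T phi rho aq ap ->
  good_data alpha th0 T phi (rho * l) (sc l aq) (sc l ap).
Proof.
move=> l0 l1 [hphi rho0 hg]; split => //; first by rewrite mulr_gt0.
move=> x hx /=; have hx' := ltW hx.
rewrite -mulrA; have [d1 d2 d3 d4 d5] := hg _ (scale_unit l0 l1 hx).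
rewrite (evrow_sc aq l0 l1 hx').
rewrite (evrow_sc ap l0 l1 hx').
rewrite (devrow_sc aq l0 l1 hx).
split; [exact: d1|exact: d2|exact: d3|exact: d4|by rewrite mformZl d5 mulr0].
Qed.

Lemma overlap_ball phi psi u : (chart_map phi @` (chart_dom phi `&` chart_dom psi)) u ->
  exists2 r : R, 0 < r &
    forall v, `|v - u| <= r -> (chart_map phi @` (chart_dom phi `&` chart_dom psi)) v.
Proof.
move=> [p [hp hp'] <-].
have hu : chart_im phi (chart_map phi p) by exists p.
have [r1 r10 h1] := chart_im_ball hu.
have /nbhs_ballP[r2 /= r20 h2] : nbhs (chart_map phi p) (chart_inv phi @^-1` chart_dom psi).
  apply: (chart_inv_cont hu); rewrite chart_mapK//.
  by apply: open_nbhs_nbhs; split => //; exact: chart_dom_open.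
exists (Num.min r1 (r2 / 2)); first by rewrite lt_min r10 divr_gt0.
move=> v; rewrite le_min => /andP[v1 v2].
have [d1 d2] := chart_im_inv (h1 v v1).
exists (chart_inv phi v) => //; split => //; apply: h2.
rewrite -ball_normE /= distrC (le_lt_trans v2)//.
by rewrite ltr_pdivrMr// ltr_pMr// ltr1n.
Qed.

(** The transition map and its partial derivatives are composed with the series, after shrinking the
    parameter range. Unit speed and orthogonality survive because position derivatives and
    velocities both transform by the Jacobian, and the metric by its tensor law. *)
Lemma good_change alpha th0 T phi rho aq ap psi :
  (forall th, geodesic h (alpha th)) -> atlas psi -> chart_dom psi (alpha th0 T) ->
  good_data alpha th0 T phi rho aq ap ->
  exists rho' bq bp, good_data alpha th0 T psi rho' bq bp.
Proof.
move=> hgeo hpsi hdpsi hg0; have [hphi rho0 hg] := hg0.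
pose TT := transition phi psi.
pose q0 := evrow 0 aq.
have z1 : `|0 : R| < 1 by rewrite normr0.
have [d0 q00 _ _ _] := hg 0 z1; rewrite mulr0 addr0 in d0 q00.
pose U := chart_map phi @` (chart_dom phi `&` chart_dom psi).
have Uq0 : U q0 by exists (alpha th0 T).
have [r1 r10 hU] := overlap_ball Uq0.
have TTan u k : U u -> fanv (fun u => TT u 0 k) u.
  by apply: analytic_on_fanv; exact: atlas_analytic.
pose q0' (i : 'I_n) := q0 0 i.
have [r2 [C2 [r20 _ h2]]] := @fan_apply_common R 'I_n 'I_n
  (fun k => (fun u => TT u 0 k) \o @rv R n) q0' (fun k => TTan q0 k Uq0).
have [r3 [C3 [r30 _ h3]]] := @fan_apply_common R 'I_n ('I_n * 'I_n)%type
  (fun kl => partial kl.2 (fun u => TT u 0 kl.1) \o @rv R n) q0'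
  (fun kl => fanv_partial kl.2 (TTan q0 kl.1 Uq0)).
pose r := Num.min r1 (Num.min r2 r3).
have r0 : 0 < r by rewrite !lt_min r10 r20.
have rr1 : r <= r1 by rewrite ge_min lexx.
have rr2 : r <= r2 by rewrite !ge_min lexx orbT.
have rr3 : r <= r3 by rewrite !ge_min lexx !orbT.
have [l l0 [l1 hl]] := ex_scale aq r0.
have [_ rhol hg'] := good_scale l0 l1 hg0.
set aq' := sc l aq in hg'; set ap' := sc l ap in hg'.
have hb : in_ball q0' r aq' by move=> i; rewrite /q0' /q0 evrowE /aq' scE; exact: hl.
have [bq hbq] := h2 A1 aq' (in_ball_le rr2 hb).
have [bd hbd] := h3 A1 aq' (in_ball_le rr3 hb).
pose bp k := \sum_l bd (k, l) * ap' l.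
have Ux x : `|x| <= 1 -> U (evrow x aq').
  move=> hx; apply: hU; rewrite (le_trans _ rr1)//; apply/rv_ball; first exact: ltW.
  exact: evrow_in_ball hx hb.
have Ebq x : `|x| <= 1 -> evrow x bq = TT (evrow x aq').
  move=> hx; apply/rowP => k; rewrite evrowE (hbq _ (evR_mor hx)) /=; congr (TT _ 0 k).
  by apply/rowP => j; rewrite rvE evrowE.
have Ebp x : `|x| <= 1 -> evrow x bp = evrow x ap' *m 'J TT (evrow x aq').
  move=> hx; have [_ ->] := @fanv_jacobian R n n TT (evrow x aq') (fun k => TTan _ k (Ux x hx)).
  apply/rowP => k; rewrite evrowE [RHS]mxE /bp.
  have [hA hM _] := evR_mor hx; rewrite (contr_add_sum _ _ _ hA); apply: eq_bigr => j _.
  rewrite hM (hbd _ (evR_mor hx) (k, j)) mxE evrowE mulrC; congr (_ * _).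
  congr (partial j _ _); by apply/rowP => i; rewrite rvE evrowE.
have dTT x : `|x| <= 1 -> differentiable TT (evrow x aq').
  by move=> hx; have [] := @fanv_jacobian R n n TT (evrow x aq') (fun k => TTan _ k (Ux x hx)).
exists (rho * l), bq, bp; split => // x hx /=.
have hx' := ltW hx.
have [e1 e2 e3 e4 e5] := hg' x hx.
set be := alpha (th0 + rho * l * x) in e1 e2 e3 *.
have [p [hp1 hp2] hp3] := Ux x hx'.
have Ep : p = be T by apply: (chart_inj hp1 e1); rewrite hp3 -e2.
have hd : chart_dom psi (be T) by rewrite -Ep.
have El : local_curve psi be T = evrow x bq.
  by rewrite Ebq// -e2 /TT /transition /local_curve chart_mapK.
have Ev : velocity psi be T = evrow x bp.
  rewrite Ebp//; have [dl _] := geodesic_derive (hgeo _) hphi e1.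
  have dT : differentiable TT (local_curve phi be T) by rewrite e2; exact: dTT.
  have := is_derive_chain dT dl; rewrite e3 e2 => dc.
  have cbe : continuous be by case: (hgeo (th0 + rho * l * x)).
  have [e e0 he] := curve_dom_near cbe e1.
  have : is_derive T 1 (local_curve psi be) (evrow x ap' *m 'J TT (evrow x aq')).
    apply: is_derive_near e0 _ dc => s hs.
    by rewrite /TT /= /transition /local_curve chart_mapK//; exact: he.
  by move=> dd; rewrite /velocity derive1E (@derive_val _ _ _ _ _ _ _ dd).
have Ed : devrow x bq = devrow x aq' *m 'J TT (evrow x aq').
  apply: (is_derive_unique (is_derive_evrow bq hx)).
  have hc := is_derive_chain (dTT x hx') (is_derive_evrow aq' hx).
  have e0 : 0 < 1 - `|x| by rewrite subr_gt0.
  apply: is_derive_near e0 _ hc => y hy; rewrite /= Ebq//.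
  by rewrite ltW// (unit_ball_near hx).
have Eg v w : mform phi (evrow x aq') v w =
    mform psi (evrow x bq) (v *m 'J TT (evrow x aq')) (w *m 'J TT (evrow x aq')).
  have := gram_transition h hphi hpsi e1 hd => /=.
  rewrite -[chart_map phi (be T)]/(local_curve phi be T) e2.
  rewrite -[chart_map psi (be T)]/(local_curve psi be T) El => Eg.
  by rewrite /mform Eg trmx_mul !mulmxA.
split => //.
- by rewrite Ebp// -Eg e4.
- by rewrite Ed Ebp// -Eg e5.
Qed.

End Good.

(** * Differentiation of series of series in time and in the parameter *)

Section SeriesODE.
Variable R : realType.
Local Notation RR := (real_ban R).

(** More general than a morphism, in order to include differentiation in the parameter, which is
    linear and contracting up to scale but not multiplicative. *)
Definition lin_contr (A : banAlg R) (phi : A -> RR) :=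
  contr_add phi /\ forall c a, phi (emb A c * a) = c * phi a.

Lemma ban_mor_lin (A : banAlg R) (phi : A -> RR) : ban_mor phi -> lin_contr phi.
Proof. by case=> h1 h2 h3; split => // c a; rewrite h2 h3. Qed.

Lemma evr_lin (A : banAlg R) (phi : A -> RR) (h : lin_contr phi) (s : R) (u : ls_ban A) :
  `|s| <= 1 -> phi (evr s u) = evR s (ls_map h.1 u).
Proof.
move=> hs; rewrite /evR !evrE /evg.
rewrite (contr_add_Sum h.1 (evg_sumb (ban_mor_id A) (nm_emb_le1 _ hs) u)).
congr nm_Sum; apply/funext => k /=.
by rewrite -rmorphXn mulrC h.2 mulrC.
Qed.

Lemma is_derive_series (A : banAlg R) (phi : A -> RR) (u v : ls_ban A) (w : A) (tau s : R) :
  lin_contr phi -> u = ls_const w + emb (ls_ban A) tau * ls_int v -> `|s| < 1 ->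
  is_derive s 1 (fun s => phi (evr s u) : R) (tau * phi (evr s v)).
Proof.
move=> h hu hs.
have E : ls_map h.1 u = ls_const (phi w) + ls_const (tau : RR) * ls_int (ls_map h.1 v).
  apply: lserP => -[|k].
    rewrite hu lsD ls_constM /= mulr0 !addr0 [cmul _ _ _](_ : _ = 0) ?addr0//.
    by rewrite /cmul big_ord1 /= mulr0.
  rewrite lsD ls_constM /= hu lsD ls_constM /= !add0r h.2; congr (_ * _).
  by rewrite mulrC h.2 mulrC.
have e0 : 0 < 1 - `|s| by rewrite subr_gt0.
apply: (is_derive_near (f := fun s => evR s (ls_map h.1 u)) e0) => [y hy|].
  by rewrite evr_lin// ltW// (unit_ball_near hs).
rewrite evr_lin ?(ltW hs)//.
have := is_derive_evR (ls_map h.1 u) hs.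
suff -> : devR s (ls_map h.1 u) = tau * evR s (ls_map h.1 v) by [].
rewrite /devR E dser_add// dser_const add0r dser_constM// dser_int//.
Qed.

Lemma devR_lin (x : R) : `|x| < 1 ->
  lin_contr (fun u : ls_ban RR => (1 - `|x|) * devR x u : RR).
Proof.
move=> hx; have l0 : 0 < 1 - `|x| by rewrite subr_gt0.
split; first split.
- by move=> u v; rewrite /devR (dser_add u v hx) mulrDr.
- move=> u; rewrite /= normrM (gtr0_norm l0).
  rewrite mulrC -ler_pdivlMr//; exact: (nm_dser u hx).
- move=> c u; rewrite /devR (dser_constM _ _ hx) mulrCA//.
Qed.

(** Interchange of the two derivatives. The parameter derivative at [x], scaled by [1 - |x|], is a
    contraction, so it may be applied to each coefficient of the series in [s] before
    differentiating in [s]. *)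
Lemma is_derive_series_dev (u v : ls_ban (ls_ban RR)) (w : ls_ban RR) (tau s x : R) :
  u = ls_const w + emb (ls_ban (ls_ban RR)) tau * ls_int v -> `|s| < 1 -> `|x| < 1 ->
  is_derive s 1 (fun s => devR x (evr s u)) (tau * devR x (evr s v)).
Proof.
move=> hu hs hx; have l0 : 0 < 1 - `|x| by rewrite subr_gt0.
have := is_derive_series (devR_lin hx) hu hs.
set f := (fun _ => _); set d := (_ * _) => hd.
have -> : (fun s => devR x (evr s u)) = (1 - `|x|)^-1 \*: f.
  by apply/funext => y; rewrite /f /= /GRing.scale/= mulKf// gt_eqF.
have -> : tau * devR x (evr s v) = (1 - `|x|)^-1 *: d.
  by rewrite /d /GRing.scale/= mulrCA mulKf// gt_eqF.
exact: is_deriveZ.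
Qed.

Lemma is_derive_bigsum n (F : 'I_n -> R -> R) (d : 'I_n -> R) (t : R) :
  (forall i, is_derive t 1 (F i) (d i)) ->
  is_derive t 1 (fun t => \sum_i F i t) (\sum_i d i).
Proof.
move=> hd; rewrite (_ : (fun t => _) = \sum_i F i); first exact: is_derive_sum.
by apply/funext => s; rewrite fct_sumE.
Qed.

End SeriesODE.

(** * The first variation formula in a chart *)

Section FirstVariation.
Variables (R : realType) (n : nat) (M : analyticManifold R n) (h : analyticMetric M).
Variable phi : chart R n M.
Hypothesis hphi : atlas phi.
Implicit Types (u v w q p d : 'rV[R]_n).
Local Notation mform := (mform h phi).

Definition dgram u (l i j : 'I_n) : R := partial l (fun w => gram h phi w i j) u.

Lemma dgram_sym u l i j : chart_im phi u -> dgram u l i j = dgram u l j i.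
Proof.
move=> hu; have [r r0 hr] := chart_im_ball hu.
rewrite /dgram /partial; apply: near_eq_derive; apply/nbhs_ballP; exists r => // v.
rewrite -ball_normE /= distrC => hv; apply: gram_symE => //.
by apply: hr; exact: ltW.
Qed.

Lemma mform_sym u v w : chart_im phi u -> mform u v w = mform u w v.
Proof.
move=> hu; rewrite !mformE exchange_big/=; apply: eq_bigr => i _; apply: eq_bigr => j _.
by rewrite (gram_symE h i j hphi hu) mulrC mulrA mulrAC.
Qed.

Lemma is_derive_mform (c V W : R -> 'rV[R]_n) (t : R) c' V' W' : chart_im phi (c t) ->
  is_derive t 1 c c' -> is_derive t 1 V V' -> is_derive t 1 W W' ->
  is_derive t 1 (fun t => mform (c t) (V t) (W t))
    (\sum_i \sum_j V t 0 i * (\sum_l c' 0 l * dgram (c t) l i j) * W t 0 j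
     + mform (c t) V' (W t) + mform (c t) (V t) W').
Proof.
move=> hu hc /is_derive_rowP hV /is_derive_rowP hW.
have hg i j := @is_derive_fanv R n _ c t c' (gram_fanv h i j hphi hu) hc.
rewrite (_ : (fun t => mform (c t) (V t) (W t)) =
  (fun t => \sum_i \sum_j V t 0 i * gram h phi (c t) i j * W t 0 j)); last first.
  by apply/funext => s; rewrite mformE.
rewrite !mformE -!big_split/=; apply: is_derive_bigsum => i.
rewrite -!big_split/=; apply: is_derive_bigsum => j.
have := @is_deriveM R R^o _ _ t 1 _ _ (@is_deriveM R R^o _ _ t 1 _ _ (hV i) (hg i j)) (hW j).
rewrite /GRing.scale/= => H; apply: (is_derive_eq H).
by rewrite !fctE /dgram /=; ring.
Qed.

(* The geodesic equation with its index lowered. *)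
Lemma mform_acc q p w : chart_im phi q -> mform q w (geo_acc h phi q p) =
  - (\sum_l \sum_a \sum_b w 0 l * p 0 a * p 0 b * dgram q a l b)
  + 2^-1 * (\sum_l \sum_a \sum_b w 0 l * p 0 a * p 0 b * dgram q l a b).
Proof.
move=> hq; have gu := gram_unit h hphi hq.
pose K : 'cV[R]_n := \col_l \sum_a \sum_b
  (dgram q a b l + dgram q b a l - dgram q l a b) * p 0 a * p 0 b.
have accE : (geo_acc h phi q p)^T = - (2^-1 *: (invmx (gram h phi q) *m K)).
  apply/colP => k; rewrite /geo_acc !mxE; congr (- _).
  rewrite mulr_sumr.
  transitivity (\sum_a \sum_b \sum_l 2^-1 * (invmx (gram h phi q) k l *
    ((dgram q a b l + dgram q b a l - dgram q l a b) * p 0 a * p 0 b))).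
    apply: eq_bigr => a _; apply: eq_bigr => b _.
    rewrite /christoffel mulr_sumr !mulr_suml; apply: eq_bigr => l _.
    by rewrite /dgram; ring.
  transitivity (\sum_a \sum_l \sum_b 2^-1 * (invmx (gram h phi q) k l *
    ((dgram q a b l + dgram q b a l - dgram q l a b) * p 0 a * p 0 b))).
    by apply: eq_bigr => a _; rewrite exchange_big.
  rewrite exchange_big/=; apply: eq_bigr => l _.
  rewrite mxE !mulr_sumr; apply: eq_bigr => a _.
  by rewrite !mulr_sumr.
have -> : mform q w (geo_acc h phi q p) = - (2^-1 * (w *m K) 0 0).
  by rewrite /mform accE mulmxN -scalemxAr -mulmxA mulKVmx// !mxE.
rewrite mxE.
have -> : \sum_l w 0 l * K l 0 =
    \sum_l \sum_a \sum_b w 0 l * p 0 a * p 0 b * dgram q a b l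
    + \sum_l \sum_a \sum_b w 0 l * p 0 a * p 0 b * dgram q b a l
    - \sum_l \sum_a \sum_b w 0 l * p 0 a * p 0 b * dgram q l a b.
  rewrite -big_split/= -sumrB; apply: eq_bigr => l _.
  rewrite mxE mulr_sumr -big_split/= -sumrB; apply: eq_bigr => a _.
  rewrite mulr_sumr -big_split/= -sumrB; apply: eq_bigr => b _; ring.
have E1 : \sum_l \sum_a \sum_b w 0 l * p 0 a * p 0 b * dgram q b a l =
    \sum_l \sum_a \sum_b w 0 l * p 0 a * p 0 b * dgram q a l b.
  apply: eq_bigr => l _; rewrite exchange_big/=; apply: eq_bigr => a _.
  apply: eq_bigr => b _; rewrite (dgram_sym _ _ _ hq); ring.
have E2 : \sum_l \sum_a \sum_b w 0 l * p 0 a * p 0 b * dgram q a b l =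
    \sum_l \sum_a \sum_b w 0 l * p 0 a * p 0 b * dgram q a l b.
  by do 3!(apply: eq_bigr => ? _); rewrite (dgram_sym _ _ _ hq).
rewrite E1 E2.
move: (\sum_l \sum_a \sum_b w 0 l * p 0 a * p 0 b * dgram q a l b)
  (\sum_l \sum_a \sum_b w 0 l * p 0 a * p 0 b * dgram q l a b) => S1 S2; lra.
Qed.

(* Along a geodesic [q] with velocity [p], for a field [W]:
   d/dt h(W, p) = h(W', p) + 1/2 (d_W h)(p, p). *)
Lemma is_derive_mform_geo (q p W : R -> 'rV[R]_n) (t tau : R) W' : chart_im phi (q t) ->
  is_derive t 1 q (tau *: p t) -> is_derive t 1 p (tau *: geo_acc h phi (q t) (p t)) ->
  is_derive t 1 W W' ->
  is_derive t 1 (fun t => mform (q t) (W t) (p t)) (mform (q t) W' (p t) +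
    tau * (2^-1 * \sum_i \sum_j p t 0 i * (\sum_l W t 0 l * dgram (q t) l i j) * p t 0 j)).
Proof.
move=> hu hq hp hW; have := is_derive_mform hu hq hW hp; move=> H; apply: (is_derive_eq H).
have mZr v w c : mform (q t) v (c *: w) = c * mform (q t) v w.
  by rewrite /mform linearZ -scalemxAr mxE.
rewrite mZr mform_acc//.
have -> : \sum_i \sum_j W t 0 i * (\sum_l (tau *: p t) 0 l * dgram (q t) l i j) * p t 0 j =
  tau * (\sum_l \sum_a \sum_b W t 0 l * p t 0 a * p t 0 b * dgram (q t) a l b).
  rewrite mulr_sumr; apply: eq_bigr => i _; rewrite mulr_sumr.
  transitivity (\sum_j \sum_l tau * (W t 0 i * p t 0 l * p t 0 j * dgram (q t) l i j)).
    apply: eq_bigr => j _; rewrite mulr_sumr mulr_suml; apply: eq_bigr => l _.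
    by rewrite mxE; ring.
  rewrite exchange_big/=; apply: eq_bigr => l _.
  by rewrite mulr_sumr.
have -> : \sum_i \sum_j p t 0 i * (\sum_l W t 0 l * dgram (q t) l i j) * p t 0 j =
  \sum_l \sum_a \sum_b W t 0 l * p t 0 a * p t 0 b * dgram (q t) l a b.
  rewrite [RHS]exchange_big/=; apply: eq_bigr => i _.
  rewrite [RHS]exchange_big/=; apply: eq_bigr => j _.
  rewrite mulr_sumr mulr_suml; apply: eq_bigr => l _; ring.
move: (\sum_l \sum_a \sum_b _ * _ * _ * dgram _ a l b) => S1.
move: (\sum_l \sum_a \sum_b _ * _ * _ * dgram _ l a b) => S2.
ring.
Qed.

(** The case [W = p] of the preceding formula: after renaming indices, every contribution is a
    multiple of the same triple sum, with factors -1, 1/2 and 1/2. *)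
Lemma unit_speed_derive (q p : R -> 'rV[R]_n) (t tau : R) : chart_im phi (q t) ->
  is_derive t 1 q (tau *: p t) -> is_derive t 1 p (tau *: geo_acc h phi (q t) (p t)) ->
  is_derive t 1 (fun t => mform (q t) (p t) (p t)) 0.
Proof.
move=> hu hq hp; have := is_derive_mform_geo hu hq hp hp => H; apply: (is_derive_eq H).
rewrite /mform -!scalemxAl mxE -/(mform _ _ _) mform_sym// mform_acc//.
have -> : \sum_i \sum_j p t 0 i * (\sum_l p t 0 l * dgram (q t) l i j) * p t 0 j =
  \sum_l \sum_a \sum_b p t 0 l * p t 0 a * p t 0 b * dgram (q t) l a b.
  rewrite [RHS]exchange_big/=; apply: eq_bigr => i _.
  rewrite [RHS]exchange_big/=; apply: eq_bigr => j _.
  rewrite mulr_sumr mulr_suml; apply: eq_bigr => l _; ring.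
have -> : \sum_l \sum_a \sum_b p t 0 l * p t 0 a * p t 0 b * dgram (q t) a l b =
  \sum_l \sum_a \sum_b p t 0 l * p t 0 a * p t 0 b * dgram (q t) l a b.
  rewrite exchange_big/=; apply: eq_bigr => l _; apply: eq_bigr => a _.
  by apply: eq_bigr => b _; rewrite [p t 0 l * _]mulrC.
move: (\sum_l \sum_a \sum_b _) => S1.
by rewrite (_ : - S1 + 2^-1 * S1 = - (2^-1 * S1)); [ring|lra].
Qed.

End FirstVariation.

Lemma scale_rowE (R : realType) n (c : R) (v : 'rV[R]_n) i : (c *: v) 0 i = c * v 0 i.
Proof. by rewrite mxE. Qed.

Lemma geo_field_inr (R : realType) n (M : analyticManifold R n) (h : analyticMetric M)
    (phi : chart R n M) q v k : geo_field h phi (inr k) (phase q v) = geo_acc h phi q v 0 k.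
Proof. by rewrite /geo_field phase_inl phase_inr. Qed.

(** * Analytic flow of a family and propagation of the Gauss lemma *)

Section Continuation.
Variables (R : realType) (n : nat) (M : analyticManifold R n) (h : analyticMetric M).
Local Notation RR := (real_ban R).
Local Notation A1 := (ls_ban RR).
Local Notation A2 := (ls_ban A1).
Implicit Types (phi psi : chart R n M) (alpha : R -> R -> M) (aq ap : 'I_n -> A1).

(** The constants [d] and [tau] depend only on the base point in phase space, not on the family or
    the time [t1]; [good_local] rests on this uniformity. Solving over [A1] treats all parameters at
    once, and [geo_follow] identifies the solutions with the given geodesics. *)
Lemma good_flow phi (u0 v0 : 'rV[R]_n) : atlas phi -> chart_im phi u0 ->
  exists d tau : R, [/\ 0 < d, 0 < tau & forall alpha th0 t1 rho aq ap,
    (forall th, geodesic h (alpha th)) -> good_data h alpha th0 t1 phi rho aq ap ->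
    (forall i, nm (aq i - emb A1 (u0 0 i)) <= d) ->
    (forall i, nm (ap i - emb A1 (v0 0 i)) <= d) ->
    exists bq bp : 'I_n -> A2,
      [/\ forall i, (bq i : lser A1) 0%N = aq i,
          forall i, evR 0 ((bq i : lser A1) 1%N) = tau * evR 0 (ap i)
        & forall s, `|s| < 1 -> good_data h alpha th0 (t1 + tau * s) phi rho
            (fun i => evr s (bq i)) (fun i => evr s (bp i))]].
Proof.
move=> hphi hu0; have [r r0 hr] := chart_im_ball hu0.
have [d [tau [d0 tau0 H]]] := @analytic_flow R _ (geo_field h phi) (phase u0 v0) r r0
  (fun c => geo_field_fan h v0 c hphi hu0).
exists d, tau; split => // alpha th0 t1 rho aq ap hgeo [_ rho0 hg] haq hap.
pose w (c : 'I_n + 'I_n) : A1 := match c with inl i => aq i | inr i => ap i end.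
have hw : in_ball (phase u0 v0) d w by case=> i /=; [exact: haq|exact: hap].
have [u [v [huv hub hpsi]]] := H A1 w hw.
pose bq i := u (inl i); pose bp i := u (inr i).
have c0 c : (u c : lser A1) 0%N = w c.
  rewrite huv lsD ls_constM.
  by rewrite [X in _ + _ * X](_ : _ = 0)// mulr0 addr0.
have ev2 (s x : R)  : `|s| <= 1 -> `|x| <= 1 -> @ban_mor R A2 RR (fun z => evR x (evr s z)).
  by move=> hs hx; apply: (ban_mor_comp (evr_mor A1 hs) (evR_mor hx)).
pose q (x s : R) := evrow x (fun i => evr s (bq i)).
pose p (x s : R) := evrow x (fun i => evr s (bp i)).
have st (s x : R)  : (fun c => evR x (evr s (u c))) = phase (q x s) (p x s).
  by apply/funext => -[i|i] /=; rewrite evrowE.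
have hq (s x : R)  : `|s| < 1 -> `|x| < 1 -> chart_im phi (q x s).
  move=> hs hx; apply: hr; apply/rv_ball; first exact: ltW.
  move=> i; rewrite evrowE.
  have := in_ball_mor (ev2 s x (ltW hs) (ltW hx)) hub (inl i); exact.
have hder (s x : R) c : `|s| < 1 -> `|x| < 1 -> is_derive s 1 (fun s => evR x (evr s (u c)))
    (tau * geo_field h phi c (phase (q x s) (p x s))).
  move=> hs hx; rewrite -st -(hpsi _ (ev2 s x (ltW hs) (ltW hx)) c).
  by apply: (is_derive_series (ban_mor_lin (evR_mor (ltW hx))) (huv c) hs).
have dq (s x : R)  : `|s| < 1 -> `|x| < 1 -> is_derive s 1 (q x) (tau *: p x s).
  move=> hs hx; apply/is_derive_rowP => i; have := hder s x (inl i) hs hx.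
  rewrite scale_rowE.
  rewrite (_ : (fun s => q x s 0 i) = (fun s => evR x (evr s (u (inl i)))))//.
  by apply/funext => y; rewrite /q evrowE.
have dp (s x : R)  : `|s| < 1 -> `|x| < 1 -> is_derive s 1 (p x) (tau *: geo_acc h phi (q x s) (p x s)).
  move=> hs hx; apply/is_derive_rowP => i.
  have -> : (tau *: geo_acc h phi (q x s) (p x s)) 0 i =
      tau * geo_field h phi (inr i) (phase (q x s) (p x s)).
    by rewrite geo_field_inr; exact: scale_rowE.
  rewrite (_ : (fun s => p x s 0 i) = (fun s => evR x (evr s (u (inr i))))).
    exact: hder.
  by apply/funext => y; rewrite /p evrowE.
have q0 (x : R) : q x 0 = evrow x aq.
  by apply/rowP => i; rewrite /q !evrowE evr0 c0.
have p0 (x : R) : p x 0 = evrow x ap.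
  by apply/rowP => i; rewrite /p !evrowE evr0 c0.
pose dl (x s : R) := devrow x (fun i => evr s (bq i)).
pose ep (x s : R) := devrow x (fun i => evr s (bp i)).
have dl0 (x : R) : dl x 0 = devrow x aq.
  by apply/rowP => i; rewrite /dl !devrowE evr0 c0.
(* [v (inl i)] and [u (inr i)] are known to agree only under evaluations; agreement for all
   parameters near [x] yields equal parameter derivatives. *)
have vE (s x : R) i : `|s| < 1 -> `|x| < 1 -> devR x (evr s (v (inl i))) = devR x (evr s (u (inr i))).
  move=> hs hx; apply: (is_derive_unique (is_derive_evR (evr s (v (inl i))) hx)).
  have e0 : 0 < 1 - `|x| by rewrite subr_gt0.
  apply: (is_derive_near (f := fun y => evR y (evr s (u (inr i)))) e0) => [y hy|].
    have y1 : `|y| <= 1 by rewrite ltW// (unit_ball_near hx).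
    exact: (esym (hpsi _ (ev2 s y (ltW hs) y1) (inl i))).
  exact: is_derive_evR.
have ddl (s x : R)  : `|s| < 1 -> `|x| < 1 -> is_derive s 1 (dl x) (tau *: ep x s).
  move=> hs hx; apply/is_derive_rowP => i.
  have := is_derive_series_dev (huv (inl i)) hs hx; rewrite vE//.
  rewrite scale_rowE /ep devrowE.
  rewrite (_ : (fun s => dl x s 0 i) = (fun s => devR x (evr s (u (inl i)))))//.
  by apply/funext => y; rewrite /dl devrowE.
have speed (s x : R)  : `|s| < 1 -> `|x| < 1 -> mform h phi (q x s) (p x s) (p x s) = 1.
  move=> hs hx; have [_ _ _ <- _] := hg x hx; rewrite -q0 -p0.
  apply: (@is_derive0_const R (fun s => mform h phi (q x s) (p x s) (p x s)) 0 1).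
    move=> y; rewrite subr0 => hy.
    by apply: (unit_speed_derive hphi (hq y x hy hx) (dq y x hy hx) (dp y x hy hx)).
  by rewrite subr0.
have gauss (s x : R)  : `|s| < 1 -> `|x| < 1 -> mform h phi (q x s) (dl x s) (p x s) = 0.
  move=> hs hx; have [_ _ _ _ <-] := hg x hx; rewrite -q0 -p0 -dl0.
  apply: (@is_derive0_const R (fun s => mform h phi (q x s) (dl x s) (p x s)) 0 1); last first.
    by rewrite subr0.
  move=> y; rewrite subr0 => hy; have iq := hq y x hy hx.
  have := is_derive_mform_geo hphi iq (dq y x hy hx) (dp y x hy hx) (ddl y x hy hx) => D.
  apply: (is_derive_eq D).
  have xq : is_derive x 1 (fun x => q x y) (dl x y) by exact: is_derive_evrow.
  have xp : is_derive x 1 (fun x => p x y) (ep x y) by exact: is_derive_evrow.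
  have := is_derive_mform (c := fun x => q x y) (t := x) h hphi iq xq xp xp => D1.
  have D0 : is_derive x 1 (fun x => mform h phi (q x y) (p x y) (p x y)) 0.
    have e0 : 0 < 1 - `|x| by rewrite subr_gt0.
    have sp z : `|z - x| < 1 - `|x| -> (fun _ : R => 1 : R) z = mform h phi (q z y) (p z y) (p z y).
      by move=> hz; rewrite speed//; exact: unit_ball_near hx hz.
    exact: (is_derive_near e0 sp (is_derive_cst _ _ _)).
  (* With [m] pairing the parameter derivative of the velocity with the velocity, and [S] the
     derivative of the metric, constant speed gives [S + 2 m = 0]. The time derivative of the Gauss
     pairing is [tau * (m + S / 2)], hence 0. *)
  have := is_derive_unique D1 D0.
  rewrite (mform_sym h hphi (p x y) (ep x y) iq) mformZl.
  move: (mform _ _ _ _ _) (\sum_i _) => m S E.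
  by rewrite -mulrDr (_ : m + 2^-1 * S = 0) ?mulr0//; lra.
exists bq, bp; split.
- by move=> i; exact: c0.
- move=> i; rewrite /bq huv lsD ls_constM /= add0r.
  have [hA hM hE] := @evR_mor R 0 (ltac:(by rewrite normr0)).
  rewrite hM [evR 0 (emb _ _)](hE tau) hM /= [evR 0 (emb _ _)](hE 1^-1) invr1 mulr1.
  congr (_ * _).
  have z1 : `|0 : R| <= 1 by rewrite normr0.
  have := hpsi _ (ev2 0 0 z1 z1) (inl i); rewrite /= evr0 => ->.
  by rewrite evr0 c0.
- move=> s hs; split => // x hx.
  have [e1 e2 e3 _ _] := hg x hx.
  have [f1 f2 f3] := @geo_follow R n M h phi (alpha (th0 + rho * x)) t1 tau (q x) (p x)
    (hgeo _) hphi (fun s hs => And3 (hq s x hs hx) (dq s x hs hx) (dp s x hs hx))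
    e1 (etrans e2 (esym (q0 x))) (etrans e3 (esym (p0 x))) s hs.
  split; [exact: f1|exact: f2|exact: f3|exact: speed|exact: gauss].
Qed.

End Continuation.

(** * Analytic dependence at all times *)

Section GoodEverywhere.
Variables (R : realType) (n : nat) (M : analyticManifold R n) (h : analyticMetric M).
Local Notation RR := (real_ban R).
Local Notation A1 := (ls_ban RR).
Local Notation A2 := (ls_ban A1).
Variables (alpha : R -> R -> M) (th0 : R).
Hypothesis hgeo : forall th, geodesic h (alpha th).
Implicit Types (phi : chart R n M) (aq ap : 'I_n -> A1).

Definition good (T : R) := exists phi rho aq ap, good_data h alpha th0 T phi rho aq ap.

Lemma good_center T phi rho aq ap : good_data h alpha th0 T phi rho aq ap ->
  [/\ chart_dom phi (alpha th0 T), local_curve phi (alpha th0) T = evrow 0 aq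
    & velocity phi (alpha th0) T = evrow 0 ap].
Proof.
move=> [_ _ /(_ 0)]; rewrite normr0 mulr0 addr0 => /(_ ltr01)[] ? ? ? _ _.
by split.
Qed.

(** Half of [d] pays for the distance of the centre from [(u0, v0)], the other half for the
    nonconstant part of the series after rescaling. *)
Lemma good_data_small phi (u0 v0 : 'rV[R]_n) (d : R) T : 0 < d -> atlas phi ->
  good T -> chart_dom phi (alpha th0 T) ->
  `|local_curve phi (alpha th0) T - u0| <= d / 2 ->
  `|velocity phi (alpha th0) T - v0| <= d / 2 ->
  exists rho aq ap, [/\ good_data h alpha th0 T phi rho aq ap,
    forall i, nm (aq i - emb A1 (u0 0 i)) <= d &
    forall i, nm (ap i - emb A1 (v0 0 i)) <= d].
Proof.
move=> d0 hphi [psi [rho0 [aq0 [ap0 hg0]]]] hd hu hv.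
have [rho1 [aq1 [ap1 hg1]]] := good_change hgeo hphi hd hg0.
have d20 : 0 < d / 2 by rewrite divr_gt0.
pose w (c : 'I_n + 'I_n) : A1 := match c with inl i => aq1 i | inr i => ap1 i end.
have [l l0 [l1 hl]] := ex_scale w d20.
exists (rho1 * l), (sc l aq1), (sc l ap1).
have [_ c2 c3] := good_center hg1.
split; first exact: good_scale.
- move=> i; rewrite scE.
  have -> : tay 0 l (aq1 i) - emb A1 (u0 0 i) = (tay 0 l (aq1 i) - emb A1 (evR 0 (aq1 i))) +
      emb A1 (evR 0 (aq1 i) - u0 0 i) by rewrite rmorphB addrA subrK.
  rewrite (le_trans (nmD _ _))// (splitr d) lerD//; first exact: (hl (inl i)).
  rewrite (le_trans (nm_emb _ _))//.
  by move: hu; rewrite c2 => /(rv_ball _ _ (ltW d20))/(_ i); rewrite evrowE.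
- move=> i; rewrite scE.
  have -> : tay 0 l (ap1 i) - emb A1 (v0 0 i) = (tay 0 l (ap1 i) - emb A1 (evR 0 (ap1 i))) +
      emb A1 (evR 0 (ap1 i) - v0 0 i) by rewrite rmorphB addrA subrK.
  rewrite (le_trans (nmD _ _))// (splitr d) lerD//; first exact: (hl (inr i)).
  rewrite (le_trans (nm_emb _ _))//.
  by move: hv; rewrite c3 => /(rv_ball _ _ (ltW d20))/(_ i); rewrite evrowE.
Qed.

(** The step length is determined at [T] alone, so the flow from any good [t1] near [T] reaches
    every [t2] near [T], backwards as well as forwards. This serves both the open and the closed
    half of the continuation. *)
Lemma good_local T : exists2 e : R, 0 < e & forall t1 t2,
  `|t1 - T| < e -> `|t2 - T| < e -> good t1 -> good t2.
Proof.
have [phi hphi hd] := atlas_cover (alpha th0 T).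
have him : chart_im phi (local_curve phi (alpha th0) T) by exists (alpha th0 T).
have [d [tau [d0 tau0 H]]] := good_flow h (velocity phi (alpha th0) T) hphi him.
have d20 : 0 < d / 2 by rewrite divr_gt0.
have calpha : continuous (alpha th0) by case: (hgeo th0).
have [e1 e10 h1] := curve_dom_near calpha hd.
have [dl dv] := geodesic_derive (hgeo th0) hphi hd.
have /cvgrPdist_le/(_ _ d20)[e2 /= e20 h2] := is_derive_continuous dl.
have /cvgrPdist_le/(_ _ d20)[e3 /= e30 h3] := is_derive_continuous dv.
exists (Num.min (Num.min e1 e2) (Num.min e3 (tau / 2))).
  by rewrite !lt_min e10 e20 e30 divr_gt0.
move=> t1 t2; rewrite !lt_min => /andP[/andP[a1 a2] /andP[a3 a4]].
move=> /andP[_ /andP[_ a4']] g1.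
have k2 : `|local_curve phi (alpha th0) t1 - local_curve phi (alpha th0) T| <= d / 2.
  by rewrite distrC; apply: h2; rewrite /= distrC.
have k3 : `|velocity phi (alpha th0) t1 - velocity phi (alpha th0) T| <= d / 2.
  by rewrite distrC; apply: h3; rewrite /= distrC.
have [rho [aq [ap [hg haq hap]]]] := good_data_small d0 hphi g1 (h1 t1 a1) k2 k3.
have [bq [bp [_ _ hb]]] := H alpha th0 t1 rho aq ap hgeo hg haq hap.
have hs : `|(t2 - t1) / tau| < 1.
  rewrite normrM normfV (gtr0_norm tau0) ltr_pdivrMr// mul1r.
  have -> : t2 - t1 = (t2 - T) - (t1 - T) by ring.
  by rewrite (le_lt_trans (ler_normB _ _))//; lra.
have := hb _ hs; rewrite mulrCA mulfV ?gt_eqF// mulr1 addrC subrK => g2.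
by exists phi, rho, (fun i => evr ((t2 - t1) / tau) (bq i)), (fun i => evr ((t2 - t1) / tau) (bp i)).
Qed.

Lemma good_all : good 0 -> forall T, good T.
Proof.
move=> g0 T; apply: (@interval_clopen R setT good 0) => //.
- move=> s _ gs; have [e e0 he] := good_local s; exists e => // s1 _ hs1.
  by apply: (he s s1) => //; rewrite subrr normr0.
- move=> s _ hs; have [e e0 he] := good_local s; have [s1 [_ hs1 g1]] := hs e e0.
  by apply: (he s1 s) => //; rewrite subrr normr0.
Qed.

Lemma good_flow_at T phi : good T -> atlas phi -> chart_dom phi (alpha th0 T) ->
  exists rho aq ap tau (bq bp : 'I_n -> A2), [/\ 0 < tau, good_data h alpha th0 T phi rho aq ap,
    forall i, (bq i : lser A1) 0%N = aq i,
    forall i, evR 0 ((bq i : lser A1) 1%N) = tau * evR 0 (ap i) &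
    forall s, `|s| < 1 -> good_data h alpha th0 (T + tau * s) phi rho
            (fun i => evr s (bq i)) (fun i => evr s (bp i))].
Proof.
move=> gT hphi hd.
have him : chart_im phi (local_curve phi (alpha th0) T) by exists (alpha th0 T).
have [d [tau [d0 tau0 H]]] := good_flow h (velocity phi (alpha th0) T) hphi him.
have [||rho [aq [ap [hg haq hap]]]] := good_data_small
   (u0 := local_curve phi (alpha th0) T) (v0 := velocity phi (alpha th0) T) d0 hphi gT hd.
- by rewrite subrr normr0 divr_ge0// ltW.
- by rewrite subrr normr0 divr_ge0// ltW.
have [bq [bp [hb0 hb1 hb]]] := H alpha th0 T rho aq ap hgeo hg haq hap.
by exists rho, aq, ap, tau, bq, bp.
Qed.

End GoodEverywhere.

(** * Hits of y along a family *)

Section IsolatedHits.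
Variables (R : realType) (n : nat) (M : analyticManifold R n) (h : analyticMetric M).
Local Notation RR := (real_ban R).
Local Notation A1 := (ls_ban RR).
Local Notation A2 := (ls_ban A1).

Lemma cvg_bigsum (T : Type) (F : set_system T) (FF : Filter F) (I : Type) (r : seq I)
    (f : I -> T -> R) (l : I -> R) :
  (forall i, f i @ F --> l i) -> (fun t => \sum_(i <- r) f i t) @ F --> \sum_(i <- r) l i.
Proof.
move=> hf; elim: r => [|i r IH].
  by under eq_fun do rewrite big_nil; rewrite big_nil; exact: cvg_cst.
by under eq_fun do rewrite big_cons; rewrite big_cons; apply: cvgD.
Qed.

Lemma iter_shiftE (u : A1) m k : (iter m (@ls_shift R RR) u : lser RR) k = (u : lser RR) (m + k)%N.
Proof. by elim: m k => [|m IH] k //=; rewrite IH addSnnS. Qed.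

Lemma evR_shift (u : A1) x : `|x| <= 1 ->
  evR x u = (u : lser RR) 0%N + x * evR x (ls_shift u) :> R.
Proof. by move=> hx; rewrite /evR evr_shift. Qed.

Lemma evR_shiftm (u : A1) m x : `|x| <= 1 -> (forall k, (k < m)%N -> (u : lser RR) k = 0) ->
  evR x u = x ^+ m * evR x (iter m (@ls_shift R RR) u) :> R.
Proof.
move=> hx; elim: m => [|m IH] hu; first by rewrite expr0 mul1r.
rewrite IH; last by move=> k km; apply: hu; rewrite ltnS ltnW.
rewrite evR_shift// iter_shiftE addn0 hu// add0r exprS /=.
by rewrite mulrCA mulrA.
Qed.

Lemma evR_eq0 (u : A1) x : `|x| <= 1 -> (forall k, (u : lser RR) k = 0) -> evR x u = 0 :> R.
Proof.
move=> hx hu; rewrite (_ : u = 0); last by apply: lserP => k; rewrite hu ls0.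
have [hA _ _] := evR_mor hx; exact: (contr_add0 hA).
Qed.

(** Replacing [s] and then [x] by 0 costs at most [|s|] and [|x|] times the norms of [b] and of its
    constant coefficient, since evaluations are contractions. *)
Lemma cvg_evr2 (b : A2) : (fun z : R * R => evR z.2 (evr z.1 b) : R) @ nbhs (0 : R, 0 : R)
  --> evR 0 ((b : lser A1) 0%N).
Proof.
pose C := nm b + nm ((b : lser A1) 0%N).
have C0 : 0 <= C by rewrite addr_ge0// nm_ge0.
apply/cvgrPdist_le => e e0.
have d0 : 0 < Num.min 1 (e / (C + 1)) by rewrite lt_min ltr01 divr_gt0// ltr_wpDl.
have hb : nbhs (0 : R, 0 : R) [set z : R * R |
    `|z.1| < Num.min 1 (e / (C + 1)) /\ `|z.2| < Num.min 1 (e / (C + 1))].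
  exists (ball (0 : R) (Num.min 1 (e / (C + 1))), ball (0 : R) (Num.min 1 (e / (C + 1)))).
    by split; exact: nbhsx_ballx.
  by move=> [s x] [/= h1 h2]; split; [move: h1|move: h2]; rewrite /ball/= sub0r normrN.
apply: filterS hb => -[s x] /= [hs hx].
have s1 : `|s| <= 1 by rewrite ltW// (lt_le_trans hs)// ge_min lexx.
have x1 : `|x| <= 1 by rewrite ltW// (lt_le_trans hx)// ge_min lexx.
have hsC : `|s| <= e / (C + 1) by rewrite ltW// (lt_le_trans hs)// ge_min lexx orbT.
have hxC : `|x| <= e / (C + 1) by rewrite ltW// (lt_le_trans hx)// ge_min lexx orbT.
have [hA _ _] := evR_mor x1.
have E1 : `|evR x (evr s b) - evR x ((b : lser A1) 0%N)| <= `|s| * nm b.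
  have E := contr_addB hA (evr s b) ((b : lser A1) 0%N).
  have H := hA.2 (evr s b - (b : lser A1) 0%N); rewrite E in H.
  exact: (le_trans H (evr_dist0 b s1)).
have E2 : `|evR x ((b : lser A1) 0%N) - evR 0 ((b : lser A1) 0%N)| <=
    `|x| * nm ((b : lser A1) 0%N).
  by have := evr_dist0 ((b : lser A1) 0%N) x1; rewrite /evR evr0.
rewrite distrC.
set f1 : R := evR x (evr s b) in E1 *; set f2 : R := evR x _ in E1 E2 *; set f3 : R := evR 0 _ in E2 *.
have -> : f1 - f3 = (f1 - f2) + (f2 - f3) by ring.
rewrite (le_trans (ler_normD _ _))// (le_trans (lerD E1 E2))//.
apply: (@le_trans _ _ (e / (C + 1) * C)).
  by rewrite /C mulrDr lerD// ler_wpM2r// nm_ge0.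
by rewrite mulrAC ler_pdivrMr ?ltr_wpDl// ler_wpM2l ?(ltW e0)// lerDl.
Qed.

Lemma cvg_evr1 (u : A1) : (fun z : R * R => evR z.2 u : R) @ nbhs (0 : R, 0 : R) --> evR 0 u.
Proof.
have := @cvg_evr2 (ls_const u); rewrite [X in evR 0 X](_ : _ = u)//.
apply: cvg_trans; apply: near_eq_cvg.
have hb : nbhs (0 : R, 0 : R) [set z : R * R | `|z.1| < 1].
  exists (ball (0 : R) 1, setT).
    by split; [exact: nbhsx_ballx|exact: filterT].
  by move=> [s x] [/= h1 _]; move: h1; rewrite /ball/= sub0r normrN.
by apply: filterS hb => -[s x] /= hs; rewrite evr_const// ltW.
Qed.

(** On [|x| <= 1/2] the derivative is bounded by [2 * nm u], which makes the product Lipschitz at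
    0. *)
Lemma dev_small (u : A1) : {for 0, continuous (fun x : R => x * devR x u)}.
Proof.
apply: (@lip_continuous _ _ _ _ 2^-1 (2 * nm u)) => //.
  by rewrite mulr_ge0// nm_ge0.
move=> x; rewrite subr0 mul0r subr0 => hx.
have x1 : `|x| < 1 by rewrite (le_lt_trans hx)// invf_lt1// ltr1n.
rewrite normrM mulrC ler_wpM2r//.
have := nm_dser u x1 => hd; apply: (le_trans hd).
rewrite mulrC ler_wpM2r ?nm_ge0//.
rewrite -[leRHS]invrK lef_pV2 ?posrE ?invr_gt0//; lra.
Qed.

Lemma devR_lead (a u : A1) (c : R) m x : `|x| < 1 ->
  (forall y : R, `|y| < 1 -> evR y a = c + y ^+ m.+1 * evR y u) ->
  devR x a = x ^+ m * (m.+1%:R * evR x u + x * devR x u).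
Proof.
move=> hx hu; apply: (is_derive_unique (is_derive_evR a hx)).
have e0 : 0 < 1 - `|x| by rewrite subr_gt0.
have E y : `|y - x| < 1 - `|x| -> c + y ^+ m.+1 * evR y u = evR y a.
  by move=> hy; rewrite hu//; exact: unit_ball_near hx hy.
apply: (is_derive_near (f := fun y => c + y ^+ m.+1 * evR y u : R) e0 E).
have hX : is_derive x 1 (fun y : R => y ^+ m.+1) (m.+1%:R * x ^+ m).
  have -> : (fun y : R => y ^+ m.+1) = (@id R) ^+ m.+1 by apply/funext => y; rewrite fctE.
  by apply: is_derive_eq; rewrite /GRing.scale/= mulr1.
have := @is_deriveD _ _ _ _ _ x 1 _ _ (is_derive_cst c x 1)
  (@is_deriveM R R^o _ _ x 1 _ _ hX (is_derive_evR u hx)) => D.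
apply: (is_derive_eq D); rewrite /GRing.scale/= exprS; ring.
Qed.

Lemma nbhs00 (P : set (R * R)) : nbhs (0 : R, 0 : R) P ->
  exists2 e : R, 0 < e & forall s x, `|s| < e -> `|x| < e -> P (s, x).
Proof.
move=> [[A B] [/= /nbhs_ballP[e1 /= e10 h1] /nbhs_ballP[e2 /= e20 h2]] hAB].
exists (Num.min e1 e2); first by rewrite lt_min e10.
move=> s x; rewrite !lt_min => /andP[s1 _] /andP[_ x2]; apply: hAB; split.
  by apply: h1; rewrite /ball/= sub0r normrN.
by apply: h2; rewrite /ball/= sub0r normrN.
Qed.

Variables (alpha : R -> R -> M) (th0 t0 : R) (y : M).
Hypothesis hgeo : forall th, geodesic h (alpha th).

(* If the hits of [y] are not constant in time to first order at [th0], their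
   leading term is at once parallel to the velocity (because it is a hit) and
   orthogonal to it (by the Gauss lemma). *)
Lemma hits_isolated_or_const : good h alpha th0 t0 -> alpha th0 t0 = y ->
  (exists2 e : R, 0 < e & forall th, `|th - th0| < e -> alpha th t0 = y) \/
  (exists2 e : R, 0 < e & forall t th, `|t - t0| < e -> `|th - th0| < e ->
     alpha th t = y -> t = t0 /\ th = th0).
Proof.
move=> g0 hy; have [phi hphi hd] := atlas_cover (alpha th0 t0).
have [rho [aq [ap [tau [bq [bp [tau0 hg hb0 hb1 hb]]]]]]] := good_flow_at hgeo g0 hphi hd.
have [_ rho0 hga] := hg.
have [_ Yq _] := good_center hg.
pose Y (i : 'I_n) : R := evR 0 (aq i).
pose d (i : 'I_n) : A1 := aq i - ls_const (Y i : RR).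
have qY th t : chart_dom phi (alpha th t) ->
    alpha th t = y <-> forall i, local_curve phi (alpha th) t 0 i = Y i.
  move=> hd'; split=> [E i|E].
    by rewrite /local_curve E -hy -[chart_map _ _]/(local_curve phi (alpha th0) t0) Yq evrowE.
  rewrite -hy; apply: (chart_inj hd' hd); apply/rowP => i.
  by rewrite -[LHS]/(local_curve phi (alpha th) t 0 i) E
    -[RHS]/(local_curve phi (alpha th0) t0 0 i) Yq evrowE.
have ed x i : `|x| <= 1 -> evR x (d i) = evR x (aq i) - Y i :> R.
  move=> hx; have [hA _ _] := evR_mor hx.
  rewrite -[Y i in RHS](evr_const (Y i : RR) hx).
  exact: (contr_addB hA).
have th_x th : `|th - th0| < rho -> `|(th - th0) / rho| < 1 /\ th0 + rho * ((th - th0) / rho) = th.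
  move=> hth; split; first by rewrite normrM normfV (gtr0_norm rho0) ltr_pdivrMr// mul1r.
  by rewrite mulrCA mulfV ?gt_eqF// mulr1 addrC subrK.
have [[k0 hk0]|hno] := pselect (exists k, [exists i, (d i : lser RR) k != 0]); last first.
  left; exists rho => // th /th_x[hx Ex].
  have [e1 e2 _ _ _] := hga _ hx; rewrite Ex in e1 e2.
  apply/(qY _ _ e1) => i; rewrite e2 evrowE; apply/eqP; rewrite -subr_eq0 -ed ?ltW//.
  apply/eqP; apply: evR_eq0; first exact: ltW.
  move=> k; apply/eqP/negPn/negP => dk; apply: hno; exists k; apply/existsP.
  by exists i.
right.
pose Pk k := [exists i, (d i : lser RR) k != 0].
have exk : exists k, Pk k by exists k0.
have [m hm hmin] : exists2 m, [exists i, (d i : lser RR) m != 0] &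
    forall k i, (k < m)%N -> (d i : lser RR) k = 0.
  case: (ex_minnP exk) => m hm hmin; exists m => // k i km.
  apply/eqP/negPn/negP => dk; have := hmin k; rewrite leqNgt km => H.
  by have := H (introT existsP (ex_intro (fun i => (d i : lser RR) k != 0) i dk)).
have {}hm := existsP hm; have [i0 hi0] := hm.
have d00 i : (d i : lser RR) 0%N = 0.
  by rewrite lsB /= /Y /evR evr0 subrr.
(* The constant terms of [d] vanish, so the order of the leading term is positive. It is [m.+1] from
   here on, which leaves [x ^+ m] after differentiation. *)
case: m hm hmin hi0 => [|m] hm hmin hi0; first by rewrite d00 eqxx in hi0.
pose e (i : 'I_n) : A1 := iter m.+1 (@ls_shift R RR) (d i).
pose c (i : 'I_n) : R := (d i : lser RR) m.+1.
have ce i : evR 0 (e i) = c i :> R by rewrite /evR evr0 iter_shiftE addn0.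
have aqE x i : `|x| <= 1 -> evR x (aq i) = Y i + x ^+ m.+1 * evR x (e i) :> R.
  move=> hx; rewrite -(evR_shiftm hx (hmin ^~ i)) ed//.
  by rewrite addrC subrK.
pose p0 := evrow 0 ap; pose Yr := evrow 0 aq.
have hdim : chart_im phi Yr by exists (alpha th0 t0).
(* The velocity with its index lowered. It takes the value 1 on the velocity and will be shown to
   annihilate the leading vector [c]. *)
pose eta (i : 'I_n) : R := \sum_j gram h phi Yr i j * p0 0 j.
have z1 : `|0 : R| < 1 by rewrite normr0.
have etap : \sum_i eta i * p0 0 i = 1.
  have [_ _ _ <- _] := hga 0 z1; rewrite -/p0 -/Yr mformE; apply: eq_bigr => i _.
  by rewrite mulr_suml; apply: eq_bigr => j _; rewrite (gram_symE h i j hphi hdim); ring.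
pose V i x : R := m.+1%:R * evR x (e i) + x * devR x (e i).
(* The Gauss relation divided by [x ^+ m]. It vanishes for [x != 0], hence at 0 by continuity, where
   it is [m.+1] times the pairing of [eta] with [c]. *)
pose L x : R := \sum_i \sum_j V i x * gram h phi (evrow x aq) i j * evR x (ap j).
have Lz x : `|x| < 1 -> x != 0 -> L x = 0.
  move=> hx x0; have [_ _ _ _] := hga x hx; rewrite mformE => H.
  have xm0 : x ^+ m != 0 by rewrite expf_neq0.
  apply: (mulfI xm0); rewrite mulr0 -[RHS]H /L mulr_sumr; apply: eq_bigr => i _.
  rewrite mulr_sumr; apply: eq_bigr => j _.
  rewrite devrowE evrowE (@devR_lead (aq i) (e i) (Y i) m x hx) /V.
    by rewrite !mulrA.
  by move=> y' hy'; rewrite aqE// ltW.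
have cevR (u : A1) : {for 0, continuous (fun x => evR x u : R)}.
  exact: (is_derive_continuous (is_derive_evR u z1)).
have Lc : {for 0, continuous L}.
  apply: cvg_bigsum => i; apply: cvg_bigsum => j; apply: cvgM; last exact: cevR.
  apply: cvgM.
    apply: cvgD; last exact: dev_small.
    by apply: cvgM; [exact: cvg_cst|exact: cevR].
  apply: (@continuous_comp _ _ _ (fun x => evrow x aq) (fun u => gram h phi u i j)).
    exact: (is_derive_continuous (is_derive_evrow aq z1)).
  exact: fanv_continuous (gram_fanv h i j hphi hdim).
have L0 : L 0 = 0.
  apply: (@agree_limit R R L (fun=> 0) 0 (@Rhausdorff R) Lc); first exact: cvg_cst.
  move=> ep ep0; exists (Num.min 2^-1 (ep / 2)).
    rewrite subr0 ger0_norm; last by rewrite le_min invr_ge0 ler0n divr_ge0// ltW.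
    by rewrite gt_min; apply/orP; right; lra.
  have p1 : 0 < Num.min 2^-1 (ep / 2) by rewrite lt_min invr_gt0 ltr0n divr_gt0.
  apply: Lz; last by rewrite gt_eqF.
  by rewrite gtr0_norm// gt_min; apply/orP; left; lra.
have etac : \sum_i eta i * c i = 0.
  have : m.+1%:R * (\sum_i eta i * c i) = 0.
    rewrite -[RHS]L0 /L mulr_sumr; apply: eq_bigr => i _.
    transitivity (\sum_j m.+1%:R * (gram h phi Yr i j * p0 0 j * c i)).
      by rewrite /eta mulr_suml mulr_sumr.
    apply: eq_bigr => j _.
    by rewrite /V mul0r addr0 ce -/Yr /p0 evrowE; ring.
  by move/eqP; rewrite mulf_eq0 pnatr_eq0/= => /eqP.
pose pi_ (i : 'I_n) : A2 := ls_shift (bq i).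
have posE s x i : `|s| <= 1 -> `|x| <= 1 ->
    evR x (evr s (bq i)) = evR x (aq i) + s * evR x (evr s (pi_ i)) :> R.
  move=> hs hx; rewrite (evr_shift (bq i) hs) hb0.
  have [hA hM hE] := evR_mor hx.
  transitivity (evR x (aq i) + evR x (emb A1 s * evr s (pi_ i)) : R); first exact: hA.1.
  congr (_ + _); transitivity (evR x (emb A1 s) * evR x (evr s (pi_ i)) : R); first exact: hM.
  by congr (_ * _); exact: hE.
pose fe i (z : R * R) : R := evR z.2 (e i).
pose fp i (z : R * R) : R := evR z.2 (evr z.1 (pi_ i)).
have cfe i : fe i @ nbhs (0 : R, 0 : R) --> c i by rewrite -(ce i); exact: cvg_evr1.
have cfp i : fp i @ nbhs (0 : R, 0 : R) --> tau * p0 0 i.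
  have -> : tau * p0 0 i = evR 0 ((bq i : lser A1) 1%N) by rewrite hb1 /p0 evrowE.
  exact: (@cvg_evr2 (pi_ i)).
pose FP z : R := \sum_i eta i * fp i z; pose FE z : R := \sum_i eta i * fe i z.
have cFP : FP @ nbhs (0 : R, 0 : R) --> tau.
  have -> : tau = \sum_i eta i * (tau * p0 0 i).
    rewrite -[LHS]mulr1 -etap mulr_sumr; apply: eq_bigr => i _; ring.
  by apply: cvg_bigsum => i; apply: cvgM; [exact: cvg_cst|exact: cfp].
have cFE : FE @ nbhs (0 : R, 0 : R) --> (0 : R).
  have : FE @ nbhs (0 : R, 0 : R) --> \sum_i eta i * c i.
    by apply: cvg_bigsum => i; apply: cvgM; [exact: cvg_cst|exact: cfe].
  by rewrite etac.
(* A hit gives two linear relations between [x ^+ m.+1] and [s]: the component [i0] and the pairing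
   with [eta]. [DD] is their determinant; its limit [c i0 * tau] is nonzero because [FE] tends to
   0. *)
pose DD z : R := fe i0 z * FP z - FE z * fp i0 z.
have cDD : DD @ nbhs (0 : R, 0 : R) --> c i0 * tau.
  have -> : c i0 * tau = c i0 * tau - 0 * (tau * p0 0 i0) by rewrite mul0r subr0.
  by apply: cvgB; apply: cvgM.
have nct : 0 < `|c i0 * tau| by rewrite normr_gt0 mulf_neq0// gt_eqF.
have [e1 e10 he1] := nbhs00 ((cvgrPdist_lt _ _).1 cDD _ nct).
have DD0 s x : `|s| < e1 -> `|x| < e1 -> DD (s, x) != 0.
  move=> hs hx; apply/eqP => D0; have := he1 s x hs hx.
  by rewrite /= D0 subr0 ltxx.
have m0 : 0 < Num.min 1 e1 by rewrite lt_min ltr01.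
exists (Num.min (rho * Num.min 1 e1) (tau * Num.min 1 e1)).
  by rewrite lt_min !mulr_gt0.
move=> t th; rewrite !lt_min => /andP[_ ht] /andP[hth _] E.
pose s := (t - t0) / tau; pose x := (th - th0) / rho.
have : `|s| < Num.min 1 e1.
  by rewrite /s normrM normfV (gtr0_norm tau0) ltr_pdivrMr// mulrC.
rewrite lt_min => /andP[s1 se].
have : `|x| < Num.min 1 e1.
  by rewrite /x normrM normfV (gtr0_norm rho0) ltr_pdivrMr// mulrC.
rewrite lt_min => /andP[x1 xe].
have Es : t0 + tau * s = t by rewrite /s mulrCA mulfV ?gt_eqF// mulr1 addrC subrK.
have Ex : th0 + rho * x = th by rewrite /x mulrCA mulfV ?gt_eqF// mulr1 addrC subrK.
have [_ _ hgs] := hb s s1; have [f1 f2 _ _ _] := hgs x x1.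
rewrite Es Ex in f1 f2.
have key i : x ^+ m.+1 * fe i (s, x) + s * fp i (s, x) = 0.
  have := (qY th t f1).1 E i; rewrite f2 evrowE posE ?ltW// aqE ?ltW// => H.
  by rewrite /fe /fp /=; move: H; lra.
have hDD := DD0 s x se xe.
have key2 : x ^+ m.+1 * FE (s, x) + s * FP (s, x) = 0.
  rewrite /FE /FP !mulr_sumr -big_split/= big1// => i _.
  by rewrite [_ + _](_ : _ = eta i * (x ^+ m.+1 * fe i (s, x) + s * fp i (s, x)));
    [rewrite key mulr0|ring].
have key3 : x ^+ m.+1 * DD (s, x) = 0.
  rewrite /DD mulrBr.
  have -> : x ^+ m.+1 * (fe i0 (s, x) * FP (s, x)) = (x ^+ m.+1 * fe i0 (s, x)) * FP (s, x) by ring.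
  have -> : x ^+ m.+1 * (FE (s, x) * fp i0 (s, x)) = (x ^+ m.+1 * FE (s, x)) * fp i0 (s, x) by ring.
  have -> : x ^+ m.+1 * fe i0 (s, x) = - (s * fp i0 (s, x)) by apply/eqP; rewrite -addr_eq0 key.
  have -> : x ^+ m.+1 * FE (s, x) = - (s * FP (s, x)) by apply/eqP; rewrite -addr_eq0 key2.
  ring.
have x0 : x = 0.
  apply/eqP; move/eqP: key3; rewrite mulf_eq0 (negbTE hDD) orbF.
  by rewrite expf_eq0.
have s0 : s = 0.
  apply/eqP/negPn/negP => sn0; move/negP: hDD; apply; apply/eqP.
  have fp0 i : fp i (s, x) = 0.
    by apply: (mulfI sn0); have := key i; rewrite x0 expr0n mul0r add0r mulr0.
  have FP0 : FP (s, x) = 0 by rewrite /FP big1// => i _; rewrite fp0 mulr0.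
  by rewrite /DD fp0 FP0 !mulr0 subr0.
by rewrite -Es -Ex s0 x0 !mulr0 !addr0.
Qed.

End IsolatedHits.

(** * One hit time for all directions *)

Section Countability.
Variable R : realType.

(** Each point is alone in a box with rational centre and rational half-width below [e / 2], as two
    points of one box are closer than [e]. Choosing such boxes injects [Z] into triples of
    rationals. *)
Lemma isolated_countable (Z : set (R * R)) : (forall z, Z z -> exists2 e : R, 0 < e &
    forall z', Z z' -> `|z'.1 - z.1| < e -> `|z'.2 - z.2| < e -> z' = z) -> countable Z.
Proof.
move=> h.
have key z : exists c : rat * rat * rat, Z z -> [/\ `|z.1 - ratr c.1.1| < ratr c.2,
    `|z.2 - ratr c.1.2| < ratr c.2 & forall z', Z z' -> `|z'.1 - ratr c.1.1| < ratr c.2 ->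
     `|z'.2 - ratr c.1.2| < ratr c.2 -> z' = z].
  have [Zz|nZ] := pselect (Z z); last by exists (0, 0, 0).
  have [e e0 he] := h z Zz.
  have [r] : exists r : rat, ratr r \in `]0, (e / 2)[ by apply: rat_in_itvoo; rewrite divr_gt0.
  rewrite in_itv/= => /andP[r0 re].
  have [p] : exists p : rat, ratr p \in `]z.1 - ratr r, (z.1 + ratr r)[.
    by apply: rat_in_itvoo; lra.
  rewrite in_itv/= => /andP[p1 p2].
  have [q] : exists p : rat, ratr p \in `]z.2 - ratr r, (z.2 + ratr r)[.
    by apply: rat_in_itvoo; lra.
  rewrite in_itv/= => /andP[q1 q2].
  have hp : `|z.1 - ratr p| < ratr r by rewrite ltr_norml; apply/andP; split; lra.
  have hq : `|z.2 - ratr q| < ratr r by rewrite ltr_norml; apply/andP; split; lra.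
  exists (p, q, r) => _; split => //= z' Zz' h1 h2; apply: he => //.
    have -> : z'.1 - z.1 = (z'.1 - ratr p) - (z.1 - ratr p) by ring.
    by rewrite (le_lt_trans (ler_normB _ _))//; lra.
  have -> : z'.2 - z.2 = (z'.2 - ratr q) - (z.2 - ratr q) by ring.
  by rewrite (le_lt_trans (ler_normB _ _))//; lra.
have [f hf] := choice key.
apply: (@sub_countable _ _ _ [set: rat * rat * rat]); last exact: countableP.
apply/pcard_injP; exists f => z z' /set_mem Zz /set_mem Zz' E.
have [a1 a2 _] := hf z Zz; have [_ _ a3] := hf z' Zz'.
by apply: a3 => //; rewrite -E.
Qed.

(** Countable sets have Lebesgue measure zero, whereas the interval has measure [b - a]. *)
Lemma real_uncountable (A : set R) (a b : R) : a < b -> (forall x, a < x < b -> A x) ->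
  ~ countable A.
Proof.
move=> ab hA cA.
have c1 : countable `]a, b[%classic.
  by apply: sub_countable cA; apply: subset_card_le => x; rewrite /= in_itv/= => /hA.
have := countable_lebesgue_measure0 c1.
rewrite lebesgue_measure_itv/= lte_fin ab -EFinB => -[] /eqP.
by rewrite subr_eq0 gt_eqF.
Qed.

Lemma countable_line_cover (n : nat) (L : set R) (E : R -> ('I_n -> R) -> Prop) :
  countable L -> (forall w, exists2 l, L l & E l w) ->
  (forall l w i, (forall t, E l (fun j => if j == i then t else w j)) \/
     countable [set t | E l (fun j => if j == i then t else w j)]) ->
  exists2 l, L l & forall w, E l w.
Proof.
move=> cL cover dich.
suff [l Ll hl] : exists2 l, L l & forall w', (forall i, i \notin enum 'I_n -> w' i = 0) -> E l w'.
  by exists l => // w; apply: hl => i; rewrite mem_enum.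
(* Free the coordinates in [s] one at a time: countably many countable sets do
   not cover a line. *)
suff : forall (s : seq 'I_n) w, exists2 l, L l & forall w', (forall i : 'I_n, i \notin s -> w' i = w i) -> E l w'.
  by move=> /(_ (enum 'I_n) (fun=> 0)).
elim=> [|i s IH] w.
  have [l Ll hl] := cover w; exists l => // w' hw'.
  by have -> : w' = w by apply/funext => i; exact: hw'.
pose upd (v : 'I_n -> R) t := fun j => if j == i then t else v j.
(* The values of coordinate [i] for which [l] serves all choices of the coordinates already freed.
   By induction these sets cover the line, so some [U l] is uncountable; this excludes the countable
   alternative for that [l], whatever the freed coordinates. *)
pose U l := [set t | forall w', (forall j, j \notin s -> w' j = upd w t j) -> E l w'].
have [l Ll ncl] : exists2 l, L l & ~ countable (U l).
  apply: contrapT => H.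
  have hc l : L l -> countable (U l).
    by move=> Ll; apply: contrapT => nc; apply: H; exists l.
  have := @bigcup_countable _ _ L U cL hc.
  apply: (@real_uncountable _ 0 1) => // t _.
  by have [l Ll hl] := IH (upd w t); exists l.
exists l => // w' hw'.
have [hall|hcount] := dich l w' i.
  have := hall (w' i); congr (E l _); apply/funext => j.
  by case: eqP => [->|].
exfalso; apply: ncl; apply: sub_countable hcount; apply: subset_card_le => t Ut /=.
apply: Ut => j js; rewrite /upd; case: eqP => // /eqP ji.
by apply: hw'; rewrite inE negb_or ji.
Qed.

End Countability.

(** * Hits along one analytic curve of directions *)

Section CurveOfDirections.
Variables (R : realType) (n : nat) (M : analyticManifold R n) (h : analyticMetric M).
Lemma good_continuous alpha th0 T : good h alpha th0 T ->
  {for th0, continuous (fun th => alpha th T)}.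
Proof.
move=> [phi [rho [aq [ap [hphi rho0 hg]]]]].
have z1 : `|0 : R| < 1 by rewrite normr0.
have [d0 _ _ _ _] := hg 0 z1.
have him : chart_im phi (evrow 0 aq).
  have [e1 e2 _ _ _] := hg 0 z1; rewrite -e2; by eexists; [exact: e1|].
have cq : {for 0, continuous (fun x => chart_inv phi (evrow x aq))}.
  apply: (@continuous_comp _ _ _ (fun x => evrow x aq)).
    exact: (is_derive_continuous (is_derive_evrow aq z1)).
  exact: chart_inv_cont.
have caff : {for th0, continuous (fun th : R => (th - th0) / rho)}.
  apply: cvgM; last exact: cvg_cst.
  by apply: cvgB; [exact: cvg_id|exact: cvg_cst].
have := @continuous_comp _ _ _ (fun th : R => (th - th0) / rho) (fun x => chart_inv phi (evrow x aq)) th0 caff.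
rewrite subrr mul0r => /(_ cq).
have E th : `|th - th0| < rho -> alpha th T = chart_inv phi (evrow ((th - th0) / rho) aq).
  move=> hth; have hx : `|(th - th0) / rho| < 1.
    by rewrite normrM normfV (gtr0_norm rho0) ltr_pdivrMr// mul1r.
  have [e1 e2 _ _ _] := hg _ hx; rewrite -e2 /local_curve chart_mapK//.
  by congr (alpha _ T); rewrite mulrCA mulfV ?gt_eqF// mulr1 addrC subrK.
have Ec : alpha th0 T = chart_inv phi (evrow 0 aq).
  by rewrite E ?subrr ?normr0// mul0r.
move=> cc; have cc' : (fun th => chart_inv phi (evrow ((th - th0) / rho) aq)) @ th0 -->
    chart_inv phi (evrow ((th0 - th0) / rho) aq) := cc.
rewrite subrr mul0r in cc'.
suff : (fun th => alpha th T) @ th0 --> alpha th0 T by [].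
rewrite Ec; apply: cvg_trans cc'; apply: near_eq_cvg; near=> th; apply/esym/E.
by rewrite distrC; near: th; exact: cvgr_dist_lt.
Unshelve. all: by end_near. Qed.

Variables (alpha : R -> R -> M) (y : M).
Hypothesis hgeo : forall th, geodesic h (alpha th).
Hypothesis hgood : forall th, good h alpha th 0.

Let hall th T : good h alpha th T := good_all (hgeo) (hgood th) T.

(** Parameters with a whole neighbourhood of hits form an open set. It is also closed: a limit of
    such parameters is a hit that is not isolated. If the set is empty, every hit is isolated. *)
Lemma hits_all_or_countable t :
  (forall th, alpha th t = y) \/ countable [set th | alpha th t = y].
Proof.
pose P th := exists2 e : R, 0 < e & forall th', `|th' - th| < e -> alpha th' t = y.
have [[th1 P1]|nP] := pselect (exists th, P th).
  left=> th; suff [e e0 he] : P th by apply: he; rewrite subrr normr0.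
  apply: (@interval_clopen R setT P th1) => // {th}.
    move=> th _ [e e0 he]; exists (e / 2); first by rewrite divr_gt0.
    move=> th' _ hth'; exists (e / 2); first by rewrite divr_gt0.
    move=> th2 h2; apply: he.
    have -> : th2 - th = (th2 - th') + (th' - th) by ring.
    by rewrite (le_lt_trans (ler_normD _ _))//; lra.
  move=> th _ hlim.
  have Eth : alpha th t = y.
    apply: (@agree_limit R M (fun th => alpha th t) (fun=> y) th).
    - exact: space_hausdorff.
    - exact: good_continuous.
    - exact: cvg_cst.
    - move=> e e0; have [th2 [_ h2 [e2 e20 he2]]] := hlim e e0.
      by exists th2 => //; apply: he2; rewrite subrr normr0.
  have [//|[e e0 he]] := hits_isolated_or_const hgeo (hall th t) Eth.
  have [th2 [_ h2 [e2 e20 he2]]] := hlim e e0.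
  exfalso.
  have Z th' : alpha th' t = y -> `|th' - th| < e -> th' = th.
    by move=> hz hth'; have [] := he t th' _ hth' hz; rewrite ?subrr ?normr0.
  have E2 : th2 = th by apply: Z => //; apply: he2; rewrite subrr normr0.
  pose d := Num.min e e2 / 2.
  have m0 : 0 < Num.min e e2 by rewrite lt_min e0.
  have me : Num.min e e2 <= e by rewrite ge_min lexx.
  have me2 : Num.min e e2 <= e2 by rewrite ge_min lexx orbT.
  have d0 : 0 < d by rewrite divr_gt0.
  have := Z (th + d); rewrite addrC addrK (gtr0_norm d0) => H.
  have : d + th = th.
    apply: H; last by rewrite /d; lra.
    by apply: he2; rewrite E2 addrK (gtr0_norm d0) /d; lra.
  by move/eqP; rewrite -subr_eq0 addrK gt_eqF.
right.
(* A dummy first coordinate 0 turns this subset of the line into a planar set for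
   [isolated_countable]. *)
have cZ : countable [set z : R * R | z.1 = 0 /\ alpha z.2 t = y].
  apply: isolated_countable => -[a th] /= [-> hth].
  have [Pth|[e e0 he]] := hits_isolated_or_const hgeo (hall th t) hth.
    by exfalso; apply: nP; exists th.
  exists e => // -[a' th'] /= [-> hth'] _ h2; congr pair.
  by have [] := he t th' _ h2 hth'; rewrite ?subrr ?normr0.
apply: (@sub_countable _ _ _ (snd @` [set z : R * R | z.1 = 0 /\ alpha z.2 t = y])).
  by apply: subset_card_le => th /= hth; exists (0, th).
exact: (sub_countable (card_image_le _ _) cZ).
Qed.

Lemma common_hit_time : (forall th, exists2 t : R, 0 < t & alpha th t = y) ->
  exists2 t : R, 0 < t & forall th, alpha th t = y.
Proof.
move=> hhit; apply: contrapT => hno.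
have cZ : countable [set z : R * R | 0 < z.1 /\ alpha z.2 z.1 = y].
  apply: isolated_countable => -[t th] /= [t0 hth].
  have [[e e0 he]|[e e0 he]] := hits_isolated_or_const hgeo (hall th t) hth.
    (* A time that works on an interval of parameters works for all of them, since the alternative
       would make that interval countable. *)
    exfalso; apply: hno; exists t => //.
    have [//|hc] := hits_all_or_countable t.
    exfalso; apply: (@real_uncountable _ _ (th - e) (th + e) _ _ hc); first by lra.
    by move=> th' /andP[h1 h2] /=; apply: he; rewrite ltr_norml; apply/andP; split; lra.
  exists e => // -[t' th'] /= [_ hth'] h1 h2.
  by have [-> ->] := he t' th' h1 h2 hth'.
have : countable [set: R].
  apply: (@sub_countable _ _ _ (snd @` [set z : R * R | 0 < z.1 /\ alpha z.2 z.1 = y])).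
    apply: subset_card_le => th _ /=; have [t t0 ht] := hhit th.
    by exists (t, th).
  exact: (sub_countable (card_image_le _ _) cZ).
by apply: (@real_uncountable R _ 0 1).
Qed.

End CurveOfDirections.

(** * Families with analytic initial velocity; uniqueness of geodesics *)

Section AnalyticDirections.
Variables (R : realType) (n : nat) (M : analyticManifold R n) (h : analyticMetric M).
Local Notation RR := (real_ban R).
Local Notation A1 := (ls_ban RR).

Definition fan1 (f : R -> R) (t : R) := fan (fun z : unit -> R => f (z tt)) (fun=> t).

Lemma evR_affine (a r x : R) : `|x| <= 1 ->
  evR x (emb A1 a + emb A1 r * lsX RR) = a + r * x :> R.
Proof.
move=> hx; have [hA hM hE] := evR_mor hx; transitivity (evR x (emb A1 a) + evR x (emb A1 r * lsX RR)).
  exact: hA.1.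
have -> : evR x (emb A1 r * lsX RR) = evR x (emb A1 r) * evR x (lsX RR) :> R by exact: hM.
have -> : evR x (emb A1 a) = a :> R by exact: hE.
have -> : evR x (emb A1 r) = r :> R by exact: hE.
by congr (a + r * _); exact: (@evr_X R RR x hx).
Qed.

(** All members start at [x], so the position series is constant at time 0 and the orthogonality
    clause holds trivially there. *)
Lemma good_initial (alpha : R -> R -> M) (x : M) phi (c : R -> 'rV[R]_n) th0 :
  atlas phi -> chart_dom phi x -> (forall th, alpha th 0 = x) ->
  (forall th, velocity phi (alpha th) 0 = c th) ->
  (forall th, mform h phi (chart_map phi x) (c th) (c th) = 1) ->
  (forall k, fan1 (fun th => c th 0 k) th0) -> good h alpha th0 0.
Proof.
move=> hphi hd h0 hv hu hc.
have [r [C [r0 _ hb]]] := fan_apply_common hc.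
pose w (_ : unit) : A1 := emb A1 th0 + emb A1 r * lsX RR.
have hw : in_ball (fun=> th0) r w.
  move=> i; rewrite /w addrC addrA addNr add0r (le_trans (nm_embM _ _))// (gtr0_norm r0).
  by rewrite -[leRHS]mulr1 ler_wpM2l ?(ltW r0)//; exact: nm_lsX.
have [ap hap] := hb A1 w hw.
pose aq (i : 'I_n) : A1 := emb A1 (chart_map phi x 0 i).
have Eq z : `|z| <= 1 -> evrow z aq = chart_map phi x.
  by move=> hz; apply/rowP => i; rewrite evrowE; have [_ _ hE] := evR_mor hz; exact: hE.
have Ep z : `|z| <= 1 -> evrow z ap = c (th0 + r * z).
  move=> hz; apply/rowP => i; rewrite evrowE (hap _ (evR_mor hz)).
  by rewrite (evR_affine _ _ hz).
exists phi, r, aq, ap; split => // z /ltW hz /=; rewrite Eq// Ep//.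
split; [by rewrite h0|by rewrite /local_curve h0|exact: hv|exact: hu|].
have -> : devrow z aq = 0.
  by apply/rowP => i; rewrite devrowE mxE; exact: (@dser_const R RR).
by rewrite /mform !mul0mx mxE.
Qed.

(** The family equal to [alpha] at parameter 0 and to [beta] elsewhere has constant initial data,
    hence is good. Continuity in the parameter at time [t] makes [alpha t] the limit of the constant
    [beta t]. *)
Lemma geodesic_unique (alpha beta : R -> M) phi : atlas phi -> chart_dom phi (alpha 0) ->
  geodesic h alpha -> geodesic h beta -> beta 0 = alpha 0 ->
  velocity phi beta 0 = velocity phi alpha 0 ->
  mform h phi (chart_map phi (alpha 0)) (velocity phi alpha 0) (velocity phi alpha 0) = 1 ->
  forall t, alpha t = beta t.
Proof.
move=> hphi hd ga gb h0 hv hu t.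
pose al (th : R) := if th == 0 then alpha else beta.
have hgeo th : geodesic h (al th) by rewrite /al; case: ifP.
have g0 : good h al 0 0.
  apply: (@good_initial al (alpha 0) phi (fun=> velocity phi alpha 0)) => // [th|th|k].
  - by rewrite /al; case: ifP.
  - by rewrite /al; case: ifP.
  - exact: fan_const.
have ct := good_continuous (good_all hgeo g0 t).
have -> : alpha t = al 0 t by rewrite /al eqxx.
apply: (@agree_limit R M (fun th => al th t) (fun=> beta t) 0) => //.
- exact: space_hausdorff.
- exact: cvg_cst.
- move=> e e0; exists (e / 2); first by rewrite subr0 gtr0_norm; lra.
  by rewrite /al gt_eqF// divr_gt0.
Qed.

Lemma is_derive_isolated (f : R -> R) (t d : R) : is_derive t 1 f d -> d != 0 ->
  exists2 e : R, 0 < e & forall s, `|s - t| < e -> f s = f t -> s = t.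
Proof.
move=> [df fd] d0.
have := df; rewrite /derivable => /cvg_ex[l hl].
have El : l = d by rewrite -fd; apply/esym/cvg_lim.
rewrite El in hl; move/cvgrPdist_lt : hl => /(_ `|d|); rewrite normr_gt0 => /(_ d0).
rewrite near_withinE => /nbhs_ballP[e /= e0 he]; exists e => // s hs fs.
apply/eqP/negPn/negP => st.
have := he (s - t); rewrite /ball/= sub0r normrN => /(_ hs).
rewrite subr_eq0 => /(_ st).
by rewrite /GRing.scale/= mulr1 subrK fs subrr mulr0 subr0 ltxx.
Qed.

(** As a constant family the geodesic has unit speed at all times, by [good_all]. Some component of
    its velocity is then nonzero at each hit, which isolates the hit in time. *)
Lemma hit_times_countable (alpha : R -> M) (y : M) : geodesic h alpha ->
  (forall th, good h (fun=> alpha) th 0) -> countable [set t | alpha t = y].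
Proof.
move=> ga g0.
have cZ : countable [set z : R * R | z.1 = 0 /\ alpha z.2 = y].
  apply: isolated_countable => -[a t] /= [-> ht].
  have [phi [rho [aq [ap hg]]]] := good_all (alpha := fun=> alpha) (fun=> ga) (g0 0) t.
  have [hphi _ /(_ 0)] := hg; rewrite normr0 => /(_ ltr01) /= [d1 d2 d3 d4 _].
  have [dl _] := geodesic_derive ga hphi d1.
  have [k hk] : exists k, velocity phi alpha t 0 k != 0.
    apply/existsP; apply: contrapT => /negP; rewrite negb_exists => /forallP H.
    have E0 : evrow 0 ap = 0.
      by rewrite -d3; apply/rowP => k; have := H k; rewrite negbK mxE => /eqP.
    by move: d4; rewrite E0 /mform !mul0mx mxE => /esym/eqP; rewrite oner_eq0.
  have [e e0 he] := is_derive_isolated ((is_derive_rowP _ _ _).1 dl k) hk.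
  exists e => // -[a' t'] /= [-> ht'] _ h2; congr pair.
  by apply: he => //; rewrite /local_curve ht ht'.
apply: (@sub_countable _ _ _ (snd @` [set z : R * R | z.1 = 0 /\ alpha z.2 = y])).
  by apply: subset_card_le => t /= ht; exists (0, t).
exact: (sub_countable (card_image_le _ _) cZ).
Qed.

End AnalyticDirections.

(** * Reflections, and one hit time for the whole unit sphere *)

Section Reflections.
Variables (R : realType) (n : nat) (M : analyticManifold R n) (h : analyticMetric M).
Variables (x y : M) (phi : chart R n M).
Hypotheses (hphi : atlas phi) (hd : chart_dom phi x).
Hypothesis hcomplete : complete_metric h.
Hypothesis hZ : Z_manifold h x y.

Let Q (a b : 'rV[R]_n) : R := mform h phi (chart_map phi x) a b.

Let him : chart_im phi (chart_map phi x).
Proof. by exists x. Qed.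

Let QZl c v w : Q (c *: v) w = c * Q v w. Proof. exact: mformZl. Qed.
Let QC v w : Q v w = Q w v. Proof. by apply: mform_sym. Qed.
Let QDl v v' w : Q (v + v') w = Q v w + Q v' w.
Proof. by rewrite /Q /mform !mulmxDl mxE. Qed.
Let QZr c v w : Q w (c *: v) = c * Q w v. Proof. by rewrite QC QZl QC. Qed.
Let QDr v v' w : Q w (v + v') = Q w v + Q w v'.
Proof. by rewrite QC QDl !(QC w). Qed.
Let Q_gt0 v : v != 0 -> 0 < Q v v. Proof. exact: gram_posdef. Qed.
Let Q_neq0 v : v != 0 -> Q v v != 0. Proof. by move=> /Q_gt0/lt0r_neq0. Qed.

Let Q0 : Q 0 0 = 0. Proof. by have := QZl 0 0 0; rewrite scale0r mul0r. Qed.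

(* The reflection of [b] in the line of [w]. *)
Definition refl (b w : 'rV[R]_n) := (2 * Q w b / Q w w) *: w - b.

Lemma refl_unit b w : Q b b = 1 -> w != 0 -> Q (refl b w) (refl b w) = 1.
Proof.
move=> hb /Q_neq0 w0; rewrite /refl -scaleN1r.
by rewrite !(QDl, QDr, QZl, QZr) hb (QC b w); field.
Qed.

Lemma reflZ b w (c : R) : c != 0 -> refl b (c *: w) = refl b w.
Proof.
move=> c0; rewrite /refl scalerA !(QZl, QZr); congr (_ *: _ - _).
have [/eqP w0|w0] := boolP (Q w w == 0); first by rewrite w0 !(mulr0, invr0, mul0r).
by field; apply/andP.
Qed.

Lemma refl_self b : Q b b = 1 -> refl b b = b.
Proof. by move=> hb; rewrite /refl hb mulr1 divr1 scaler_nat mulr2n addrK. Qed.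

Lemma unit_neq0 v : Q v v = 1 -> v != 0.
Proof. by move=> hv; apply/eqP => v0; move: hv; rewrite v0 Q0 => /esym/eqP; rewrite oner_eq0. Qed.

(** The bisector [v + b] works unless [v = - b]. In that case any nonzero vector orthogonal to [b]
    works, and a combination of two coordinate vectors provides one. *)
Lemma unit_refl b v : (2 <= n)%N -> Q b b = 1 -> Q v v = 1 ->
  exists2 w, w != 0 & v = refl b w.
Proof.
move=> hn hb hv; have [vb|vb] := eqVneq (v + b) 0; last first.
  exists (v + b) => //; have := Q_neq0 vb; rewrite /refl !(QDl, QDr) hb hv (QC b v) => q0.
  rewrite (_ : 2 * _ / _ = 1); first by rewrite scale1r addrK.
  by field.
pose e0 : 'rV[R]_n := delta_mx 0 (Ordinal (ltnW hn)).
pose e1 : 'rV[R]_n := delta_mx 0 (Ordinal hn).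
suff [w w0 wb] : exists2 w, w != 0 & Q w b = 0.
  exists w => //; rewrite /refl wb mulr0 mul0r scale0r add0r.
  by apply/eqP; rewrite -addr_eq0; apply/eqP.
have [q0|q0] := eqVneq (Q e0 b) 0.
  exists e0 => //; apply/eqP => /rowP/(_ (Ordinal (ltnW hn))).
  by rewrite !mxE !eqxx /= => /eqP; rewrite oner_eq0.
exists (e1 + (- (Q e1 b / Q e0 b)) *: e0); last first.
  by rewrite QDl QZl; field.
apply/eqP => /rowP/(_ (Ordinal hn)); rewrite !mxE !eqxx /= mulr0 addr0.
by move=> /eqP; rewrite oner_eq0.
Qed.

Lemma fan1_id (t : R) : fan1 id t. Proof. exact: (@fan_proj R unit tt). Qed.
Lemma fan1_line (w d : 'rV[R]_n) i t : fan1 (fun s => (w + s *: d) 0 i) t.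
Proof.
rewrite (_ : (fun s => _) = (fun s => w 0 i + s * d 0 i)).
  by apply: fan_add; [exact: fan_const|apply: fan_mul; [exact: fan1_id|exact: fan_const]].
by apply/funext => s; rewrite !mxE.
Qed.

Lemma fan1_Q (v w : R -> 'rV[R]_n) t : (forall i, fan1 (fun s => v s 0 i) t) ->
  (forall i, fan1 (fun s => w s 0 i) t) -> fan1 (fun s => Q (v s) (w s)) t.
Proof.
move=> hv hw; rewrite (_ : (fun s => _) = (fun s => \sum_i \sum_j
   v s 0 i * gram h phi (chart_map phi x) i j * w s 0 j)).
  apply: (@fan_sum R unit _ _ _ (fun i z => \sum_j
    v (z tt) 0 i * gram h phi (chart_map phi x) i j * w (z tt) 0 j)) => i _.
  apply: (@fan_sum R unit _ _ _ (fun j z =>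
    v (z tt) 0 i * gram h phi (chart_map phi x) i j * w (z tt) 0 j)) => j _.
  by apply: fan_mul; [apply: fan_mul; [exact: hv|exact: fan_const]|exact: hw].
by apply/funext => s; rewrite /Q mformE.
Qed.

Lemma fan1_refl b (w d : 'rV[R]_n) k t : w + t *: d != 0 ->
  fan1 (fun s => refl b (w + s *: d) 0 k) t.
Proof.
move=> w0; have hl i := fan1_line w d i t.
rewrite (_ : (fun s => _) = (fun s => 2 * Q (w + s *: d) b * (Q (w + s *: d) (w + s *: d))^-1 *
   (w + s *: d) 0 k + - b 0 k)).
  apply: fan_add; last exact: fan_const.
  apply: fan_mul; last exact: hl.
  apply: fan_mul.
    apply: fan_mul; first exact: fan_const.
    exact: (@fan1_Q (fun s => w + s *: d) (fun=> b) t hl (fun i => fan_const _ _)).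
  apply: (@fan_inv R unit (fun z => Q (w + z tt *: d) (w + z tt *: d))).
    exact: (@fan1_Q (fun s => w + s *: d) (fun s => w + s *: d) t hl hl).
  exact: Q_neq0.
by apply/funext => s; rewrite /refl !mxE.
Qed.

Lemma geodesic_family : exists X : 'rV[R]_n -> R -> M, forall v,
  [/\ geodesic h (X v), X v 0 = x & velocity phi (X v) 0 = v].
Proof.
by have /choice[X hX] := fun v => hcomplete v hphi hd; exists X.
Qed.

Section Family.
Variable X : 'rV[R]_n -> R -> M.
Hypothesis hX : forall v, [/\ geodesic h (X v), X v 0 = x & velocity phi (X v) 0 = v].

Let geoX v : geodesic h (X v). Proof. by case: (hX v). Qed.

Lemma unit_hits v : Q v v = 1 -> exists2 t : R, 0 < t & X v t = y.
Proof.
move=> hv; have [g X0 vX] := hX v; apply: hZ => //.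
apply: contrapT => hc; move: (unit_neq0 hv); rewrite -vX => /eqP; apply.
rewrite /velocity (_ : local_curve phi (X v) = cst (chart_map phi (X v 0))).
  by rewrite derive1_cst.
apply/funext => s; rewrite /local_curve /=; congr chart_map.
by apply: contrapT => hs; apply: hc; exists s.
Qed.

Lemma good_unit_family (c : R -> 'rV[R]_n) th : (forall s, Q (c s) (c s) = 1) ->
  (forall k, fan1 (fun s => c s 0 k) th) -> good h (fun s => X (c s)) th 0.
Proof.
by move=> hc hf; apply: (good_initial hphi hd) hc hf => s; case: (hX (c s)).
Qed.

Lemma uniform_hit b : (2 <= n)%N -> Q b b = 1 ->
  exists2 l : R, 0 < l & forall w, w != 0 -> X (refl b w) l = y.
Proof.
move=> hn hb.
pose L : set R := [set l | 0 < l /\ X b l = y].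
have cL : countable L.
  have := @hit_times_countable R n M h (X b) y (geoX b) _.
  move=> H; apply: (@sub_countable _ _ _ [set t | X b t = y]).
    by apply: subset_card_le => t [].
  by apply: H => th; apply: (@good_unit_family (fun=> b)) => // k; exact: fan_const.
have line_good w d th : (forall s, w + s *: d != 0) ->
    good h (fun s => X (refl b (w + s *: d))) th 0.
  move=> w0; apply: (@good_unit_family (fun s => refl b (w + s *: d))) => [s|k].
    exact: refl_unit.
  exact: fan1_refl.
have [l0 l00 Xl0] := unit_hits hb.
(* The excluded value [w = 0] counts as a hit at every time, so that [E] is defined on the full
   coordinate space required by [countable_line_cover]. *)
pose E l (w : 'I_n -> R) := rv w = 0 \/ X (refl b (rv w)) l = y.
have cover w : exists2 l, L l & E l w.
  have [w0|w0] := eqVneq (rv w) 0; first by exists l0 => //; left.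
  have [[c wc]|nc] := pselect (exists c : R, rv w = c *: b).
    exists l0 => //; right; rewrite wc reflZ; first by rewrite refl_self.
    by apply: contraNneq w0 => c0; rewrite wc c0 scale0r.
  (* The line from [b] to [w] could meet 0 only if [w] were a multiple of [b], the case just
     settled. It can therefore serve as a curve of directions that starts at [b]. *)
  have nz s : b + s *: (rv w - b) != 0.
    apply/eqP => hs; apply: nc; have [s0|s0] := eqVneq s 0.
      by move: hs; rewrite s0 scale0r addr0 => b0; move: (unit_neq0 hb); rewrite b0 eqxx.
    exists ((s - 1) / s); apply: (scalerI s0); rewrite scalerA mulrCA mulfV// mulr1.
    rewrite scalerBl scale1r; apply/eqP; rewrite -subr_eq0 -hs scalerBr; apply/eqP.
    by rewrite opprB addrCA addrC -addrA [- _ + _]addrC.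
  have [|||l lp hl] := @common_hit_time R n M h (fun s => X (refl b (b + s *: (rv w - b)))) y.
  - by move=> th; exact: geoX.
  - by move=> th; exact: line_good.
  - by move=> th; apply: unit_hits; exact: refl_unit.
  exists l; first by split => //; have := hl 0; rewrite scale0r addr0 refl_self.
  by right; have := hl 1; rewrite scale1r addrC subrK.
have dich l w i : (forall t, E l (fun j => if j == i then t else w j)) \/
     countable [set t | E l (fun j => if j == i then t else w j)].
  pose w' := rv (fun j => if j == i then 0 else w j).
  have Et t : rv (fun j => if j == i then t else w j) = w' + t *: delta_mx 0 i.
    apply/rowP => j; rewrite !mxE eqxx /=; case: eqP => _; first by rewrite mulr1 add0r.
    by rewrite mulr0 addr0.
  (* If [w'] is 0 the line passes through the origin; the reflection is constant on it off 0, so the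
     hits are the whole line or at most the point 0. Any other line in direction [i] avoids the
     origin. *)
  have [w0|w0] := eqVneq w' 0.
    have [hi|hi] := pselect (X (refl b (delta_mx 0 i)) l = y).
      left=> t; rewrite /E Et w0 add0r; have [->|t0] := eqVneq t 0.
        by left; rewrite scale0r.
      by right; rewrite reflZ.
    right; apply: (@sub_countable _ _ _ [set 0 : R]); last exact: countable1.
    apply: subset_card_le => t; rewrite /= /E Et w0 add0r => -[ht|ht].
      by move/rowP: ht => /(_ i); rewrite !mxE !eqxx mulr1.
    by apply/eqP/negPn/negP => t0; apply: hi; rewrite -(reflZ _ _ t0).
  have nz t : w' + t *: delta_mx 0 i != 0.
    apply: contraNneq w0 => /rowP ht; apply/eqP/rowP => j; rewrite !mxE.
    by have := ht j; rewrite !mxE eqxx /=; case: eqP => // _; rewrite mulr0 addr0.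
  have [||hall|hc] := @hits_all_or_countable R n M h (fun s => X (refl b (w' + s *: delta_mx 0 i))) y _ _ l.
  - by move=> th; exact: geoX.
  - by move=> th; exact: line_good.
  - by left=> t; right; rewrite Et.
  - right; apply: sub_countable hc; apply: subset_card_le => t; rewrite /= /E Et.
    by case=> // /eqP; rewrite (negbTE (nz t)).
have [l [lp _] hl] := countable_line_cover cL cover dich.
exists l => // w w0; have [] := hl (fun i => w 0 i); rewrite rvK//.
by move/eqP; rewrite (negbTE w0).
Qed.

End Family.

Lemma Y_of_Z : (2 <= n)%N -> exists2 l : R, 0 < l & Y_manifold h x y l.
Proof.
move=> hn; have [X hX] := geodesic_family.
pose e0 : 'rV[R]_n := delta_mx 0 (Ordinal (ltnW hn)).
have e00 : e0 != 0.
  apply/eqP => /rowP/(_ (Ordinal (ltnW hn))).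
  by rewrite !mxE !eqxx /= => /eqP; rewrite oner_eq0.
pose b := (Num.sqrt (Q e0 e0))^-1 *: e0.
have hb : Q b b = 1.
  rewrite QZl QZr mulrA -invfM -expr2 sqr_sqrtr ?mulVf ?Q_neq0//.
  by rewrite ltW// Q_gt0.
have [l lp hl] := uniform_hit hX hn hb.
exists l => // alpha ga a0 hu.
have ha : chart_dom phi (alpha 0) by rewrite a0.
have := hu phi hphi ha; rewrite /= /local_curve a0.
rewrite -/(mform h phi (chart_map phi x) _ _) -/(Q _ _) => hv.
have [w w0 Ew] := unit_refl hn hb hv.
have [gX X0 vX] := hX (velocity phi alpha 0).
(* The members of [X] were chosen arbitrarily; uniqueness transfers their hit time to the given
   geodesic. *)
rewrite (geodesic_unique hphi ha ga gX) ?a0 ?X0//.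
by rewrite Ew; exact: hl.
Qed.

End Reflections.

Theorem mainTheorem5 (R : realType) (n : nat) (hn : (2 <= n)%N)
    (M : analyticManifold R n) (h : analyticMetric M)
    (hcomplete : complete_metric h) (x y : M) (hZ : Z_manifold h x y) :
  exists2 l : R, 0 < l & Y_manifold h x y l.
Proof.
by have [phi hphi hd] := atlas_cover x; exact: Y_of_Z hphi hd hcomplete hZ hn.
Qed.
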